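(* For any RES-graph $(G,\gamma,b)$, $$\tilde{\nu}(G,\gamma,b)=\min_{\gamma',X}\Big(\gamma'(E(X))+\tfrac12|\delta(X)|-\mathrm{odd}_{\gamma'}(G-X)\Big),$$ where the minimum is taken over all shiftings $\gamma'$ of $\gamma$ and all sets of vertices $X\subseteq V(G)$ with $b\in X$.
   Context: Graphs are finite and may have loops and multiple edges. Each edge consists of two half-edges; each half-edge is incident to a vertex, and a loop has both half-edges at the same vertex, so it contributes $2$ to that vertex's degree. An arc is an ordered pair $(h_1,h_2)$ of half-edges forming an edge; its tail is the vertex of $h_1$ and its head is the vertex of $h_2$. A trail is a sequence of arcs whose edges are pairwise distinct and such that the head of each arc (other than the last) is the tail of the next. Its tail is the tail of its first arc, and its head is the head of its last arc. A circuit is a trail whose head equals its tail. A circuit hits a vertex $v$ if it contains an arc incident to $v$. A circuit-decomposition of $G$ is a collection of circuits such that every edge of $G$ is used by exactly one circuit of the collection. A graph is Eulerian if it is connected and every vertex has even degree. A signature of $G$ is a function $\gamma:E(G)\to\mathbb{Z}_2$. The weight of a trail is the sum in $\mathbb{Z}_2$ of $\gamma$ over its edges, and a trail (or edge) is zero or non-zero according to its weight. Shifting at a vertex $v$ means adding $1$ to the weight of every non-loop edge incident to $v$. A shifting of $\gamma$ is any signature obtainable from $\gamma$ by a sequence of shiftings at vertices. An RES-graph is a triple $(G,\gamma,b)$ where $G$ is an Eulerian graph, $\gamma$ is a signature of $G$, and $b\in V(G)$ is called the root. The flooding number $\tilde{\nu}(G,\gamma,b)$ is the maximum size of a circuit-decomposition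 of $G$ in which every circuit is non-zero and hits $b$; it is $0$ if no such decomposition exists. For $X\subseteq V(G)$, $E(X)$ is the set of edges with both ends in $X$, and $\delta(X)$ is the set of edges with exactly one end in $X$. $G-X$ is the subgraph induced on $V(G)\setminus X$. For a set of edges $F$ and a signature $\gamma'$, $\gamma'(F)$ denotes the number of edges of $F$ with weight $1$ under $\gamma'$. A vertex set $Y$ is $\gamma'$-odd if the parity of $\gamma'(E(Y)\cup\delta(Y))$ differs from the parity of $|\delta(Y)|/2$. Finally, $\mathrm{odd}_{\gamma'}(G-X)$ is the number of components of $G-X$ whose vertex set is $\gamma'$-odd. *)

(* Defs.v *)
From mathcomp Require Import all_boot.
From mathcomp Require Import boolp.
From mathcomp Require Import all_order all_algebra.

Set Implicit Arguments.
Unset Strict Implicit.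
Unset Printing Implicit Defensive.

(* A graph (loops and multiple edges allowed) is given by a finite vertex type
   V, a finite edge type E and, for each edge e, its two half-edges, encoded as
   the pair ends e = (end of half-edge 0, end of half-edge 1).
   Z_2 is represented by bool (addition = addb, 1 = true). *)

Section RES.
Variables (V E : finType) (ends : E -> V * V).

(* An arc (e, d): d = false is the ordered pair (h0, h1), d = true is (h1, h0). *)
Definition arc := (E * bool)%type.
Definition atail (a : arc) : V := if a.2 then (ends a.1).2 else (ends a.1).1.
Definition ahead (a : arc) : V := if a.2 then (ends a.1).1 else (ends a.1).2.

Definition trail (t : seq arc) : bool :=
  uniq (map fst t) &&
  (match t with [::] => true
   | a :: t' => path (fun x y => ahead x == atail y) a t' end).

Definition circuit (t : seq arc) : bool :=
  match t with
  | [::] => false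
  | a :: t' => trail t && (ahead (last a t') == atail a)
  end.

Definition hits (t : seq arc) (v : V) : bool :=
  has (fun a => (atail a == v) || (ahead a == v)) t.

Definition circuit_decomposition (D : seq (seq arc)) : bool :=
  all circuit D && [forall e : E, count (fun c => e \in map fst c) D == 1].

Definition weight (gamma : E -> bool) (t : seq arc) : bool :=
  foldr addb false (map (fun a => gamma a.1) t).

Definition flooding_decomposition (gamma : E -> bool) (b : V)
    (D : seq (seq arc)) : Prop :=
  circuit_decomposition D /\
  all (fun c => weight gamma c && hits c b) D.

(* maximum size of such a decomposition, 0 if none exists; sizes are at most
   #|E| since circuits are nonempty and edge-disjoint. *)
Definition flooding_number (gamma : E -> bool) (b : V) : nat :=
  \max_(k < #|E|.+1 | `[< exists D, flooding_decomposition gamma b D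
                                    /\ size D = k >]) k.

Definition degree (v : V) : nat :=
  \sum_(e : E) (((ends e).1 == v) + ((ends e).2 == v)).

Definition adj (u v : V) : bool :=
  [exists e : E, (ends e == (u, v)) || (ends e == (v, u))].

Definition eulerian : Prop :=
  (forall u v : V, connect adj u v) /\ (forall v : V, ~~ odd (degree v)).

Definition shift_at (gamma : E -> bool) (v : V) : E -> bool :=
  fun e => if ((ends e).1 != (ends e).2) &&
              (((ends e).1 == v) || ((ends e).2 == v))
           then ~~ gamma e else gamma e.

Definition is_shifting (gamma gamma' : E -> bool) : Prop :=
  exists vs : seq V, gamma' =1 foldl shift_at gamma vs.

Definition E_in (X : {set V}) : {set E} :=
  [set e | ((ends e).1 \in X) && ((ends e).2 \in X)].
Definition delta (X : {set V}) : {set E} :=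
  [set e | ((ends e).1 \in X) (+) ((ends e).2 \in X)].

Definition gcount (gamma : E -> bool) (F : {set E}) : nat :=
  #|[set e in F | gamma e]|.

Definition gamma_odd (gamma : E -> bool) (Y : {set V}) : bool :=
  odd (gcount gamma (E_in Y :|: delta Y)) != odd (#|delta Y| %/ 2).

Definition adj_minus (X : {set V}) (u v : V) : bool :=
  (u \notin X) && (v \notin X) && adj u v.

Definition components_minus (X : {set V}) : {set {set V}} :=
  [set [set v | connect (adj_minus X) u v] | u in ~: X].

Definition odd_components (gamma : E -> bool) (X : {set V}) : nat :=
  #|[set C in components_minus X | gamma_odd gamma C]|.

Definition bound_value (gamma : E -> bool) (X : {set V}) : int :=
  (gcount gamma (E_in X) + #|delta X| %/ 2)%:Z - (odd_components gamma X)%:Z.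

End RES.

(* Main.v *)
Require Import Defs.
From mathcomp Require Import all_boot boolp all_order all_algebra.
From mathcomp Require Import zify.

Set Implicit Arguments.
Unset Strict Implicit.
Unset Printing Implicit Defensive.

(** Edges are split off at vertices until only loops at the root remain, so
    floodings are reductions of a multigraph and the bound can be followed
    through each single splitting: splitting never increases it, which gives the
    upper bound.

    For equality, induct on the size of the graph, Anderson style.  Among the
    certificates attaining the bound take one with X, and then the number of
    classes, maximal.  By maximality and induction every class C can be reduced
    to non-zero passages only, except that an odd class has one zero passage,
    which may be made to contain any prescribed edge of delta(C).  Read the zero
    edges inside X and the edges of delta(X) as edges to be directed: minimality
    of the bound is exactly Hakimi's condition for an orientation in which all
    edges leave the classes, up to one entering each odd class, and in which
    every vertex of X other than the root is balanced once non-zero edges count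
    as entering at both ends.  A balanced orientation can be contracted at all
    vertices but the root without losing a non-zero edge.

    If the only certificate attaining the bound is X = {b} with one class, an
    odd class is made even by flipping the weight of an edge at b, and for an
    even one some pair of edges at a neighbour of b can be split off without
    decreasing the bound. *)

(** * Splitting reductions *)

(** Parity drives the argument. In an even graph every certificate, under every shift, has a bound
    with the parity of the total weight. Bounds are doubled to avoid halves, so one that misses the
    minimum misses it by at least 4. This slack pays for undoing a splitting (at most 4) or flipping
    a root edge (at most 2); and for [k] of the right parity, a bound of [k] holds as soon as it is
    missed by less than 4.

    Splitting may disconnect the graph. What replaces connectivity is that a set off the root that
    no edge leaves has even weight: the loops it shrinks to pair off and vanish.

    A class is handled by contracting everything outside it to the root. Certificates of the
    contracted graph refine the given one, so its maximality carries over to the smaller graph, and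
    the reductions found there pull back because they split only at vertices that were not
    contracted.

    Zero circuits are harmless: in the connected original graph they can be appended to non-zero
    circuits through the root, so only the non-zero loops need counting. *)

Definition wedge (V : Type) := (V * V * bool)%type.

Section Reduction.
Variable V : eqType.
Implicit Types (A : pred V) (G H K : seq (wedge V)).

(** Permutation and reversal make the list an undirected multigraph. Only zero loops may be deleted:
    each stands for a zero closed trail that can be appended to another circuit later without
    changing that circuit's weight. *)
Inductive red A : seq (wedge V) -> seq (wedge V) -> Prop :=
| red_perm G H : perm_eq G H -> red A G H
| red_rev u v w G : red A ((u, v, w) :: G) ((v, u, w) :: G)
| red_split u v y w1 w2 G : A v ->
    red A ((u, v, w1) :: (v, y, w2) :: G) ((u, y, w1 (+) w2) :: G)
| red_loop v G : A v -> red A ((v, v, false) :: G) G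
| red_trans G H K : red A G H -> red A H K -> red A G K.

Lemma red_refl A G : red A G G.
Proof. exact: red_perm. Qed.

Lemma red_catr A G H K : red A G H -> red A (G ++ K) (H ++ K).
Proof.
elim=> {G H} /=.
- by move=> G H GH; apply: red_perm; rewrite perm_cat2r.
- by move=> u v w G; apply: red_rev.
- by move=> u v y w1 w2 G Av; apply: red_split.
- by move=> v G Av; apply: red_loop.
- by move=> G H L _ GH _ HL; apply: red_trans GH HL.
Qed.

Lemma red_catl A G H K : red A G H -> red A (K ++ G) (K ++ H).
Proof.
move=> GH; apply: (red_trans (red_perm _ _)); first by rewrite perm_catC.
apply: (red_trans (red_catr K GH)); apply: red_perm.
by rewrite perm_catC.
Qed.

Lemma red_cat A G H G' H' :
  red A G H -> red A G' H' -> red A (G ++ G') (H ++ H').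
Proof. by move=> r1 r2; apply: red_trans (red_catr _ r1) (red_catl _ r2). Qed.

Lemma red_cons A e G H : red A G H -> red A (e :: G) (e :: H).
Proof. exact: (@red_catl A G H [:: e]). Qed.

Lemma red_mono A A' G H : (forall v, A v -> A' v) -> red A G H -> red A' G H.
Proof.
move=> sAA'; elim=> {G H}.
- by move=> G H GH; apply: red_perm.
- by move=> u v w G; apply: red_rev.
- by move=> u v y w1 w2 G /sAA'; apply: red_split.
- by move=> v G /sAA'; apply: red_loop.
- by move=> G H L _ GH _ HL; apply: red_trans GH HL.
Qed.

Definition ends_at x (e : wedge V) : nat := (e.1.1 == x) + (e.1.2 == x).
Definition deg G x : nat := \sum_(e <- G) ends_at x e.

Lemma deg_perm G H x : perm_eq G H -> deg G x = deg H x.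
Proof. by move=> GH; apply: perm_big. Qed.

Lemma red_deg A G H x : red A G H -> ~~ A x -> deg G x = deg H x.
Proof.
move=> rGH nAx; elim: rGH => {G H}.
- by move=> G H; apply: deg_perm.
- by move=> u v w G; rewrite /deg !big_cons /ends_at /= [(v == x) + _]addnC.
- move=> u v y w1 w2 G Av; rewrite /deg !big_cons /ends_at /=.
  have -> : (v == x) = false by apply: contraNF nAx => /eqP <-.
  by lia.
- move=> v G Av; rewrite /deg !big_cons /ends_at /=.
  by have -> : (v == x) = false by apply: contraNF nAx => /eqP <-.
- by move=> G H K _ -> _ ->.
Qed.

Lemma red_odd_deg A G H x : red A G H -> odd (deg G x) = odd (deg H x).
Proof.
elim=> {G H}.
- by move=> G H GH; rewrite (deg_perm _ GH).
- by move=> u v w G; rewrite /deg !big_cons /ends_at /= [(v == x) + _]addnC.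
- by move=> u v y w1 w2 G Av; rewrite /deg !big_cons /ends_at /=; lia.
- by move=> v G Av; rewrite /deg !big_cons /ends_at /=; lia.
- by move=> G H K _ -> _ ->.
Qed.

Definition tweight G : bool := odd (\sum_(e <- G) e.2).

Lemma tweight_cons e G : tweight (e :: G) = e.2 (+) tweight G.
Proof. by rewrite /tweight big_cons oddD oddb. Qed.

Lemma tweight_perm G H : perm_eq G H -> tweight G = tweight H.
Proof. by move=> GH; congr odd; apply: perm_big. Qed.

Lemma red_tweight A G H : red A G H -> tweight G = tweight H.
Proof.
elim=> {G H}.
- exact: tweight_perm.
- by move=> u v w G; rewrite !tweight_cons.
- by move=> u v y w1 w2 G Av; rewrite !tweight_cons /= addbA.
- by move=> v G Av; rewrite tweight_cons.
- by move=> G H K _ -> _ ->.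
Qed.

End Reduction.

Section Transport.
Variables (V V' : eqType) (g : V -> V') (s : V -> bool).

(** Contraction and shifting in one map: flipping a root edge will be expressed as a shift at a
    fresh vertex which [g] then identifies with the root. *)
Definition emap (e : wedge V) : wedge V' :=
  (g e.1.1, g e.1.2, e.2 (+) (s e.1.1 (+) s e.1.2)).

Lemma red_map (A : pred V) (A' : pred V') G H :
  (forall v, A v -> A' (g v)) -> red A G H -> red A' (map emap G) (map emap H).
Proof.
move=> sA; elim=> {G H} /=.
- by move=> G H GH; apply/red_perm/perm_map.
- by move=> u v w G; rewrite /emap /= [s u (+) _]addbC; apply: red_rev.
- move=> u v y w1 w2 G /sA Av; rewrite /emap /=.
  have -> : w1 (+) w2 (+) (s u (+) s y) =
     (w1 (+) (s u (+) s v)) (+) (w2 (+) (s v (+) s y)).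
    by case: w1; case: w2; case: (s u); case: (s v); case: (s y).
  exact: red_split.
- by move=> v G /sA Av; rewrite /emap /= addbb; apply: red_loop.
- by move=> G H K _ GH _ HK; apply: red_trans GH HK.
Qed.

Lemma perm_map_lift (T1 T2 : eqType) (f : T1 -> T2) (G : seq T1) (H : seq T2) :
  perm_eq (map f G) H -> exists2 H', perm_eq G H' & H = map f H'.
Proof.
elim: H G => [|y H IH] G GH.
  exists [::]; last by [].
  by move/perm_size: GH; rewrite size_map; case: G.
have /mapP[x xG yE] : y \in map f G by rewrite (perm_mem GH) mem_head.
have GE := perm_to_rem xG.
have GH' : perm_eq (map f (rem x G)) H.
  rewrite -(perm_cons y); apply: perm_trans GH; rewrite perm_sym yE.
  exact: (perm_map f GE).
have [H' p' HE] := IH _ GH'.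
exists (x :: H'); last by rewrite /= yE HE.
by apply: (perm_trans GE); rewrite perm_cons.
Qed.

(* A reduction performed after contracting vertices lifts back as soon as it
   only splits at vertices with a single preimage. *)
Lemma red_lift (A : pred V') G H :
  (forall x y, g x = g y -> A (g x) -> x = y) ->
  red A (map emap G) H ->
  exists2 H', red (fun x => A (g x)) G H' & H = map emap H'.
Proof.
move=> inj; move E: (map emap G) => G0 rGH; elim: rGH G E => {G0 H}.
- move=> G0 H GH G E; move: GH; rewrite -E => /perm_map_lift[H' p ->].
  by exists H' => //; apply: red_perm.
- move=> u v w G0 [|[[u' v'] w'] G] //= [<- <- <- <-].
  exists ((v', u', w') :: G); first exact: red_rev.
  by rewrite /emap /= [s u' (+) _]addbC.
- move=> u v y w1 w2 G0 Av [|[[u' v'] w1'] [|[[v'' y'] w2'] G]] //= [<- E1 <- E2 <- <- <-].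
  have E : v' = v'' by apply: inj; rewrite E1 ?E2.
  rewrite -E in E2 *; exists ((u', y', w1' (+) w2') :: G).
    by apply: red_split; rewrite E1.
  rewrite /emap /=; congr ((_, _, _) :: _).
  by case: w1'; case: w2'; case: (s u'); case: (s v'); case: (s y').
- move=> v G0 Av [|[[u' v'] w'] G] //= [E1 E2 E3 <-].
  have E : u' = v' by apply: inj; rewrite E1 ?E2.
  move: E3; rewrite -E addbb addbF => -> {E}.
  exists G => //; apply: red_loop; by rewrite E1.
- move=> G0 H K _ IH1 _ IH2 G /IH1[H1 r1 E1].
  have [K1 r2 E2] := IH2 _ (esym E1).
  by exists K1 => //; apply: red_trans r1 r2.
Qed.

End Transport.

(** * Certificates *)

Definition even_graph (V : eqType) (G : seq (wedge V)) := forall x, ~~ odd (deg G x).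

Lemma sum_ends (V : finType) (P : pred V) (G : seq (wedge V)) :
  \sum_(x | P x) deg G x = \sum_(e <- G) (P e.1.1 + P e.1.2).
Proof.
rewrite exchange_big /=; apply: eq_bigr => e _; rewrite big_split /=.
have sum1 z : \sum_(i | P i) (z == i) = P z :> nat.
  case Pz: (P z).
    rewrite (bigD1 z) //= eqxx big1 // => i /andP[_ /negbTE].
    by rewrite eq_sym => ->.
  by rewrite big1 // => i Pi; case: eqP => // zi; rewrite zi Pi in Pz.
by rewrite !sum1.
Qed.

(** Handshake: the degree sum over [P] counts inner edges twice, so modulo 2 only the crossing edges
    remain. *)
Lemma even_cut (V : finType) (P : pred V) (G : seq (wedge V)) :
  (forall x, P x -> ~~ odd (deg G x)) ->
  ~~ odd (\sum_(e <- G) (P e.1.1 (+) P e.1.2)).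
Proof.
move=> ev; have : ~~ odd (\sum_(x | P x) deg G x).
  by elim/big_ind: _ => // m n; rewrite oddD => /negbTE-> /negbTE->.
rewrite sum_ends; congr (~~ _); elim: G {ev} => [|e G IH]; first by rewrite !big_nil.
by rewrite !big_cons !oddD IH; case: (P _); case: (P _).
Qed.

Lemma even_cut_graph (V : finType) (P : pred V) (G : seq (wedge V)) :
  even_graph G -> ~~ odd (\sum_(e <- G) (P e.1.1 (+) P e.1.2)).
Proof. by move=> ev; apply: even_cut. Qed.

Section Certificates.
Variables (V N : finType).
Implicit Types (T : V -> option N) (e : wedge V) (G : seq (wedge V)).

(* A certificate [T] sends the vertices of X to [None] and the other ones to the
   name of their class; classes replace the components of G - X, as a union of
   components gives a weaker bound. *)
Definition incl (o : option N) (r : N) : bool := if o is Some a then a == r else false.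

Definition vedge T e : bool :=
  match T e.1.1, T e.1.2 with Some a, Some c => a == c | _, _ => true end.

Definition valid T G := all (vedge T) G.

(* The doubled bound is [cost - 2 * nodd]. *)
Definition cost1 T e : nat :=
  match T e.1.1, T e.1.2 with
  | None, None => e.2.*2
  | Some _, Some _ => 0
  | _, _ => 1
  end.

Definition cost T G := \sum_(e <- G) cost1 T e.

(* A class is odd exactly when its charges add up to 2 modulo 4. *)
Definition charge1 T r e : nat :=
  (incl (T e.1.1) r || incl (T e.1.2) r) * e.2.*2 + (incl (T e.1.1) r (+) incl (T e.1.2) r).

Definition charge T G r := \sum_(e <- G) charge1 T r e.

Definition nodd T G : nat := \sum_(r : N) (charge T G r %% 4 == 2).

Lemma cost_cons T e G : cost T (e :: G) = cost1 T e + cost T G.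
Proof. exact: big_cons. Qed.
Lemma charge_cons T e G r : charge T (e :: G) r = charge1 T r e + charge T G r.
Proof. exact: big_cons. Qed.
Lemma cost_perm T G H : perm_eq G H -> cost T G = cost T H.
Proof. exact: perm_big. Qed.
Lemma charge_perm T G H r : perm_eq G H -> charge T G r = charge T H r.
Proof. exact: perm_big. Qed.
Lemma nodd_perm T G H : perm_eq G H -> nodd T G = nodd T H.
Proof. by move=> GH; apply: eq_bigr => r _; rewrite (charge_perm _ _ GH). Qed.
Lemma valid_perm T G H : perm_eq G H -> valid T G = valid T H.
Proof. exact: perm_all. Qed.

Lemma cost_cat T G H : cost T (G ++ H) = cost T G + cost T H.
Proof. exact: big_cat. Qed.

Lemma charge_even T G r : even_graph G -> ~~ odd (charge T G r).
Proof.
move=> /(even_cut_graph (fun x => incl (T x) r)); congr (~~ _).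
rewrite /charge; elim: G => [|e G IH]; first by rewrite !big_nil.
rewrite !big_cons ![odd (_ + \sum_(_ <- _) _)]oddD IH; congr (_ (+) _).
by rewrite /charge1 oddD oddM odd_double andbF.
Qed.

Lemma charge_sum1 T e : vedge T e ->
  \sum_r charge1 T r e + cost1 T e = e.2.*2 + (isSome (T e.1.1) (+) isSome (T e.1.2)).*2.
Proof.
rewrite /vedge /cost1 /charge1.
have sum1 (a : N) (f : bool -> nat) : f false = 0 -> \sum_r f (a == r) = f true.
  move=> f0; rewrite (bigD1 a) //= eqxx big1 ?addn0 // => i /negbTE.
  by rewrite eq_sym => ->.
case: (T e.1.1) => [a|]; case: (T e.1.2) => [c|] //=.
- move=> /eqP <-; rewrite (sum1 a (fun b => (b || b) * e.2.*2 + (b (+) b))) //=; lia.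
- by move=> _; rewrite (sum1 a (fun b => (b || false) * e.2.*2 + (b (+) false))) //=; lia.
- by move=> _; rewrite (sum1 c (fun b => (false || b) * e.2.*2 + (false (+) b))) //=; lia.
- by move=> _; rewrite big1 //; lia.
Qed.

Lemma charge_sum T G : valid T G ->
  \sum_r charge T G r + cost T G =
  (\sum_(e <- G) e.2).*2 + (\sum_(e <- G) (isSome (T e.1.1) (+) isSome (T e.1.2))).*2.
Proof.
rewrite /charge exchange_big /= /cost; elim: G => [|e G IH /=].
  by rewrite !big_nil.
by move=> /andP[/charge_sum1 h1 /IH h2]; rewrite !big_cons; lia.
Qed.

Lemma nodd_mod T G : even_graph G ->
  \sum_r charge T G r = (nodd T G).*2 %[mod 4].
Proof.
move=> ev; have E r : charge T G r = 2 * (charge T G r %% 4 == 2) + 4 * (charge T G r %/ 4).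
  by have := charge_even T r ev; case: eqP; lia.
rewrite (eq_bigr _ (fun r _ => E r)) big_split -!big_distrr /= -/(nodd T G).
lia.
Qed.

(** By [charge_sum], charges and cost add up to twice the total weight plus twice the size of the
    cut around X. That cut is even, and modulo 4 each charge is 2 or 0 as its class is odd or
    not. *)
Lemma bound_parity T G : even_graph G -> valid T G ->
  cost T G + (nodd T G).*2 = (tweight G).*2 %[mod 4].
Proof.
move=> ev /charge_sum E; have := nodd_mod T ev.
have := even_cut_graph (fun x => isSome (T x)) ev.
move: E; rewrite /tweight.
move: (\sum_r _) (\sum_(e <- G) nat_of_bool e.2) (\sum_(e <- G) _) (cost T G) (nodd T G).
by move=> a c d f g; lia.
Qed.

Lemma cost_even T G : even_graph G -> valid T G -> ~~ odd (cost T G).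
Proof. by move=> ev /(bound_parity ev); lia. Qed.

Lemma nodd_change1 (f g : N -> nat) r : (forall r0, r0 != r -> f r0 = g r0) ->
  \sum_r (f r %% 4 == 2) + (g r %% 4 == 2) = \sum_r (g r %% 4 == 2) + (f r %% 4 == 2).
Proof.
move=> E; rewrite (bigD1 r) //= [in RHS](bigD1 r) //=.
rewrite (eq_bigr (fun i => nat_of_bool (g i %% 4 == 2))); last by move=> i /E ->.
lia.
Qed.

Lemma even_split u v y w1 w2 (R : seq (wedge V)) :
  even_graph [:: (u, v, w1), (v, y, w2) & R] -> even_graph ((u, y, w1 (+) w2) :: R).
Proof.
move=> ev x; have r : red predT [:: (u, v, w1), (v, y, w2) & R] ((u, y, w1 (+) w2) :: R).
  exact: red_split.
by rewrite -(red_odd_deg x r).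
Qed.

Lemma valid_cons T e G : valid T (e :: G) = vedge T e && valid T G.
Proof. by []. Qed.

(** If [T] is valid on both sides, a single class at most feels the splitting, so the doubled bound
    stays or drops by 4. *)
Lemma split_valid T u v y w1 w2 R :
  let G := [:: (u, v, w1), (v, y, w2) & R] in
  let G' := (u, y, w1 (+) w2) :: R in
  even_graph G -> valid T G -> valid T G' ->
  cost T G + (nodd T G').*2 = cost T G' + (nodd T G).*2 \/
  cost T G + (nodd T G').*2 = cost T G' + (nodd T G).*2 + 4.
Proof.
move=> G G' evG; have evG' : even_graph G' by apply: even_split evG.
have key r : (forall r0, r0 != r -> charge T G r0 = charge T G' r0) ->
   [/\ ~~ odd (charge T G r), ~~ odd (charge T G' r) &
   nodd T G + (charge T G' r %% 4 == 2) = nodd T G' + (charge T G r %% 4 == 2)].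
  by move=> h; split; try exact: charge_even; apply: nodd_change1.
have nodd0 : (forall r, charge1 T r (u, v, w1) + charge1 T r (v, y, w2) =
    charge1 T r (u, y, w1 (+) w2)) -> nodd T G = nodd T G'.
  by move=> h; apply: eq_bigr => r _; rewrite !charge_cons addnA h.
move: key nodd0; rewrite {evG evG'} !valid_cons !cost_cons.
move: (nodd T G) (nodd T G') => n n' key nodd0.
have {}key r : (forall r0, r0 != r ->
    charge1 T r0 (u, v, w1) + charge1 T r0 (v, y, w2) =
    charge1 T r0 (u, y, w1 (+) w2)) ->
   [/\ ~~ odd (charge1 T r (u, v, w1) + (charge1 T r (v, y, w2) + charge T R r)),
     ~~ odd (charge1 T r (u, y, w1 (+) w2) + charge T R r) &
    n + ((charge1 T r (u, y, w1 (+) w2) + charge T R r) %% 4 == 2) =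
   n' + ((charge1 T r (u, v, w1) + (charge1 T r (v, y, w2) + charge T R r)) %% 4 == 2)].
  move=> h; move: (key r); rewrite !charge_cons; apply.
  by move=> r0 /h; rewrite !charge_cons; lia.
have side (r r0 : N) : r0 != r -> (r == r0) = false by rewrite eq_sym => /negbTE.
move: key nodd0; rewrite /vedge /cost1 /charge1 /=.
(* The cases tell which of [v], [u], [y] lie in X; validity forces all classes that occur among them
   to coincide. *)
case Tv: (T v) => [a|]; case Tu: (T u) => [c|]; case Ty: (T y) => [d|] //= key nodd0.
- move=> /and3P[/eqP Ec /eqP Ed _] _; move: key; rewrite Ec -Ed => /(_ a) [].
    by move=> r0 /side -> /=.
  by rewrite eqxx; case: (w1); case: (w2) => /=; lia.
- move=> /andP[/eqP Ec _] _; move: key; rewrite Ec => /(_ a) [].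
    by move=> r0 /side -> /=.
  by rewrite eqxx; case: (w1); case: (w2) => /=; lia.
- move=> /andP[/eqP Ec _] _; move: key; rewrite Ec => /(_ d) [].
    by move=> r0 /side -> /=.
  by rewrite eqxx; case: (w1); case: (w2) => /=; lia.
- move: key => /(_ a) [].
    by move=> r0 /side -> /=.
  by rewrite eqxx; case: (w1); case: (w2) => /=; lia.
- move=> _ /andP[/eqP Ec _]; move: key; rewrite Ec => /(_ d) [].
    by move=> r0 /side -> /=.
  by rewrite eqxx; case: (w1); case: (w2) => /=; lia.
- move: key => /(_ c) [].
    by move=> r0 /side -> /=.
  by rewrite eqxx; case: (w1); case: (w2) => /=; lia.
- move: key => /(_ d) [].
    by move=> r0 /side -> /=.
  by rewrite eqxx; case: (w1); case: (w2) => /=; lia.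
- by rewrite nodd0 //; case: (w1); case: (w2) => /=; lia.
Qed.

Lemma nodd_change2 (f g : N -> nat) r r' : r != r' ->
  (forall r0, r0 != r -> r0 != r' -> f r0 = g r0) ->
  \sum_r (f r %% 4 == 2) + ((g r %% 4 == 2) + (g r' %% 4 == 2)) =
  \sum_r (g r %% 4 == 2) + ((f r %% 4 == 2) + (f r' %% 4 == 2)).
Proof.
move=> rr' E; rewrite (bigD1 r) //= (bigD1 r') 1?eq_sym //=.
rewrite [in RHS](bigD1 r) //= [in RHS](bigD1 r') 1?eq_sym //=.
rewrite (eq_bigr (fun i => nat_of_bool (g i %% 4 == 2))); last first.
  by move=> i /andP[ir ir']; rewrite E.
lia.
Qed.

Definition merge (r r' : N) T x : option N := if T x == Some r' then Some r else T x.

Lemma merge_None r r' T x : (merge r r' T x == None) = (T x == None).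
Proof. by rewrite /merge; case: ifP => // /eqP ->. Qed.

Lemma merge_vedge r r' T e : vedge T e -> vedge (merge r r' T) e.
Proof.
rewrite /vedge /merge; case: (T e.1.1) => [a|] //; case: (T e.1.2) => [c|] //=.
  by move=> /eqP ->; case: ifP => // _; rewrite eqxx.
by case: ifP.
Qed.

Lemma merge_valid r r' T G : valid T G -> valid (merge r r' T) G.
Proof. by apply: sub_all => e; apply: merge_vedge. Qed.

Lemma merge_cost1 r r' T e : cost1 (merge r r' T) e = cost1 T e.
Proof.
rewrite /cost1 /merge; case: (T e.1.1) => [a|]; case: (T e.1.2) => [c|] //=;
by do ?case: ifP.
Qed.

Lemma merge_cost r r' T G : cost (merge r r' T) G = cost T G.
Proof. by apply: eq_bigr => e _; apply: merge_cost1. Qed.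

Lemma incl_merge r r' T x r0 : r != r' ->
  incl (merge r r' T x) r0 =
  if r0 == r then incl (T x) r || incl (T x) r' else
  if r0 == r' then false else incl (T x) r0.
Proof.
move=> rr'; rewrite /merge; case: (T x) => [a|] /=; last by do 2?case: ifP.
have -> : (Some a == Some r') = (a == r') by [].
case: (eqVneq a r') => [->|ar'] /=.
  rewrite orbT eq_sym; case: eqP => // _.
  by rewrite eq_sym; case: eqP.
case: (eqVneq r0 r) => [->|r0r]; first by rewrite orbF.
by case: (eqVneq r0 r') => // ->; rewrite (negbTE ar').
Qed.

Lemma merge_charge1 r r' T e : r != r' -> vedge T e ->
  charge1 (merge r r' T) r e = charge1 T r e + charge1 T r' e.
Proof.
move=> rr'; rewrite /charge1 !incl_merge // eqxx /vedge.
have h a : (a == r) && (a == r') = false.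
  by apply/negP => /andP[/eqP -> /eqP E]; rewrite E eqxx in rr'.
case: (T e.1.1) => [a|]; case: (T e.1.2) => [c|] //=.
- by move=> /eqP <-; move: (h a); case: (a == r); case: (a == r') => //= _; lia.
- by move: (h a); case: (a == r); case: (a == r') => //= _; lia.
- by move: (h c); case: (c == r); case: (c == r') => //= _; lia.
Qed.

Lemma merge_charge1' r r' T e : r != r' -> charge1 (merge r r' T) r' e = 0.
Proof. by move=> rr'; rewrite /charge1 !incl_merge // eqxx eq_sym (negbTE rr'). Qed.

Lemma merge_charge1_neq r r' r0 T e : r != r' -> r0 != r -> r0 != r' ->
  charge1 (merge r r' T) r0 e = charge1 T r0 e.
Proof. by move=> rr' h1 h2; rewrite /charge1 !incl_merge // (negbTE h1) (negbTE h2). Qed.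

Lemma merge_charge r r' T G : r != r' -> valid T G ->
  charge (merge r r' T) G r = charge T G r + charge T G r'.
Proof.
move=> rr' /allP vG; rewrite /charge -big_split; apply: eq_big_seq => e eG.
by apply: merge_charge1 => //; apply: vG.
Qed.

Lemma merge_charge' r r' T G : r != r' -> charge (merge r r' T) G r' = 0.
Proof. by move=> rr'; rewrite /charge big1 // => e _; apply: merge_charge1'. Qed.

Lemma merge_charge_neq r r' r0 T G : r != r' -> r0 != r -> r0 != r' ->
  charge (merge r r' T) G r0 = charge T G r0.
Proof. by move=> rr' h1 h2; apply: eq_bigr => e _; apply: merge_charge1_neq. Qed.

(* If the ends of the new edge lie in different classes, these classes are merged. *)
Lemma split_forward T u v y w1 w2 R :
  let G := [:: (u, v, w1), (v, y, w2) & R] in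
  let G' := (u, y, w1 (+) w2) :: R in
  even_graph G -> valid T G ->
  exists T', [/\ forall x, (T' x == None) = (T x == None), valid T' G' &
    cost T' G' + (nodd T G).*2 <= cost T G + (nodd T' G').*2].
Proof.
move=> G G' evG vG; have evG' : even_graph G' by apply: even_split evG.
case vG' : (valid T G').
  by exists T; split=> //; case: (split_valid evG vG vG') => /=; rewrite -/G -/G'; lia.
move: (vG) vG'; rewrite !valid_cons => /and3P[v1 v2 vR]; rewrite vR andbT.
rewrite /vedge /=; case Tu: (T u) => [r|] //; case Ty: (T y) => [r'|] // /negbT rr'.
have Tv : T v = None.
  move: v1 v2; rewrite /vedge /= Tu Ty; case: (T v) => // a /eqP<- /eqP ar'.
  by rewrite ar' eqxx in rr'.
have rrS : (Some r == Some r') = false by apply/negbTE.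
have vT' : valid (merge r r' T) G'.
  by rewrite valid_cons merge_valid // andbT /vedge /= /merge Tu Ty rrS eqxx /= eqxx.
exists (merge r r' T); split=> //; first exact: merge_None.
have h := @nodd_change2 (charge (merge r r' T) G') (charge T G) r r' rr'.
have {}h : nodd (merge r r' T) G' + ((charge T G r %% 4 == 2) + (charge T G r' %% 4 == 2)) =
    nodd T G + ((charge (merge r r' T) G' r %% 4 == 2) + 0).
  rewrite /nodd; move: h; rewrite merge_charge' // => -> // r0 h1 h2; rewrite merge_charge_neq // !charge_cons.
  by rewrite /charge1 /= Tu Ty Tv /= ![_ == r0]eq_sym (negbTE h1) (negbTE h2).
(* Two crossing edges become one edge inside the merged class: the cost drops by 2. The merged
   charge is 2 less than the sum of the two modulo 4, so at most one odd class is lost, which the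
   cost pays for. *)
have c : charge (merge r r' T) G' r + 2 = charge T G r + charge T G r' %[mod 4].
  rewrite !charge_cons merge_charge // /charge1 /= /merge Tu Ty Tv rrS eqxx /= eqxx.
  rewrite [r' == r]eq_sym (negbTE rr') eqxx; move: (charge T R r) (charge T R r') => c c'.
  by clear; case: w1; case: w2 => /=; lia.
have e1 := charge_even T r evG.
have e2 := charge_even T r' evG.
rewrite merge_cost /G !cost_cons /cost1 /= Tu Ty Tv -/G.
move: h c e1 e2; move: (nodd _ _) (nodd _ _) (charge T G r) (charge T G r') (charge _ _ _) (cost T R).
by clear; move=> n n' c c' c'' d; lia.
Qed.

(** Carries a certificate of the split graph back to the original one when the edge from [v] to [y]
    would join two classes. The two odd classes that may be lost are worth 4 in the doubled bound,
    the slack of a strict bound. *)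
Lemma split_backward_merge T u v y w1 w2 R r r' :
  let G := [:: (u, v, w1), (v, y, w2) & R] in
  let G' := (u, y, w1 (+) w2) :: R in
  T u = None -> T v = Some r -> T y = Some r' -> r != r' -> valid T G' ->
  [/\ valid (merge r r' T) G, cost (merge r r' T) G = cost T G' &
    nodd T G' <= nodd (merge r r' T) G + 2].
Proof.
move=> G G' Tu Tv Ty rr'; rewrite valid_cons => /andP[_ vR].
have rrS : (Some r == Some r') = false by apply/negbTE.
split.
- by rewrite !valid_cons merge_valid // andbT /vedge /= /merge Tu Tv Ty rrS eqxx /= eqxx.
- by rewrite merge_cost !cost_cons /cost1 /= Tu Tv Ty.
have h : nodd T G' + ((charge (merge r r' T) G r %% 4 == 2) + (charge (merge r r' T) G r' %% 4 == 2)) =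
    nodd (merge r r' T) G + ((charge T G' r %% 4 == 2) + (charge T G' r' %% 4 == 2)).
  apply: nodd_change2 => // r0 h1 h2; rewrite merge_charge_neq // !charge_cons.
  by rewrite /charge1 /= Tu Ty Tv /= ![_ == r0]eq_sym (negbTE h1) (negbTE h2).
by move: h; lia.
Qed.

End Certificates.

(** * Reorientations and balanced orientations *)

Section Reversal.
Variable V : eqType.
Implicit Types (G H : seq (wedge V)) (e : wedge V).

Definition erev e : wedge V := (e.1.2, e.1.1, e.2).

Definition rev_rel e e' := (e' == e) || (e' == erev e).

Definition reoriented G H := all2 rev_rel G H.

Lemma erevK e : erev (erev e) = e.
Proof. by case: e => [[]]. Qed.

Lemma reoriented_refl G : reoriented G G.
Proof. by elim: G => //= e G ->; rewrite /rev_rel eqxx. Qed.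

Lemma reoriented_sym G H : reoriented G H -> reoriented H G.
Proof.
rewrite /reoriented; elim: G H => [|e G IH] [|f H] //= /andP[ef /IH ->]; rewrite andbT.
move: ef; rewrite /rev_rel => /orP[]/eqP->; first by rewrite eqxx.
by rewrite erevK eqxx orbT.
Qed.

Lemma red_erev (A : pred V) e G : red A (e :: G) (erev e :: G).
Proof. by case: e => [[u v] w]; apply: red_rev. Qed.

Lemma reoriented_red (A : pred V) G H : reoriented G H -> red A G H.
Proof.
rewrite /reoriented; elim: G H => [|e G IH] [|f H] //=; first by move=> _; apply: red_refl.
move=> /andP[/orP[]/eqP-> /IH GH]; first exact: red_cons.
exact: red_trans (red_erev _ _ _) (red_cons _ GH).
Qed.

Lemma reoriented_all (P : pred (wedge V)) G H :
  (forall e, P (erev e) = P e) -> reoriented G H -> all P G = all P H.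
Proof.
move=> Pr; rewrite /reoriented; elim: G H => [|e G IH] [|f H] //= /andP[ef /IH ->].
by case/orP: ef => /eqP->; rewrite ?Pr.
Qed.

Lemma reoriented_sum (F : wedge V -> nat) G H :
  (forall e, F (erev e) = F e) -> reoriented G H ->
  \sum_(e <- G) F e = \sum_(e <- H) F e.
Proof.
move=> Fr; rewrite /reoriented; elim: G H => [|e G IH] [|f H] //=.
move=> /andP[ef /IH GH]; rewrite !big_cons GH.
by case/orP: ef => /eqP->; rewrite ?Fr.
Qed.

Lemma reoriented_filter (P : pred (wedge V)) G H :
  (forall e, P (erev e) = P e) -> reoriented G H ->
  reoriented (filter P G) (filter P H).
Proof.
move=> Pr; rewrite /reoriented; elim: G H => [|e G IH] [|f H] //= /andP[ef /IH GH].
have -> : P f = P e by case/orP: ef => /eqP->; rewrite ?Pr.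
by case: (P e) => //=; rewrite GH ef.
Qed.

Lemma reoriented_cat G H G' H' :
  reoriented G H -> reoriented G' H' -> reoriented (G ++ G') (H ++ H').
Proof.
rewrite /reoriented; elim: G H => [|e G IH] [|f H] //= /andP[-> GH] h.
exact: IH.
Qed.

End Reversal.

Section ReversalCost.
Variables (V N : finType) (T : V -> option N).
Implicit Types (e : wedge V).

Lemma vedge_rev e : vedge T (erev e) = vedge T e.
Proof. by rewrite /vedge /=; case: (T _) => [a|]; case: (T _) => [c|] //; rewrite eq_sym. Qed.

Lemma cost1_rev e : cost1 T (erev e) = cost1 T e.
Proof. by rewrite /cost1 /=; case: (T _) => [a|]; case: (T _). Qed.

Lemma charge1_rev r e : charge1 T r (erev e) = charge1 T r e.
Proof. by rewrite /charge1 /= orbC addbC. Qed.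

(** Certificates change only by merging classes, so X, and with it the root, is kept along the whole
    reduction. *)
Lemma red_bound (A : pred V) G H : red A G H -> even_graph G ->
  forall T0 : V -> option N, valid T0 G ->
  exists T' : V -> option N, [/\ forall x, (T' x == None) = (T0 x == None), valid T' H &
    cost T' H + (nodd T0 G).*2 <= cost T0 G + (nodd T' H).*2].
Proof.
elim=> {G H}.
- move=> G H GH _ T0 vT0; exists T0; split=> //; first by rewrite -(valid_perm _ GH).
  by rewrite (cost_perm _ GH) (nodd_perm _ GH).
- move=> u v w G _ T0 vT0; exists T0; split=> //.
    move: vT0; rewrite !valid_cons; congr (_ && _).
    by rewrite /vedge /=; case: (T0 u) => [a|]; case: (T0 v) => [c|] //; rewrite eq_sym.
  have -> : nodd T0 ((v, u, w) :: G) = nodd T0 ((u, v, w) :: G).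
    by apply: eq_bigr => r _; rewrite !charge_cons /charge1 /= orbC addbC.
  rewrite leq_add2r !cost_cons leq_add2r /cost1 /=.
  by case: (T0 u) => [a|]; case: (T0 v).
- by move=> u v y w1 w2 G _ ev T0 vT0; apply: split_forward.
- move=> v G _ ev T0; rewrite valid_cons => /andP[_ vG]; exists T0; split=> //.
  rewrite !cost_cons; have -> : nodd T0 ((v, v, false) :: G) = nodd T0 G.
    by apply: eq_bigr => r _; rewrite charge_cons /charge1 /= muln0 addbb.
  by rewrite leq_add2r leq_addl.
- move=> G H K r1 IH1 r2 IH2 ev T0 vT0.
  have [T1 [n1 v1 h1]] := IH1 ev T0 vT0.
  have evH : even_graph H by move=> x; rewrite -(red_odd_deg x r1).
  have [T2 [n2 v2 h2]] := IH2 evH T1 v1.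
  exists T2; split=> // [x|]; first by rewrite n2 n1.
  by lia.
Qed.

End ReversalCost.

Lemma sum_pos_has (T : eqType) (F : T -> nat) (s : seq T) :
  0 < \sum_(e <- s) F e -> exists2 e, e \in s & 0 < F e.
Proof.
move=> h; case: (boolP (has (fun e => 0 < F e) s)) => [/hasP[e es eF]|/hasPn no].
  by exists e.
by move: h; rewrite big_seq big1 // => e /no; rewrite -leqNgt leqn0 => /eqP.
Qed.

(** * Contracting a balanced orientation to the root *)

Section Balanced.
Variables (V : eqType) (A : pred V) (b : V).
Implicit Types (M : seq (wedge V)) (e : wedge V).

(* Edges of weight 0 are read as directed edges, edges of weight 1 as edges
   with an arrowhead at both ends. *)
Definition tails1 x e : nat := ~~ e.2 && (e.1.1 == x).
Definition heads1 x e : nat := (e.1.2 == x) + (e.2 && (e.1.1 == x)).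

Lemma balanced_red M : ~~ A b ->
  all (fun e => (A e.1.1 || (e.1.1 == b)) && (A e.1.2 || (e.1.2 == b))) M ->
  (forall x, A x -> \sum_(e <- M) tails1 x e = \sum_(e <- M) heads1 x e) ->
  exists L, [/\ red A M L, all (fun e => e.1 == (b, b)) L &
    count (fun e => e.2) L = count (fun e => e.2) M].
Proof.
move=> nAb; have [n] := ubnP (size M); elim: n M => // n IH M sM eM bal.
case: (boolP (all (fun e => e.1 == (b, b)) M)) => [allb|].
  by exists M; split=> //; apply: red_refl.
rewrite -has_predC => /hasP[e0 e0M /= e0b].
(* Zero loops go first; afterwards an edge with its tail at [x] cannot also have its arrowhead
   there, so the two edges to be paired are distinct. *)
case: (boolP (has (fun e => [&& A e.1.1, e.1.1 == e.1.2 & ~~ e.2]) M)).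
  move=> /hasP[[[x x'] w] eM0 /= /and3P[Ax /eqP xx']]; case: w eM0 => // eM0 _.
  have p := perm_to_rem eM0; subst x'.
  have [|||L [rL lL cL]] := IH (rem (x, x, false) M).
  - by move: sM; rewrite (perm_size p).
  - by move: eM; rewrite (perm_all _ p) => /andP[].
  - move=> z Az; move: (bal z Az); rewrite !(perm_big _ p) /= !big_cons /tails1 /heads1 /=.
    by rewrite addn0 => /addnI.
  exists L; split=> //; last by rewrite cL (permP p).
  by apply: (red_trans (red_perm _ p)); apply: red_trans (red_loop _ Ax) rL.
move=> /hasPn nl.
have [x [Ax xe0]] : exists x, A x /\ ((e0.1.1 == x) || (e0.1.2 == x)).
  move/allP/(_ _ e0M): eM => /andP[/orP[Au|/eqP ub] /orP[Av|/eqP vb]].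
  - by exists e0.1.1; rewrite eqxx.
  - by exists e0.1.1; rewrite eqxx.
  - by exists e0.1.2; rewrite eqxx orbT.
  - by move: e0b; case: (e0) ub vb => [[? ?] ?] /= -> ->; rewrite eqxx.
have pos : 0 < \sum_(e <- M) tails1 x e + \sum_(e <- M) heads1 x e.
  rewrite -big_split /= (big_rem e0) //= /tails1 /heads1.
  by case/orP: xe0 => ->; case: (e0.2) => /=; lia.
have [tpos hpos] : 0 < \sum_(e <- M) tails1 x e /\ 0 < \sum_(e <- M) heads1 x e.
  by move: pos; rewrite (bal x Ax); lia.
have [[[x' y] w1] e1M] := sum_pos_has tpos; rewrite /tails1 /= lt0b => /andP[nw1 /eqP xx'].
have [[[u v] w2] e2M h2] := sum_pos_has hpos.
subst x'; case: w1 e1M nw1 => // e1M _.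
have xy : x != y by have := nl _ e1M; rewrite /= Ax andbT.
have p1 := perm_to_rem e1M.
have e2M' : (u, v, w2) \in rem (x, y, false) M.
  move: e2M; rewrite (perm_mem p1) inE => /orP[/eqP[eu ev ew]|//].
  move: h2; rewrite /heads1 /= eu ev ew.
  by rewrite eq_sym (negbTE xy).
have p2 := perm_to_rem e2M'; set R := rem (u, v, w2) _ in p2.
have {p1 p2} p : perm_eq M [:: (u, v, w2), (x, y, false) & R].
  apply: (perm_trans p1); apply: (@perm_trans _ [:: (x, y, false), (u, v, w2) & R]).
    by rewrite perm_cons; apply: p2.
  by apply/permP => P /=; rewrite addnCA.
(* An edge with an arrowhead at [x] can be written with [x] as second end: a non-zero edge has
   arrowheads at both ends, so reversing it changes no count. *)
have [u' [r1 hh tt eu']] : exists u', [/\ red A M [:: (u', x, w2), (x, y, false) & R],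
   forall z, heads1 z (u', x, w2) = heads1 z (u, v, w2),
   forall z, tails1 z (u', x, w2) = tails1 z (u, v, w2) &
   (A u' || (u' == b))].
  have := eM; rewrite (perm_all _ p) /= => /and3P[/andP[bu bv] _ _].
  case: (eqVneq v x) => [vx|vx].
    by subst v; exists u; split=> //; apply: red_perm.
  move: h2; rewrite /heads1 /= (negbTE vx) lt0b => /andP[w2T /eqP ux].
  subst u; exists v; split=> //.
  - by apply: (red_trans (red_perm _ p)); apply: red_rev.
  - by move=> z; rewrite /heads1 /= w2T addnC.
  - by move=> z; rewrite /tails1 /= w2T.
have := eM; rewrite (perm_all _ p) /= => /and3P[_ /andP[_ by_] eR].
have [|||L [rL lL cL]] := IH ((u', y, w2) :: R).
- by move: sM; rewrite (perm_size p).
- by rewrite /= eu' by_.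
- move=> z Az; move: (bal z Az); rewrite !(perm_big _ p) /= !big_cons -hh -tt.
  rewrite /tails1 /heads1 /=; move: (\sum_(j <- R) _) (\sum_(j <- R) _) (u' == z) (y == z) (x == z).
  by clear; case: w2 => s1 s2 [] [] [] /=; lia.
exists L; split=> //; last by rewrite cL (permP p).
apply: (red_trans r1); apply: red_trans rL.
by have := red_split u' y w2 false R Ax; rewrite addbF.
Qed.

End Balanced.

(** * Orientations with prescribed indegrees *)

Section Orientation.
Variables (V : eqType) (Q : finType) (q : V -> Q).
Implicit Types (H : seq (wedge V)) (S : {set Q}) (e : wedge V).

Definition inside S e : bool := (q e.1.1 \in S) && (q e.1.2 \in S).

Lemma sum_dec (t : Q -> nat) c S : 0 < t c ->
  \sum_(z in S) (t z - (z == c)) + (c \in S) = \sum_(z in S) t z.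
Proof.
move=> tc; case cS: (c \in S).
  rewrite (bigD1 c) //= [in RHS](bigD1 c) //= eqxx.
  rewrite (eq_bigr t); first by lia.
  by move=> z /andP[_ /negbTE->]; rewrite subn0.
rewrite addn0; apply: eq_bigr => z zS; case: eqP => [zc|]; last by rewrite subn0.
by rewrite -zc zS in cS.
Qed.

(** Hakimi's theorem, with indegrees prescribed on the quotient by [q]. The first edge is directed
    so that the condition survives for the other edges with one unit less at its head. *)
Lemma orientation H (t : Q -> nat) :
  (forall S, \sum_(e <- H) inside S e <= \sum_(z in S) t z) ->
  size H = \sum_z t z ->
  exists2 H', reoriented H H' & forall z, \sum_(e <- H') (q e.1.2 == z) = t z.
Proof.
elim: H t => [|e H IH] t cut sz.
  exists [::] => // z; rewrite big_nil.
  by move/eqP: sz => /=; rewrite eq_sym sum_nat_eq0 => /forallP/(_ z)/eqP.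
pose fits c := [forall S, \sum_(e <- H) inside S e + (c \in S) <= \sum_(z in S) t z].
have step e' : rev_rel e e' -> fits (q e'.1.2) ->
    exists2 H', reoriented (e :: H) H' & forall z, \sum_(e <- H') (q e.1.2 == z) = t z.
  move=> ee' /forallP fit.
  have tc : 0 < t (q e'.1.2).
    by have := fit [set q e'.1.2]; rewrite inE eqxx big_set1; lia.
  have [||H' HH' tH'] := IH (fun z => t z - (z == q e'.1.2)).
  - by move=> S; have := fit S; have := sum_dec S tc; lia.
  - have E (F : Q -> nat) : \sum_(z in setT) F z = \sum_z F z.
      by apply: eq_bigl => z; rewrite inE.
    by move: (sum_dec setT tc) sz; rewrite !E inE /= => <-; rewrite addn1 => -[].
  exists (e' :: H'); first by rewrite /reoriented /= ee'.
  move=> z; rewrite big_cons tH' eq_sym; case: eqP => [->|_]; last by lia.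
  by rewrite addnC subnK.
case: (boolP (fits (q e.1.2))) => [|nf1].
  by apply: step; rewrite /rev_rel eqxx.
case: (boolP (fits (q (erev e).1.2))) => [|nf2].
  by apply: step; rewrite /rev_rel eqxx orbT.
(* If neither direction works, there are two tight sets, each containing just one end of [e]. Their
   union contains both ends and so needs one unit more, against supermodularity of the number of
   inner edges. *)
move: nf1 nf2; rewrite !negb_forall => /existsP[S1] h1 /existsP[S2] h2; exfalso.
pose f S := \sum_(e <- H) inside S e; pose g S := \sum_(z in S) t z.
have tt : g (S1 :|: S2) + g (S1 :&: S2) = g S1 + g S2.
  rewrite /g !(big_mkcond (fun z => z \in _)) -!big_split; apply: eq_bigr => z _ /=.
  by rewrite !inE; case: (z \in S1); case: (z \in S2); rewrite /= ?addn0 ?add0n.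
have ff : f S1 + f S2 <= f (S1 :|: S2) + f (S1 :&: S2).
  rewrite /f -!big_split; apply: leq_sum => a _ /=; rewrite /inside !inE.
  by case: (q _ \in S1); case: (q _ \in S2); case: (_ \in S1); case: (_ \in S2).
have {}cut S : inside S e + f S <= g S by have := cut S; rewrite big_cons.
move: h1 h2 tt ff (cut S1) (cut S2) (cut (S1 :&: S2)) (cut (S1 :|: S2)).
rewrite -!/(f _) -!/(g _) /inside !inE /=.
move: (f S1) (f S2) (g S1) (g S2) (f (S1 :|: S2)) (f (S1 :&: S2)) (g (S1 :|: S2)) (g (S1 :&: S2)).
clear; case: (_ \in S1); case: (_ \in S1); case: (_ \in S2); case: (_ \in S2) => /=; lia.
Qed.

End Orientation.

(** * Rooted instances *)

Section Instances.
Variable V : finType.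
Implicit Types (W K : {set V}) (G H : seq (wedge V)) (e : wedge V) (b : V).

Definition shift (s : V -> bool) G : seq (wedge V) := map (emap id s) G.

Lemma emapE (V' : eqType) (g : V -> V') s u v w :
  emap g s (u, v, w) = (g u, g v, w (+) (s u (+) s v)).
Proof. by []. Qed.

Lemma shiftK s : involutive (shift s).
Proof.
move=> G; rewrite /shift -map_comp map_id_in // => -[[u v] w] _ /=.
by rewrite /emap /= -addbA addbb addbF.
Qed.

Definition ends_in W b e :=
  ((e.1.1 \in W) || (e.1.1 == b)) && ((e.1.2 \in W) || (e.1.2 == b)).

Definition closed_in G K := all (fun e => (e.1.1 \in K) == (e.1.2 \in K)) G.

(** Substitute for connectivity. An off-root set of odd weight with no leaving edge would be an odd
    class without crossing edges, and no reduction could erase it. *)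
Definition closed_even b G := forall K, b \notin K -> closed_in G K ->
  ~~ odd (\sum_(e <- G) (e.1.1 \in K) && e.2).

Record instance b W G : Prop := Instance {
  inst_root : b \notin W;
  inst_ends : all (ends_in W b) G;
  inst_even : even_graph G;
  inst_closed : closed_even b G }.

(** The bound of the theorem is at least [k], doubled and arranged without subtraction; the
    condition outside [W] puts the root into X. *)
Definition ok (k : nat) W G :=
  forall (s : V -> bool) (N : finType) (T : V -> option N),
  (forall u, u \notin W -> T u = None) -> valid T G ->
  k.*2 + (nodd T (shift s G)).*2 <= cost T (shift s G).

(** Zero loops may remain at the root; they are absorbed only when trails are formed. *)
Definition flood b W G (k : nat) := exists L,
  [/\ red (fun x => x \in W) G L, all (fun e => e.1 == (b, b)) L & k <= count (fun e => e.2) L].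

Definition eqv G H := exists2 G', perm_eq G G' & reoriented G' H.

Lemma eqv_perm G H : perm_eq G H -> eqv G H.
Proof. by move=> GH; exists H => //; apply: reoriented_refl. Qed.

Lemma eqv_sum (F : wedge V -> nat) G H : (forall e, F (erev e) = F e) -> eqv G H ->
  \sum_(e <- G) F e = \sum_(e <- H) F e.
Proof.
by move=> Fr [G' p r]; rewrite (perm_big _ p) /=; apply: reoriented_sum.
Qed.

Lemma eqv_all (P : pred (wedge V)) G H : (forall e, P (erev e) = P e) -> eqv G H ->
  all P G = all P H.
Proof.
by move=> Pr [G' p r]; rewrite (perm_all _ p) /=; apply: reoriented_all.
Qed.

Lemma eqv_red (A : pred V) G H : eqv G H -> red A G H.
Proof.
by move=> [G' p r]; apply: (red_trans (red_perm _ p)); apply: reoriented_red.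
Qed.

Lemma eqv_deg G H x : eqv G H -> deg G x = deg H x.
Proof. by apply: eqv_sum => e; rewrite /ends_at /= addnC. Qed.

Lemma eqv_cost (N : finType) (T : V -> option N) G H : eqv G H -> cost T G = cost T H.
Proof. by apply: eqv_sum; apply: cost1_rev. Qed.

Lemma eqv_charge (N : finType) (T : V -> option N) G H r :
  eqv G H -> charge T G r = charge T H r.
Proof. by apply: eqv_sum; apply: charge1_rev. Qed.

Lemma eqv_nodd (N : finType) (T : V -> option N) G H : eqv G H -> nodd T G = nodd T H.
Proof. by move=> GH; apply: eq_bigr => r _; rewrite (eqv_charge _ _ GH). Qed.

Lemma eqv_valid (N : finType) (T : V -> option N) G H : eqv G H -> valid T G = valid T H.
Proof. by apply: eqv_all; apply: vedge_rev. Qed.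

Lemma reoriented_map (V' : eqType) (g : V -> V') s G H :
  reoriented G H -> reoriented (map (emap g s) G) (map (emap g s) H).
Proof.
rewrite /reoriented; elim: G H => [|e G IH] [|f H] //= /andP[ef /IH ->].
rewrite andbT; move: ef; rewrite /rev_rel => /orP[]/eqP->; first by rewrite eqxx.
by rewrite /erev /emap /= [s e.1.2 (+) _]addbC eqxx orbT.
Qed.

Lemma eqv_map (g : V -> V) s G H : eqv G H -> eqv (map (emap g s) G) (map (emap g s) H).
Proof.
by move=> [G' p r]; exists (map (emap g s) G'); [apply: perm_map | apply: reoriented_map].
Qed.


Lemma valid_shift (N : finType) (T : V -> option N) s G : valid T (shift s G) = valid T G.
Proof. by rewrite /valid /shift all_map. Qed.

Lemma deg_shift s G x : deg (shift s G) x = deg G x.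
Proof. by rewrite /deg big_map. Qed.

Lemma even_shift s G : even_graph G -> even_graph (shift s G).
Proof. by move=> ev x; rewrite deg_shift. Qed.

Lemma odd_sum_addb (T : Type) (s : seq T) (P F : T -> bool) :
  odd (\sum_(e <- s) (P e (+) F e)) = odd (\sum_(e <- s) P e) (+) odd (\sum_(e <- s) F e).
Proof.
elim: s => [|e s IH]; first by rewrite !big_nil.
rewrite !big_cons 3!oddD IH; case: (P e); case: (F e) => /=;
by case: (odd _); case: (odd _).
Qed.

(** Over a closed set the shift contributes the degrees of its shifted vertices, all even. *)
Lemma sum_shift_even K s G : even_graph G -> closed_in G K ->
  ~~ odd (\sum_(e <- G) (e.1.1 \in K) && (s e.1.1 (+) s e.1.2)).
Proof.
move=> ev cl; have := even_cut_graph (fun x => (x \in K) && s x) ev; congr (~~ odd _).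
apply: eq_big_seq => e eG; have /eqP E := allP cl e eG; rewrite /= -E.
by case: (_ \in K).
Qed.

Lemma closed_shift b s G : even_graph G -> closed_even b G -> closed_even b (shift s G).
Proof.
move=> ev cl K bK cK; have {}cK : closed_in G K.
  by move: cK; rewrite /closed_in /shift all_map.
have := cl K bK cK; have := sum_shift_even s ev cK.
rewrite /shift big_map => /negbTE h /negbTE h2.
rewrite (eq_bigr (fun e => nat_of_bool
   (((e.1.1 \in K) && e.2) (+) ((e.1.1 \in K) && (s e.1.1 (+) s e.1.2))))).
  by rewrite odd_sum_addb h h2.
by move=> e _ /=; case: (_ \in K).
Qed.

Lemma tweight_shift s G : even_graph G -> tweight (shift s G) = tweight G.
Proof.
move=> ev; rewrite /tweight /shift big_map.
have cl : closed_in G setT by apply/allP => e _; rewrite !inE.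
have /negbTE := sum_shift_even s ev cl; rewrite /= odd_sum_addb.
under eq_bigr do rewrite inE /=.
by move=> ->; rewrite addbF.
Qed.

Lemma instance_shift b W s G : instance b W G -> instance b W (shift s G).
Proof.
move=> [bW eW ev cl]; split=> //; first by rewrite /shift all_map.
- exact: even_shift.
- exact: closed_shift.
Qed.

Lemma shift_add s t G : shift s (shift t G) = shift (fun x => s x (+) t x) G.
Proof.
rewrite /shift -map_comp; apply: eq_map => -[[u v] w] /=; rewrite /emap /=.
by congr (_, _); case: w; case: (s u); case: (s v); case: (t u); case: (t v).
Qed.

Lemma ok_shift k W s G : ok k W G -> ok k W (shift s G).
Proof.
move=> h t N T off vT; rewrite shift_add; apply: h => //.
by move: vT; rewrite valid_shift.
Qed.

Lemma flood_shift b W s G k : flood b W (shift s G) k -> flood b W G k.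
Proof.
move=> [L [rL lL cL]]; exists L; split=> //.
rewrite -[G](shiftK s) -[L in red _ _ L](_ : shift s L = L).
  by apply: red_map rL.
rewrite /shift map_id_in // => -[[u v] w] /(allP lL)/= /eqP[-> ->].
by rewrite emapE addbb addbF.
Qed.

Lemma flood_red b W G H k : red (fun x => x \in W) G H -> flood b W H k -> flood b W G k.
Proof. by move=> r [L [rL lL cL]]; exists L; split=> //; apply: red_trans r rL. Qed.

Lemma eqv_ok k W G H : eqv G H -> ok k W G -> ok k W H.
Proof.
move=> GH h s N T off vT; rewrite -(eqv_cost T (eqv_map id s GH)) -(eqv_nodd T (eqv_map id s GH)).
by apply: h => //; rewrite (eqv_valid _ GH).
Qed.

Lemma eqv_instance b W G H : eqv G H -> instance b W G -> instance b W H.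
Proof.
move=> GH [bW eW ev cl]; split=> //.
- rewrite -(eqv_all _ GH) // => e; by rewrite /ends_in /= andbC.
- by move=> x; rewrite -(eqv_deg _ GH).
move=> K bK cK; have cG : closed_in G K.
  by rewrite /closed_in (eqv_all _ GH) // => e; rewrite /= eq_sym.
have := cl K bK cG.
have E e1 : e1 \in G -> (e1.1.1 \in K) && e1.2 = ((e1.1.1 \in K) && (e1.1.2 \in K)) && e1.2 :> nat.
  by move=> e1G; have /eqP <- := allP cG _ e1G; rewrite andbb.
have E' e1 : e1 \in H -> (e1.1.1 \in K) && e1.2 = ((e1.1.1 \in K) && (e1.1.2 \in K)) && e1.2 :> nat.
  by move=> e1G; have /eqP <- := allP cK _ e1G; rewrite andbb.
rewrite (eq_big_seq _ E) (eq_big_seq _ E') (eqv_sum _ GH) // => e1 /=.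
by rewrite [(e1.1.2 \in K) && _]andbC.
Qed.

Lemma even_from_root b W G : b \notin W -> all (ends_in W b) G ->
  (forall x, x \in W -> ~~ odd (deg G x)) -> even_graph G.
Proof.
move=> bW eW ev x; case xW: (x \in W); first exact: ev.
have off y : y \notin W -> y != b -> deg G y = 0.
  move=> yW yb; rewrite /deg big_seq big1 // => e eG.
  have := allP eW e eG; rewrite /ends_in /ends_at.
  case: (eqVneq e.1.1 y) => [->|_]; first by rewrite (negbTE yW) (negbTE yb).
  by case: (eqVneq e.1.2 y) => [->|_] //; rewrite (negbTE yW) (negbTE yb) andbF.
case: (eqVneq x b) => [->|xb]; last by rewrite off ?xW.
have := even_cut ev.
rewrite (eq_big_seq (fun e => nat_of_bool ((e.1.1 == b) (+) (e.1.2 == b)))); last first.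
  move=> e /(allP eW)/andP[].
  case: (eqVneq e.1.1 b) => [->|_]; case: (eqVneq e.1.2 b) => [->|_];
  by rewrite ?(negbTE bW) ?orbF => h1 h2; rewrite ?h1 ?h2.
congr (~~ _); rewrite /deg.
elim: (G) => [|e G' IH]; first by rewrite !big_nil.
rewrite !big_cons ![odd (_ + \sum_(_ <- _) _)]oddD IH; congr (_ (+) _).
by rewrite /ends_at oddD !oddb.
Qed.

End Instances.

(** * Contracting the complement of a class *)

Section Flip.
Variables (V : finType) (b : V).

(** A closed set without [b] cannot contain [v], so it does not see the flipped edge. *)
Lemma flip_instance (W : {set V}) v w w' R :
  instance b W ((b, v, w) :: R) -> instance b W ((b, v, w') :: R).
Proof.
move=> [bW eW ev cl]; split=> //; first by move=> x; have := ev x; rewrite /deg !big_cons.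
move=> K bK cK; have := cl K bK cK.
by rewrite !big_cons /= (negbTE bK).
Qed.

(** Either [v] lies in a class, and only the oddness of that class changes, or [v] lies in X, and
    only the cost of this edge changes. Both move the doubled bound by at most 2. *)
Lemma flip_bound (N : finType) (T : V -> option N) v w R : T b = None ->
  cost T ((b, v, w) :: R) + (nodd T ((b, v, ~~ w) :: R)).*2 <=
  cost T ((b, v, ~~ w) :: R) + (nodd T ((b, v, w) :: R)).*2 + 2.
Proof.
move=> Tb; rewrite !cost_cons /cost1 /= Tb.
case Tv: (T v) => [r|].
  have : nodd T ((b, v, w) :: R) + (charge T ((b, v, ~~ w) :: R) r %% 4 == 2) =
      nodd T ((b, v, ~~ w) :: R) + (charge T ((b, v, w) :: R) r %% 4 == 2).
    apply: nodd_change1 => r0 rr0; rewrite !charge_cons /charge1 /= Tb Tv /=.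
    by rewrite eq_sym (negbTE rr0).
  by move: (nodd _ _) (nodd _ _) => n n'; case: (_ == 2); case: (_ == 2) => /=; lia.
have -> : nodd T ((b, v, ~~ w) :: R) = nodd T ((b, v, w) :: R).
  by apply: eq_bigr => r _; rewrite !charge_cons /charge1 /= Tb Tv.
by case: w => /=; lia.
Qed.

End Flip.

Section Rank.
Variables (V : finType).

(* Refining a class by a certificate of rank at least 2 increases the rank; the
   factor 2 pays for the loss of a class whose vertices all move to X. *)
Definition rank (W : {set V}) (N : finType) (T : V -> option N) :=
  #|[set u in W | T u == None]|.*2 + #|[set r | [exists u in W, T u == Some r]]|.

Lemma rank_single (W : {set V}) (N : finType) (T : V -> option N) u0 :
  u0 \in W -> rank W T <= 1 ->
  exists r, forall u, u \in W -> T u = Some r.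
Proof.
move=> u0W rk.
have none u : u \in W -> T u != None.
  move=> uW; apply/negP => Tu; move: rk; rewrite /rank.
  have : 0 < #|[set u in W | T u == None]| by apply/card_gt0P; exists u; rewrite inE uW.
  by lia.
have [r Tu0] : exists r, T u0 = Some r by have := none _ u0W; case: (T u0) => // r; exists r.
exists r => u uW; have := none _ uW; case Tu: (T u) => [r'|] // _; congr Some.
apply/eqP/contraT => rr'.
suff : 1 < #|[set r | [exists u in W, T u == Some r]]| by move: rk; rewrite /rank; lia.
apply/card_gt1P; exists r', r; rewrite !inE; split=> //.
- by apply/existsP; exists u; rewrite uW Tu eqxx.
- by apply/existsP; exists u0; rewrite u0W Tu0 eqxx.
Qed.

End Rank.

Section Class.
Variables (V N : finType) (b : V) (W : {set V}) (G : seq (wedge V)).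
Variables (T : V -> option N) (r : N).
Hypotheses (instG : instance b W G) (off : forall u, u \notin W -> T u = None).
Hypothesis vT : valid T G.

Definition class : {set V} := [set u | T u == Some r].
Definition touches (e : wedge V) := (e.1.1 \in class) || (e.1.2 \in class).
Definition collapse u := if u \in class then u else b.
Definition local := filter touches G.
Definition contracted := map (emap collapse (fun=> false)) local.

Lemma class_sub : class \subset W.
Proof.
apply/subsetP => u; rewrite inE; apply: contraLR => /off ->.
by [].
Qed.

Lemma root_class : b \notin class.
Proof. by apply: contra (inst_root instG); apply: (subsetP class_sub). Qed.

Lemma collapse_class u : (collapse u \in class) = (u \in class).
Proof. by rewrite /collapse; case: ifP => [->|] //; rewrite (negbTE root_class). Qed.

Lemma collapse_in u : (collapse u \in class) || (collapse u == b).
Proof. by rewrite collapse_class /collapse; case: ifP => //; rewrite eqxx. Qed.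

Lemma collapse_eq u x : x \in class -> (collapse u == x) = (u == x).
Proof.
move=> xC; rewrite /collapse; case: ifP => // uC.
rewrite (_ : (b == x) = false); first by case: eqP => // ux; rewrite ux xC in uC.
by apply: contraNF root_class => /eqP ->.
Qed.

Lemma crossing_ends e : e \in G ->
  vedge T e /\ (touches e -> (e.1.1 \notin class -> T e.1.1 = None) /\
                            (e.1.2 \notin class -> T e.1.2 = None)).
Proof.
move=> eG; have ve : vedge T e by apply: (allP vT).
split=> //; rewrite /touches !inE; move: ve; rewrite /vedge.
case: (T e.1.1) => [a|]; case: (T e.1.2) => [c|] //.
- by move=> /eqP ->; rewrite orbb => ->.
- by move=> _; rewrite orbF => ->.
- by move=> _; rewrite orFb => ->.
Qed.

Lemma sum_contracted (F : wedge V -> nat) (F' : wedge V -> nat) :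
  (forall e, e \in G -> touches e -> F (emap collapse (fun=> false) e) = F' e) ->
  (forall e, e \in G -> ~~ touches e -> F' e = 0) ->
  \sum_(e <- contracted) F e = \sum_(e <- G) F' e.
Proof.
move=> h1 h2; rewrite /contracted big_map big_filter [RHS](bigID touches) /=.
rewrite [X in _ = _ + X]big_seq_cond [X in _ = _ + X]big1 ?addn0; last first.
  by move=> e /andP[/h2].
rewrite [LHS]big_seq_cond [RHS]big_seq_cond.
by apply: eq_bigr => e /andP[eG te]; apply: h1.
Qed.

Lemma contracted_instance : instance b class contracted.
Proof.
have ends : all (ends_in class b) contracted.
  by rewrite all_map; apply/allP => e _; rewrite /= /ends_in /= !collapse_in.
split=> //; first exact: root_class.
- apply: (even_from_root root_class ends) => x xC.
  rewrite /deg (sum_contracted (F' := ends_at x)).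
  + exact: (inst_even instG).
  + by move=> e _ _; rewrite /ends_at /= !collapse_eq.
  + move=> e _; rewrite /touches /ends_at negb_or => /andP[h1 h2].
    case: eqP => [E|_]; first by rewrite E xC in h1.
    by case: eqP => [E|_] //; rewrite E xC in h2.
move=> K bK cK; have {}cK e : e \in G -> touches e -> (collapse e.1.1 \in K) = (collapse e.1.2 \in K).
  move=> eG te; have := allP cK (emap collapse (fun=> false) e).
  by move=> /(_ _)/eqP; apply; apply: map_f; rewrite mem_filter te.
(* A closed set of the contracted graph that avoids the root pulls back to [K :&: class], which is
   closed in [G]. *)
have colK u : (collapse u \in K) = (u \in K :&: class).
  by rewrite inE /collapse; case: ifP => _; rewrite ?andbT ?andbF // (negbTE bK).
rewrite (sum_contracted (F' := fun e => (e.1.1 \in K :&: class) && e.2)).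
- apply: (inst_closed instG); first by rewrite inE (negbTE bK).
  apply/allP => e eG /=; case te: (touches e); first by rewrite -!colK cK.
  by move/negbT: te; rewrite /touches negb_or !in_setI => /andP[/negbTE-> /negbTE->]; rewrite !andbF.
- by move=> e _ _; rewrite /= colK addbF.
- by move=> e _; rewrite /touches negb_or in_setI => /andP[/negbTE-> _]; rewrite andbF.
Qed.

Definition ncross := \sum_(e <- G) ((e.1.1 \in class) (+) (e.1.2 \in class)).

Lemma deg_contracted : deg contracted b = ncross.
Proof.
rewrite /deg; apply: sum_contracted => e eG; rewrite /touches.
  have cb u : (collapse u == b) = (u \notin class).
    rewrite /collapse; case: ifP => [uC|]; last by rewrite eqxx.
    by apply: contraTF uC => /eqP ->; apply: root_class.
  by rewrite /ends_at /= !cb; case: (_ \in class); case: (_ \in class).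
by rewrite negb_or => /andP[/negbTE-> /negbTE->].
Qed.

Section Combine.
Variables (N2 : finType) (s2 : V -> bool) (T2 : V -> option N2).
Hypotheses (off2 : forall u, u \notin class -> T2 u = None).
Hypothesis vT2 : valid T2 contracted.

Definition combined u : option (N + N2) :=
  if u \in class then omap inr (T2 u) else omap inl (T u).
(** Adding a constant to [s2] shifts nothing, so it is normalised to vanish at [b]; then extending
    it by 0 outside the class leaves all other edges alone. *)
Definition cshift u := (u \in class) && (s2 u (+) s2 b).

Let cin e : wedge V := emap collapse (fun=> false) e.

Lemma combined_off u : u \notin W -> combined u = None.
Proof.
move=> uW; rewrite /combined; case: ifP => [uC|_]; last by rewrite off.
by rewrite (subsetP class_sub _ uC) in uW.
Qed.

Lemma vedge2 e : e \in G -> touches e -> vedge T2 (cin e).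
Proof. by move=> eG te; apply: (allP vT2); apply: map_f; rewrite mem_filter te. Qed.

Lemma combined_valid : valid combined G.
Proof.
apply/allP => e eG; have [ve te] := crossing_ends eG.
have := vedge2 eG; rewrite /vedge /combined /= /collapse; move: te; rewrite /touches.
case: (e.1.1 \in class); case: (e.1.2 \in class) => /= te.
- by move=> /(_ isT); case: (T2 _) => [a|]; case: (T2 _) => [c|].
- by have [_ /(_ isT)->] := te isT; case: (T2 _) => [a|].
- by have [/(_ isT)-> _] := te isT; case: (T2 _) => [a|].
- by move=> _; move: ve; rewrite /vedge; case: (T _) => [a|]; case: (T _) => [c|].
Qed.

(** A crossing edge costs 1 under [T], while its cost in the combined certificate is the one under
    [T2]; every other edge is charged by exactly one of the two. Hence the surplus [ncross]. *)
Lemma combined_cost :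
  cost combined (shift cshift G) + ncross = cost T G + cost T2 (shift s2 contracted).
Proof.
rewrite /cost /shift !big_map big_filter [X in _ = _ + X]big_mkcond /= -!big_split /=.
apply: eq_big_seq => e eG; have [_ te] := crossing_ends eG.
move: te; rewrite /cost1 /touches /combined /= /collapse /cshift.
have Cb := root_class.
have T2b : T2 b = None by apply: off2.
have inT u : u \in class -> T u = Some r by rewrite inE => /eqP.
case uC: (e.1.1 \in class); case vC: (e.1.2 \in class) => /= te.
- rewrite (inT _ uC) (inT _ vC) addn0.
  have -> : s2 e.1.1 (+) s2 b (+) (s2 e.1.2 (+) s2 b) = s2 e.1.1 (+) s2 e.1.2.
    by case: (s2 _); case: (s2 _); case: (s2 _).
  by rewrite addbF; case: (T2 _) => [a|]; case: (T2 _).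
- rewrite (inT _ uC) (te isT).2 //= T2b addbF.
  by rewrite !addbF addnC; case: (T2 _).
- rewrite (inT _ vC) (te isT).1 //= T2b.
  by rewrite !addbF [s2 _ (+) s2 b]addbC addnC; case: (T2 _).
- by rewrite addbF; case: (T _) => [a|]; case: (T _).
Qed.

Lemma charge_inr r2 :
  charge combined (shift cshift G) (inr r2) = charge T2 (shift s2 contracted) r2.
Proof.
rewrite /charge /shift !big_map big_filter [RHS]big_mkcond /=.
apply: eq_big_seq => e eG; have [_ te] := crossing_ends eG.
move: te; rewrite /charge1 /touches /combined /= /collapse /cshift.
have T2b : T2 b = None by apply: off2; apply: root_class.
have inr_incl (o : option N2) : incl (omap inr o : option (N + N2)) (inr r2) = incl o r2.
  by case: o.
have inl_incl (o : option N) : incl (omap inl o : option (N + N2)) (inr r2) = false.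
  by case: o.
case uC: (e.1.1 \in class); case vC: (e.1.2 \in class) => /= te; rewrite ?inr_incl ?inl_incl //.
- have -> : s2 e.1.1 (+) s2 b (+) (s2 e.1.2 (+) s2 b) = s2 e.1.1 (+) s2 e.1.2.
    by case: (s2 _); case: (s2 _); case: (s2 _).
  by rewrite addbF.
- by rewrite T2b !addbF.
- by rewrite T2b !addbF [s2 _ (+) s2 b]addbC.
Qed.

Lemma charge_inl r1 : charge combined (shift cshift G) (inl r1) =
  if r1 == r then 0 else charge T G r1.
Proof.
have -> : (if r1 == r then 0 else charge T G r1) =
    \sum_(e <- G) (if r1 == r then 0 else charge1 T r1 e).
  by case: eqP => // _; rewrite big1.
rewrite /charge /shift !big_map.
apply: eq_big_seq => e eG; have [_ te] := crossing_ends eG.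
move: te; rewrite /charge1 /touches /combined /= /cshift.
have inr_incl (o : option N2) : incl (omap inr o : option (N + N2)) (inl r1) = false.
  by case: o.
have inl_incl (o : option N) : incl (omap inl o : option (N + N2)) (inl r1) = incl o r1.
  by case: o.
have inT u : u \in class -> incl (T u) r1 = (r1 == r).
  by rewrite inE => /eqP -> /=; rewrite eq_sym.
have outT u : u \notin class -> incl (T u) r1 -> (r1 == r) = false.
  rewrite inE; case: (T u) => [a|] //= ar /eqP ar1.
  by rewrite -ar1; apply: negbTE.
case uC: (e.1.1 \in class); case vC: (e.1.2 \in class) => /= te; rewrite ?inr_incl ?inl_incl //.
- by rewrite !inT //; case: eqP.
- by rewrite (te isT).2 //= inT //; case: eqP.
- by rewrite (te isT).1 //= inT //; case: eqP.
- rewrite addbF; case: eqP => // r1r.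
  have h u : u \notin class -> incl (T u) r1 = false.
    by move=> uN; apply/negP => /(outT _ uN); rewrite r1r eqxx.
  by rewrite !h ?uC ?vC.
Qed.

Lemma combined_nodd :
  nodd combined (shift cshift G) + (charge T G r %% 4 == 2) =
  nodd T G + nodd T2 (shift s2 contracted).
Proof.
rewrite /nodd big_sumType /= (bigD1 r) //= charge_inl eqxx /= [in RHS](bigD1 r) //=.
under eq_bigr => i ir do rewrite charge_inl (negbTE ir).
under [X in _ + X + _]eq_bigr => i _ do rewrite charge_inr.
by rewrite add0n addnC addnA.
Qed.

(** The class [r] disappears and the parts counted by [T2] take its place, so refining by rank at
    least 2 raises the rank. *)
Lemma combined_rank u0 : u0 \in class ->
  rank W combined + 1 = rank W T + rank class T2.
Proof.
move=> u0C; rewrite /rank.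
have -> : [set u in W | combined u == None] =
    [set u in W | T u == None] :|: [set u in class | T2 u == None].
  apply/setP => u; rewrite !inE /combined; case: ifP; rewrite inE => uC.
    by rewrite uC (eqP uC) andbF /= (subsetP class_sub) ?inE //; case: (T2 u).
  by rewrite uC /= orbF; case: (T u).
rewrite cardsU (_ : _ :&: _ = set0) ?cards0 ?subn0; last first.
  apply/setP => u; rewrite in_set0 in_setI [u \in [set u in class | _]]inE !inE.
  by case: (T u) => [a|]; rewrite ?andbF.
set A1 := [set r0 | [exists u in W, T u == Some r0]].
set A2 := [set r2 | [exists u in class, T2 u == Some r2]].
have -> : [set r0 | [exists u in W, combined u == Some r0]] =
    [set inl x | x in A1 :\ r] :|: [set inr x | x in A2].
  apply/setP => -[r1|r2]; rewrite !inE.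
  - have -> : (inl r1 \in [set inr x | x in A2]) = false by apply/imsetP => -[].
    rewrite orbF (mem_imset _ _ (@inl_inj _ _)) !inE.
    apply/existsP/andP => [[u /andP[uW]]|[r1r /existsP[u /andP[uW /eqP Tu]]]].
      rewrite /combined; case: ifP => uC; first by case: (T2 u).
      case Tu: (T u) => [a|] //= /eqP[ar]; subst a; split.
        by apply: contraFN uC => /eqP ar; rewrite inE Tu ar.
      by apply/existsP; exists u; rewrite uW Tu eqxx.
    exists u; rewrite uW /combined inE Tu.
    have -> : (Some r1 == Some r) = false by apply: negbTE.
    by rewrite /= eqxx.
  - have -> : (inr r2 \in [set inl x | x in A1 :\ r]) = false by apply/imsetP => -[].
    rewrite (mem_imset _ _ (@inr_inj _ _)) inE.
    apply/existsP/existsP => [[u /andP[uW]]|[u /andP[uC /eqP Tu]]].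
      rewrite /combined; case: ifP => uC; last by case: (T u).
      case Tu: (T2 u) => [a|] //= /eqP[ar]; subst a.
      by exists u; rewrite uC Tu eqxx.
    by exists u; rewrite (subsetP class_sub) //= /combined uC Tu /= eqxx.
have rA : r \in A1.
  rewrite inE; apply/existsP; exists u0; rewrite (subsetP class_sub) //=.
  by move: u0C; rewrite inE.
rewrite cardsU (_ : _ :&: _ = set0) ?cards0 ?subn0; last first.
  apply/setP => x; rewrite in_set0 in_setI; apply/negP => /andP[/imsetP[y _ ->] /imsetP[]] //.
rewrite (card_imset _ (@inl_inj _ _)) (card_imset _ (@inr_inj _ _)).
by rewrite (cardsD1 r A1) rA; clear -A1 A2; lia.
Qed.

End Combine.

End Class.

(** The flip changes the parity of the total weight but not the cost [m], so the one class, odd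
    before ([m + 1.*2]), is even afterwards and [n] is 0. *)
Lemma even_after_flip (m n : nat) (t : bool) :
  m + n.*2 = (~~ t).*2 %[mod 4] -> n <= 1 -> t.*2 = m + 1.*2 %[mod 4] -> m + n.*2 <= m.
Proof. by case: n => [|[|n]] // h1 _ h2; move: h1 h2; case: t => /=; lia. Qed.

(** * Reducing one class of a tight certificate *)

Section ClassReduction.
Variables (V N : finType) (b : V) (W : {set V}) (G : seq (wedge V)) (k : nat).
Variables (T : V -> option N).
Hypotheses (instG : instance b W G) (okG : ok k W G).
Hypothesis IH : forall (b' : V) (W' : {set V}) (G' : seq (wedge V)) k', instance b' W' G' -> ok k' W' G' ->
  #|W'| + size G' < #|W| + size G -> flood b' W' G' k'.
Hypotheses (off : forall u, u \notin W -> T u = None) (vT : valid T G).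
Hypothesis tight : k.*2 + (nodd T G).*2 = cost T G.
Hypothesis strict : forall (s : V -> bool) (N' : finType) (T' : V -> option N'),
  (forall u, u \notin W -> T' u = None) -> valid T' G -> rank W T < rank W T' ->
  k.*2 + (nodd T' (shift s G)).*2 + 4 <= cost T' (shift s G).
Variables (r : N) (u0 u1 : V).
Hypotheses (u0C : T u0 = Some r) (u1W : u1 \in W) (u1C : T u1 != Some r).

Local Notation C := (class T r).
Local Notation G2 := (contracted b G T r).
Local Notation oddr := (charge T G r %% 4 == 2).
Local Notation m := (ncross G T r).

Let u0C' : u0 \in C. Proof. by rewrite inE u0C. Qed.

Lemma class_small : #|C| < #|W|.
Proof.
apply: proper_card; apply/properP; split; first exact: class_sub.
by exists u1 => //; rewrite inE.
Qed.

(** The combined certificate is a certificate of [G]. Compared with the tight [T], [okG] gives the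
    first inequality; when [T2] has rank at least 2 the combined rank is larger, and [strict] gives
    4 more. *)
Lemma class_bound (N2 : finType) (s2 : V -> bool) (T2 : V -> option N2) :
  (forall u, u \notin C -> T2 u = None) -> valid T2 G2 ->
  m + (nodd T2 (shift s2 G2)).*2 <= cost T2 (shift s2 G2) + oddr.*2 /\
  (1 < rank C T2 -> m + (nodd T2 (shift s2 G2)).*2 + 4 <= cost T2 (shift s2 G2) + oddr.*2).
Proof.
move=> off2 vT2.
have c := combined_cost instG off vT s2 off2.
have n := combined_nodd instG off vT s2 off2.
have rk := combined_rank off T2 u0C'.
have offc := combined_off r off T2.
have vc := combined_valid vT vT2.
have okc := okG (cshift b T r s2) offc vc.
split; first by lia.
move=> rk2; have := strict (cshift b T r s2) offc vc; rewrite -(ltn_add2r 1) rk.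
rewrite ltn_add2l => /(_ rk2); lia.
Qed.

Lemma single_cost (N2 : finType) (s2 : V -> bool) (T2 : V -> option N2) r2 :
  (forall u, u \notin C -> T2 u = None) -> (forall u, u \in C -> T2 u = Some r2) ->
  cost T2 (shift s2 G2) = m.
Proof.
move=> off2 on2; rewrite /cost /shift big_map.
have cC u : (collapse b T r u \in C) = (u \in C) by exact: (collapse_class r instG off).
have T2E u : T2 u = if u \in C then Some r2 else None.
  by case: ifP => [/on2|/negbT/off2].
apply: sum_contracted => e _; rewrite /touches.
  rewrite /cost1 /= !T2E !cC.
  by case: (_ \in C); case: (_ \in C).
by rewrite negb_or => /andP[/negbTE-> /negbTE->].
Qed.

(** [bound_parity] for the one-class certificate of the contracted graph: its cost is [m], and its
    class is odd exactly when [r] is odd in [G]. *)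
Lemma contracted_parity : (tweight G2).*2 = m + oddr.*2 %[mod 4].
Proof.
pose T0 u := if u \in C then Some tt else None.
have off0 u : u \notin C -> T0 u = None by rewrite /T0 => /negbTE->.
have on0 u : u \in C -> T0 u = Some tt by rewrite /T0 => ->.
have s0 G0 : shift (fun=> false) G0 = G0 :> seq (wedge V).
  by rewrite /shift map_id_in // => -[[u v] w] _; rewrite emapE !addbF.
have v0 : valid T0 G2.
  apply/allP => e _; rewrite /vedge /T0.
  by case: (_ \in C); case: (_ \in C).
have c0 := single_cost (fun=> false) off0 on0; rewrite s0 in c0.
have ev := inst_even (contracted_instance r instG off).
have := bound_parity ev v0; rewrite c0 => <-.
have -> : nodd T0 G2 = oddr.
  rewrite /nodd (bigD1 tt) //= big1 ?addn0 => [|[] //].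
  congr (nat_of_bool (_ %% 4 == _)).
  apply: sum_contracted => e _; rewrite /touches /charge1.
    have iE u : incl (T0 (collapse b T r u)) tt = incl (T u) r.
      rewrite /T0 (collapse_class r instG off) inE.
      by case: (T u) => [a|] //=; rewrite -[Some a == _]/(a == r); case: (a == r).
    by rewrite /= !iE addbF.
  have iE u : u \notin C -> incl (T u) r = false.
    by rewrite inE; case: (T u) => [a|] //= /negbTE.
  by rewrite negb_or => /andP[/iE-> /iE->].
by [].
Qed.

Lemma size_contracted : #|C| + size G2 < #|W| + size G.
Proof.
rewrite /contracted /local size_map size_filter.
by rewrite -addSn; apply: leq_add; [exact: class_small | exact: count_size].
Qed.

Lemma ncross_even : ~~ odd m.
Proof. by have := even_cut_graph (fun x => x \in C) (inst_even instG). Qed.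

Lemma loops_deg (L : seq (wedge V)) : all (fun e => e.1 == (b, b)) L -> deg L b = (size L).*2.
Proof.
elim: L => [|e L IHL] /=; first by rewrite /deg big_nil.
by move=> /andP[/eqP eb /IHL]; rewrite /deg big_cons /ends_at eb /= eqxx => ->.
Qed.

(** The degree [m] of the root survives the reduction, so there are just [m./2] loops in the end; a
    flooding of that size leaves none of them zero. *)
Lemma full_flood H : deg H b = m -> flood b C H m./2 ->
  exists L, red (fun x => x \in C) H L /\ all (fun e => e == (b, b, true)) L.
Proof.
move=> dH [L [rL lL cL]]; exists L; split=> //.
have dL : (size L).*2 = m.
  by rewrite -(loops_deg lL) -dH (red_deg rL) // (root_class r instG off).
have : count (fun e => e.2) L == size L.
  by rewrite eqn_leq count_size /=; move: cL; rewrite -dL doubleK.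
rewrite -all_count => aL; apply/allP => e eL.
have /eqP e1 := allP lL e eL; have e2 := allP aL e eL.
by move: e1 e2; case: (e) => [[? ?] ?] /= [-> ->] ->.
Qed.

Definition outer (e : wedge V) := [&& e.1.1 \notin C, e.1.2 \notin C & e.2].

(** For an even class [class_bound] is precisely [ok m./2] on the contracted graph, which is
    smaller. Each non-zero loop at the root lifts to a non-zero passage between vertices outside the
    class. *)
Lemma class_even : ~~ oddr ->
  exists2 L, red (fun x => x \in C) (local G T r) L & all outer L.
Proof.
move=> evr; have inst2 := contracted_instance r instG off.
have ok2 : ok m./2 C G2.
  move=> s N2 T2 off2 vT2; have [+ _] := class_bound s off2 vT2.
  by rewrite (negbTE evr); have := ncross_even; lia.
have [L [rL lL]] := full_flood (deg_contracted r instG off) (IH inst2 ok2 size_contracted).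
have [|L' rL' LE] := red_lift _ rL.
  move=> u v; rewrite /= (collapse_class r instG off) /collapse => + uC; rewrite uC.
  case: ifP => // vC uv; rewrite uv in uC.
  by rewrite (negbTE (root_class r instG off)) in uC.
exists L'.
  by apply: red_mono rL' => u; rewrite (collapse_class r instG off).
apply/allP => -[[u v] w] eL; have : emap (collapse b T r) (fun=> false) (u, v, w) \in L.
  by rewrite LE; apply: map_f.
move=> /(allP lL); rewrite emapE !addbF /outer /= => /eqP[cu cv ->].
by rewrite -(collapse_class r instG off u) -(collapse_class r instG off v) cu cv (root_class r instG off).
Qed.

Lemma single_nodd (N2 : finType) (s2 : V -> bool) (T2 : V -> option N2) r2 H :
  (forall u, u \notin C -> T2 u = None) -> (forall u, u \in C -> T2 u = Some r2) ->
  nodd T2 (shift s2 H) <= 1.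
Proof.
move=> off2 on2; rewrite /nodd (bigD1 r2) //= big1.
  by rewrite addn0; case: (_ == 2).
move=> r0 r0r; rewrite /charge big1 // => e _; rewrite /charge1.
have iE u : incl (T2 u) r0 = false.
  case uC: (u \in C); last by rewrite off2 ?uC.
  by rewrite on2 //= eq_sym; apply: negbTE.
by rewrite !iE.
Qed.

(** Before the flip, certificates of rank at least 2 have doubled bound at least [m + 2], so they
    survive the loss of 2. The one-class certificate costs [m], and parity makes its class even
    after the flip. *)
Lemma flipped_ok y w R : oddr -> y \in C -> eqv G2 ((b, y, w) :: R) ->
  ok m./2 C ((b, y, ~~ w) :: R).
Proof.
move=> oddr1 yC E s N2 T2 off2 vT2.
have E' := eqv_map id s E.
have vE : valid T2 G2 by rewrite (eqv_valid T2 E).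
have T2b : T2 b = None by apply: off2; apply: (root_class r instG off).
have inst1 : instance b C ((b, y, ~~ w) :: R).
  apply: flip_instance; apply: (eqv_instance E); exact: (contracted_instance r instG off).
have [_ B2] := class_bound s off2 vE.
rewrite oddr1 in B2.
have := flip_bound (y) (w (+) (s b (+) s y)) (shift s R) T2b.
rewrite -[(b, y, _) :: shift s R]/(shift s ((b, y, w) :: R)).
have -> : (b, y, ~~ (w (+) (s b (+) s y))) :: shift s R = shift s ((b, y, ~~ w) :: R).
  by rewrite /shift /= emapE addNb.
rewrite -(eqv_cost T2 E') -(eqv_nodd T2 E') => fb.
case: (leqP (rank C T2) 1) => rk; last first.
  have := B2 rk; have := ncross_even; rewrite -[map _ G2]/(shift s G2) in fb *.
  by lia.
have [r2 on2] := rank_single u0C' rk.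
have c0 := single_cost s off2 on2.
have n1 := single_nodd s ((b, y, ~~ w) :: R) off2 on2.
have c1 : cost T2 (shift s ((b, y, ~~ w) :: R)) = m.
  rewrite -c0 (eqv_cost T2 E') /shift /= !cost_cons /cost1 /= T2b.
  by rewrite on2.
have p1 := bound_parity (even_shift s (inst_even inst1)) (_ : valid T2 (shift s ((b, y, ~~ w) :: R))).
have {}p1 := p1 _; rewrite valid_shift in p1; have {}p1 := p1 vT2.
rewrite c1 tweight_shift in p1; last exact: (inst_even inst1).
have tE : tweight G2 = tweight ((b, y, w) :: R).
  by congr odd; apply: (eqv_sum _ E).
have := contracted_parity; rewrite tE oddr1; move: p1 n1.
rewrite !tweight_cons /= c1 addNb.
rewrite (even_halfK ncross_even); exact: even_after_flip.
Qed.

(** Flipping the chosen edge makes the class even, so all passages can be made non-zero; undoing the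
    flip turns just the passage through that edge into a zero one. *)
Lemma class_odd x y w : oddr -> x \notin C -> y \in C ->
  (x, y, w) \in G \/ (y, x, w) \in G ->
  exists x' L, [/\ red (fun x => x \in C) (local G T r) ((x, x', false) :: L),
    x' \notin C & all outer L].
Proof.
move=> oddr1 xC yC eG.
have [R eL] : exists R, eqv (local G T r) ((x, y, w) :: R).
  case: eG => eG.
    exists (rem (x, y, w) (local G T r)); apply/eqv_perm/perm_to_rem.
    by rewrite mem_filter eG /touches yC orbT.
  exists (rem (y, x, w) (local G T r)); exists ((y, x, w) :: rem (y, x, w) (local G T r)).
    by apply/perm_to_rem; rewrite mem_filter eG /touches yC.
  rewrite /reoriented /= /rev_rel eqxx orbT /=; exact: reoriented_refl.
have bC := root_class r instG off.
pose R2 := map (emap (collapse b T r) (fun=> false)) R.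
have cx : collapse b T r x = b by rewrite /collapse (negbTE xC).
have cy : collapse b T r y = y by rewrite /collapse yC.
have E2 : eqv G2 ((b, y, w) :: R2).
  have := eqv_map (collapse b T r) (fun=> false) eL.
  by rewrite /= emapE cx cy !addbF.
have inst2 : instance b C ((b, y, ~~ w) :: R2).
  by apply: flip_instance; apply: (eqv_instance E2); exact: (contracted_instance r instG off).
have sz : #|C| + size ((b, y, ~~ w) :: R2) < #|W| + size G.
  have := size_contracted; have := eqv_sum (F := fun=> 1) (fun=> erefl) E2.
  by rewrite !sum1_size => ->.
have d2 : deg ((b, y, ~~ w) :: R2) b = m.
  have := deg_contracted r instG off; rewrite (eqv_deg b E2) => <-.
  by rewrite /deg !big_cons.
have [L [rL lL]] := full_flood d2 (IH inst2 (flipped_ok oddr1 yC E2) sz).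
(* The end of the chosen edge outside the class becomes a vertex [None] of its
   own, so that flipping this edge is a shift at [None]. *)
pose g o := oapp (collapse b T r) b o.
pose s (o : option V) := ~~ isSome o.
pose Gh : seq (wedge (option V)) := (None, Some y, w) :: map (emap Some (fun=> false)) R.
have GhE : map (emap g s) Gh = (b, y, ~~ w) :: R2.
  rewrite /= emapE /= cy addbT /R2 -map_comp; congr (_ :: _).
  by apply: eq_map => -[[u v] w']; rewrite /= /emap /= !addbF.
rewrite -GhE in rL.
have [|L' rL' LE] := red_lift _ rL.
  have cC := collapse_class r instG off.
  have cI u v : collapse b T r u = collapse b T r v -> u \in C -> u = v.
    rewrite /collapse => + uC; rewrite uC; case: ifP => // vC uv.
    by rewrite uv (negbTE bC) in uC.
  move=> [u|] [v|] //=; rewrite ?(negbTE bC) // ?cC.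
    by move=> /cI h /h ->.
  by move=> E; rewrite -cC E (negbTE bC).
(* No splitting takes place at [None], so its degree is preserved and a single passage ends
   there. *)
have dN : deg L' None = 1.
  rewrite -(red_deg rL') ?(negbTE bC) // /deg big_cons big_map.
  by rewrite big1_seq // => e _.
have posN : 0 < \sum_(e <- L') ends_at None e by rewrite -/(deg _ _) dN.
have [e eL' eN] := sum_pos_has posN.
have p := perm_to_rem eL'; set L1 := rem e L' in p.
have h1 : ends_at None e = 1 /\ deg L1 None = 0.
  move: dN eN; rewrite (deg_perm _ p) /deg big_cons.
  by case: (ends_at None e) => [|[|a]] //; case: (\sum_(_ <- _) _).
have outL o1 o2 we : (o1, o2, we) \in L' -> [/\ g o1 = b, g o2 = b & we = ~~ (s o1 (+) s o2)].
  move=> oL; have : emap g s (o1, o2, we) \in L by rewrite LE; apply: map_f.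
  by move/(allP lL); rewrite emapE => /eqP[-> ->]; case: (we); case: (s _ (+) _).
have gC o : g o = b -> odflt x o \notin C.
  case: o => [u|] //= gu; rewrite -(collapse_class r instG off) gu.
  exact: bC.
pose h := emap (odflt x) (fun=> false).
have rB : red (fun x => x \in C) ((x, y, w) :: R) (map h L').
  have -> : (x, y, w) :: R = map h Gh.
    rewrite /= /h emapE /= !addbF; congr (_ :: _).
    by rewrite -map_comp map_id_in // => -[[u v] w'] _; rewrite /= /emap /= !addbF.
  by apply: red_map rL' => -[u|] //=; rewrite ?(negbTE bC) // (collapse_class r instG off).
have L1out : all outer (map h L1).
  rewrite all_map; apply/allP => -[[o1 o2] we] oL1.
  have [g1 g2 ->] : [/\ g o1 = b, g o2 = b & we = ~~ (s o1 (+) s o2)].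
    by apply: outL; rewrite (perm_mem p) inE oL1 orbT.
  rewrite /outer /= !gC //= !addbF.
  have /eqP := h1.2; rewrite /deg sum_nat_seq_eq0 => /allP/(_ _ oL1).
  by rewrite /ends_at /= /s; case: (o1) => //; case: (o2).
have [x' [x'C he]] : exists x', x' \notin C /\ (h e = (x, x', false) \/ h e = (x', x, false)).
  move: eL' h1.1; case: (e) => [[o1 o2] we] /outL[g1 g2 ->].
  case: o1 g1 => [u1'|] g1; case: o2 g2 => [u2|] g2 // _.
    by exists u1'; split; [exact: gC g1 | right].
  by exists u2; split; [exact: gC g2 | left].
exists x', (map h L1); split=> //.
apply: red_trans (eqv_red _ eL) _; apply: red_trans rB _.
apply: red_trans (red_perm _ (perm_map h p)) _ => /=.
by case: he => ->; [apply: red_refl | apply: red_rev].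
Qed.

End ClassReduction.

(** * Orienting around a tight certificate *)

Lemma sum_ends_weighted (V : finType) (P : pred V) (c : wedge V -> nat) (G : seq (wedge V)) :
  \sum_(x | P x) \sum_(e <- G) c e * ends_at x e =
  \sum_(e <- G) c e * (P e.1.1 + P e.1.2).
Proof.
rewrite exchange_big /=; apply: eq_bigr => e _; rewrite -big_distrr /=; congr (_ * _).
by have := sum_ends P [:: e]; rewrite /deg big_seq1; under eq_bigr do rewrite big_seq1.
Qed.

Lemma cut_arith a i x d s cT cTS nT nTS :
  a + i.*2 + cTS + x.*2 <= d + cT -> nT <= nTS + s + x ->
  cT + nTS.*2 <= cTS + nT.*2 -> a + i.*2 <= d + s.*2.
Proof. by lia. Qed.

Section Assembly.
Variables (V N : finType) (b : V) (W : {set V}) (G : seq (wedge V)) (k : nat).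
Variables (T : V -> option N).
Hypotheses (instG : instance b W G) (okG : ok k W G).
Hypothesis IH : forall (b' : V) (W' : {set V}) (G' : seq (wedge V)) k', instance b' W' G' -> ok k' W' G' ->
  #|W'| + size G' < #|W| + size G -> flood b' W' G' k'.
Hypotheses (off : forall u, u \notin W -> T u = None) (vT : valid T G).
Hypothesis tight : k.*2 + (nodd T G).*2 = cost T G.
Hypothesis strict : forall (s : V -> bool) (N' : finType) (T' : V -> option N'),
  (forall u, u \notin W -> T' u = None) -> valid T' G -> rank W T < rank W T' ->
  k.*2 + (nodd T' (shift s G)).*2 + 4 <= cost T' (shift s G).
Hypothesis nontrivial : forall r, exists2 u, u \in W & T u != Some r.

Local Notation oddr r := (charge T G r %% 4 == 2).
Local Notation inX u := (T u == None).

(** These are the edges left undirected, with arrowheads at both ends. *)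
Definition arrow2 (e : wedge V) := [&& inX e.1.1, inX e.1.2 & e.2].
Definition directed (e : wedge V) := (inX e.1.1 || inX e.1.2) && ~~ arrow2 e.
(** Classes shrink to points, as only the number of edges entering a class is prescribed. *)
Definition quot (u : V) : V + N := if T u is Some r then inr r else inl u.

Let d0 x := \sum_(e <- G) directed e * ends_at x e.
Let n1 x := \sum_(e <- G) arrow2 e * ends_at x e.

(** * Hakimi's condition for sets that avoid the root *)

Section Cut.
Variable S : {set V + N}.
Hypothesis bS : inl b \notin S.

Let SX u := [&& inX u, u \in W & inl u \in S].
Let joins r (e : wedge V) := (SX e.1.1 && (T e.1.2 == Some r)) || (SX e.1.2 && (T e.1.1 == Some r)).
(** The neighbouring classes must join in, since an edge between two classes would make the new
    certificate invalid. *)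
Let absorbed r := (inr r \in S) || has (joins r) G.
Let inU u := if T u is Some r then absorbed r else SX u.
(* The certificate obtained by merging S and the classes next to it into one class. *)
Let TS u : option (N + unit) := if inU u then Some (inr tt) else omap inl (T u).

Lemma SX_quot e : e \in G ->
  (inX e.1.1 -> SX e.1.1 = (quot e.1.1 \in S)) /\ (inX e.1.2 -> SX e.1.2 = (quot e.1.2 \in S)).
Proof.
move=> /(allP (inst_ends instG))/andP[h1 h2]; rewrite /SX /quot.
split=> /eqP E; rewrite E eqxx /=; [move: h1|move: h2];
  by case/orP=> [->|/eqP ->] //; rewrite (negbTE bS) andbF.
Qed.

Lemma merged_off u : u \notin W -> TS u = None.
Proof. by move=> uW; rewrite /TS /inU /SX (off uW) (negbTE uW). Qed.

Lemma absorbed_joins e r : e \in G -> joins r e -> absorbed r.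
Proof. by move=> eG je; rewrite /absorbed; apply/orP; right; apply/hasP; exists e. Qed.

Lemma merged_valid : valid TS G.
Proof.
apply/allP => e eG; have := allP vT e eG; rewrite /vedge /TS /inU.
have := @absorbed_joins e ^~ eG; rewrite /joins.
case Tu: (T e.1.1) => [a|]; case Tv: (T e.1.2) => [c|] /= hj.
- by move=> /eqP ->; case: (absorbed c) => //=.
- move=> _; case sv: (SX e.1.2); last by case: (absorbed a).
  by rewrite hj // sv eqxx orbT.
- move=> _; case sv: (SX e.1.1); last by case: (absorbed c).
  by rewrite hj // sv eqxx.
- by case: (SX e.1.1); case: (SX e.1.2).
Qed.

(** A class absorbed without belonging to [S] has such an edge; the double weight of these edges in
    [merged_pointwise] pays for the class in case it was odd. *)
Let extra (e : wedge V) := \sum_(r | inr r \notin S) joins r e.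

Lemma extraE e : extra e =
  match T e.1.1, T e.1.2 with
  | None, Some r => SX e.1.1 && (inr r \notin S) : nat
  | Some r, None => SX e.1.2 && (inr r \notin S) : nat
  | _, _ => 0
  end.
Proof.
have SXN u r : T u = Some r -> SX u = false by rewrite /SX => ->.
have sum1 r0 (f : bool) : \sum_(r | inr r \notin S) (f && (Some r0 == Some r)) = f && (inr r0 \notin S) :> nat.
  case rS: (inr r0 \notin S); last first.
    rewrite andbF big1 // => r rS'; case: eqP => [[E]|]; last by rewrite andbF.
    by rewrite -E rS in rS'.
  rewrite (bigD1 r0) //= eqxx big1 ?addn0 // => r /andP[_ rr0].
  by rewrite [_ == _](_ : _ = (r0 == r)) // eq_sym (negbTE rr0) andbF.
rewrite /extra /joins; case Tu: (T e.1.1) => [a|]; case Tv: (T e.1.2) => [c|].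
- by rewrite big1 // => r _; rewrite (SXN _ _ Tu) (SXN _ _ Tv).
- by rewrite -sum1; apply: eq_bigr => r _; rewrite (SXN _ _ Tu).
- by rewrite -sum1; apply: eq_bigr => r _; rewrite (SXN _ _ Tv) orbF.
- by rewrite big1 // => r _; rewrite !andbF.
Qed.

(** The tightest case is an edge from the X-part of [S] to a class outside [S]: its cost falls from
    1 to 0 and its end in [S] counts 1, which leaves exactly the 2 needed for [extra]. *)
Lemma merged_pointwise e : e \in G ->
  arrow2 e * (SX e.1.1 + SX e.1.2) + (directed e && inside quot S e).*2 +
    cost1 TS e + (extra e).*2 <=
  directed e * (SX e.1.1 + SX e.1.2) + cost1 T e.
Proof.
move=> eG; have [q1 q2] := SX_quot eG; have hj := @absorbed_joins e ^~ eG.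
have ve := allP vT e eG.
move: q1 q2 hj ve; rewrite extraE /directed /arrow2 /inside /cost1 /TS /inU /joins /vedge.
have SXN u r : T u = Some r -> SX u = false by rewrite /SX => ->.
have qS u r : T u = Some r -> quot u = inr r by rewrite /quot => ->.
case Tu: (T e.1.1) => [a|]; case Tv: (T e.1.2) => [c|] /=.
- by move=> _ _ _ /eqP ->; rewrite (SXN _ _ Tu) (SXN _ _ Tv); case: (absorbed c).
- move=> _ /(_ isT) <- /(_ a); rewrite eqxx (SXN _ _ Tu) (qS _ _ Tu) andbT /=.
  have : (inr a \in S) -> absorbed a by rewrite /absorbed => ->.
  case: (SX _); case: (_ \in S) => /=.
  + by move=> /(_ isT) -> _ _.
  + by move=> _ /(_ isT) -> _.
  + by move=> /(_ isT) -> _ _.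
  + by case: (absorbed a).
- move=> /(_ isT) <- _ /(_ c); rewrite eqxx (SXN _ _ Tv) (qS _ _ Tv) andbT orbF /=.
  have : (inr c \in S) -> absorbed c by rewrite /absorbed => ->.
  case: (SX _); case: (_ \in S) => /=.
  + by move=> /(_ isT) -> _ _.
  + by move=> _ /(_ isT) -> _.
  + by move=> /(_ isT) -> _ _.
  + by case: (absorbed c).
- move=> /(_ isT) <- /(_ isT) <- _ _.
  by case: (SX _); case: (SX _); case: (e.2).
Qed.

Lemma merged_nodd : nodd T G <=
  nodd TS G + \sum_(r | inr r \in S) oddr r + \sum_(e <- G) extra e.
Proof.
rewrite /nodd big_sumType /= (bigID (fun r => inr r \in S)) /=.
have chargeS r : ~~ absorbed r -> charge TS G (inl r) = charge T G r.
  move=> ar; apply: eq_bigr => e _; rewrite /charge1.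
  have iE u : incl (TS u) (inl r) = incl (T u) r.
    rewrite /TS /inU /SX; case: (T u) => [a|] /=.
      case aa: (absorbed a) => //=; apply/esym/negbTE.
      by apply: contraNneq ar => <-.
    by case: ifP.
  by rewrite !iE.
have h : \sum_(r | inr r \notin S) oddr r <=
    \sum_r (charge TS G (inl r) %% 4 == 2) + \sum_(e <- G) extra e.
  rewrite [\sum_(e <- G) _]exchange_big /= big_mkcond [in X in _ + X]big_mkcond -big_split /=.
  apply: leq_sum => r _; case: ifP => // rS.
  case ab: (absorbed r); last by rewrite chargeS ?ab // leq_addr.
  move: ab; rewrite /absorbed (negbTE rS) /= => /hasP[e eG je].
  by rewrite (big_rem e) //= je; case: (_ == 2); rewrite // addnCA.
apply: leq_trans (leq_add (leqnn _) h) _.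
rewrite addnCA -[in leqRHS]addnA -addnA leq_add2l.
by rewrite leq_addl.
Qed.

(** The merged certificate cannot beat the tight one; summing the edgewise comparison and inserting
    [merged_nodd] turns this into the doubled cut condition. *)
Lemma merged_cut :
  \sum_(e <- G) arrow2 e * (SX e.1.1 + SX e.1.2) + (\sum_(e <- G) (directed e && inside quot S e)).*2 <=
  \sum_(e <- G) directed e * (SX e.1.1 + SX e.1.2) + (\sum_(r | inr r \in S) oddr r).*2.
Proof.
have s0 : shift (fun=> false) G = G.
  by rewrite /shift map_id_in // => -[[u v] w] _; rewrite emapE !addbF.
have := okG (fun=> false) merged_off merged_valid; rewrite s0 => ok1.
have n := merged_nodd.
have p : \sum_(e <- G) arrow2 e * (SX e.1.1 + SX e.1.2) +
    (\sum_(e <- G) (directed e && inside quot S e)).*2 + cost TS G + (\sum_(e <- G) extra e).*2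
  <= \sum_(e <- G) directed e * (SX e.1.1 + SX e.1.2) + cost T G.
  rewrite -!mul2n !big_distrr -!big_split /= big_seq [leqRHS]big_seq.
  by apply: leq_sum => e eG; rewrite !mul2n; apply: merged_pointwise.
have ok2 : cost T G + (nodd TS G).*2 <= cost TS G + (nodd T G).*2.
  by move: ok1 tight; move: (nodd TS G) (nodd T G) (cost TS G) (cost T G); clear; lia.
exact: cut_arith p n ok2.
Qed.

Lemma touch_pointwise e : e \in G ->
  directed e * (SX e.1.1 + SX e.1.2) +
    \sum_(r | inr r \in S) ((e.1.1 \in class T r) (+) (e.1.2 \in class T r)) <=
  (directed e && ((quot e.1.1 \in S) || (quot e.1.2 \in S))).*2.
Proof.
move=> eG; have [q1 q2] := SX_quot eG; have ve := allP vT e eG.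
have sum1 r0 (f : N -> bool) : (forall r, f r = (r0 == r)) ->
    \sum_(r | inr r \in S) f r = (inr r0 \in S) :> nat.
  move=> fE; case rS: (inr r0 \in S); last first.
    by rewrite big1 // => r rS'; rewrite fE; case: eqP => // E; rewrite E rS' in rS.
  rewrite (bigD1 r0) //= fE eqxx big1 ?addn0 // => r /andP[_ rr0].
  by rewrite fE eq_sym (negbTE rr0).
move: q1 q2 ve; rewrite /directed /arrow2 /vedge.
have SXN u r : T u = Some r -> SX u = false by rewrite /SX => ->.
have qS u r : T u = Some r -> quot u = inr r by rewrite /quot => ->.
under eq_bigr do rewrite !inE.
case Tu: (T e.1.1) => [a|]; case Tv: (T e.1.2) => [c|] /=.
- by move=> _ _ /eqP ->; rewrite big1 // => r _; rewrite addbb.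
- move=> _ /(_ isT) <- _; rewrite (SXN _ _ Tu) (qS _ _ Tu).
  rewrite (sum1 a) => [|r]; last by rewrite addbF.
  by case: (SX _); case: (_ \in S).
- move=> /(_ isT) <- _ _; rewrite (SXN _ _ Tv) (qS _ _ Tv).
  rewrite (sum1 c) => [|r]; last by [].
  by case: (SX _); case: (_ \in S).
- move=> /(_ isT) <- /(_ isT) <- _; rewrite big1 //.
  by case: (SX _); case: (SX _); case: (e.2).
Qed.

(** The cut of a class is even. If it were empty the class would be closed, hence of even weight,
    and its charge would be 0 modulo 4. *)
Lemma odd_class_cross r : oddr r -> 2 <= ncross G T r.
Proof.
move=> oddr1; have := ncross_even T instG r.
suff : 0 < ncross G T r by case: (ncross G T r) => [|[|n]].
rewrite lt0n; apply: contraTneq oddr1 => m0.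
have cl : closed_in G (class T r).
  apply/allP => e eG; have /eqP := m0; rewrite /ncross sum_nat_seq_eq0 => /allP/(_ e eG) /=.
  by rewrite eqb0; case: (_ \in _); case: (_ \in _).
have bC : b \notin class T r by apply: (root_class r instG off).
have := inst_closed instG bC cl.
have -> : charge T G r = (\sum_(e <- G) (e.1.1 \in class T r) && e.2).*2.
  rewrite -mul2n big_distrr /=; apply: eq_big_seq => e eG.
  have /eqP := allP cl e eG; rewrite /= !inE /charge1.
  have iE u : incl (T u) r = (T u == Some r) by case: (T u).
  by rewrite !iE => ->; rewrite addbb orbb addn0 mul2n; case: (_ == _); case: (e.2).
by move: (\sum_(e <- G) _) => n; clear; lia.
Qed.

(** Serves the sets containing the root, with [S] as their complement: enough directed edges touch
    [S] to supply its prescribed indegrees. An odd class asks for one edge and has at least two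
    crossing ones. *)
Lemma touch_cut :
  \sum_(e <- G) directed e * (SX e.1.1 + SX e.1.2) + (\sum_(r | inr r \in S) oddr r).*2 <=
  (\sum_(e <- G) (directed e && ((quot e.1.1 \in S) || (quot e.1.2 \in S)))).*2.
Proof.
have h : (\sum_(r | inr r \in S) oddr r).*2 <= \sum_(r | inr r \in S) ncross G T r.
  rewrite -mul2n big_distrr /=; apply: leq_sum => r _.
  case o: (_ == 2) => //; exact: odd_class_cross.
have p : \sum_(e <- G) directed e * (SX e.1.1 + SX e.1.2) + \sum_(r | inr r \in S) ncross G T r
   <= (\sum_(e <- G) (directed e && ((quot e.1.1 \in S) || (quot e.1.2 \in S)))).*2.
  rewrite -mul2n big_distrr [X in _ + X]exchange_big -big_split /= big_seq [leqRHS]big_seq.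
  by apply: leq_sum => e eG; rewrite mul2n; apply: touch_pointwise.
by apply: leq_trans p; rewrite leq_add2l.
Qed.

End Cut.
Lemma quot_inl x v : inX x -> (quot v == inl x) = (v == x).
Proof.
rewrite /quot => /eqP Tx; case Tv: (T v) => [r|] /=; last by [].
by apply/esym/eqP => vx; rewrite vx Tx in Tv.
Qed.

Lemma quot_inr r v : (quot v == inr r) = (T v == Some r).
Proof. by rewrite /quot; case: (T v). Qed.

(** The cut condition for a single vertex; it makes the truncated subtraction in [t0] exact. *)
Lemma arrow_bound x : x \in W -> inX x -> n1 x <= d0 x.
Proof.
move=> xW Xx; have bS : inl b \notin ([set inl x] : {set V + N}).
  rewrite inE; apply: contra (inst_root instG) => /eqP[->]; exact: xW.
have := merged_cut bS.
have SXE u : [&& inX u, u \in W & inl u \in [set inl x]] = (u == x).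
  rewrite inE; apply/and3P/eqP => [[_ _ /eqP[]]//|->]; by rewrite Xx xW.
rewrite [\sum_(r | _) _]big1; last by move=> r; rewrite inE.
rewrite addn0.
under eq_bigr do rewrite !SXE; under [X in _ <= X]eq_bigr do rewrite !SXE.
by move=> h; apply: leq_trans h; rewrite leq_addr.
Qed.

Lemma directed_arrow x : inX x -> d0 x + n1 x = deg G x.
Proof.
move=> Xx; rewrite -big_split; apply: eq_bigr => e _ /=.
rewrite /directed /arrow2 /ends_at.
case: (eqVneq e.1.1 x) => [->|_]; case: (eqVneq e.1.2 x) => [->|_]; rewrite ?Xx ?muln0 //=;
by case: (inX _); case: (e.2).
Qed.

Let H := filter directed G.

(** Balance at [x] says that the indegree plus [n1 x] equals the outdegree, and in- and outdegree
    add up to [d0 x]; this solves for the indegree. An odd class receives one edge, an even one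
    none. *)
Let t0 (z : V + N) : nat :=
  match z with
  | inl x => if (x \in W) && inX x then (d0 x - n1 x)./2 else 0
  | inr r => oddr r
  end.

Lemma t0_double x : x \in W -> inX x -> (t0 (inl x)).*2 + n1 x = d0 x.
Proof.
move=> xW Xx; rewrite /= xW Xx /=.
have := arrow_bound xW Xx; have := directed_arrow Xx; have := inst_even instG x.
by move: (d0 x) (n1 x) (deg G x); clear; lia.
Qed.

Lemma t0_sum (S : {set V + N}) : inl b \notin S ->
  (\sum_(z in S) t0 z).*2 +
    \sum_(e <- G) arrow2 e * ([&& inX e.1.1, e.1.1 \in W & inl e.1.1 \in S] +
       [&& inX e.1.2, e.1.2 \in W & inl e.1.2 \in S]) =
  \sum_(e <- G) directed e * ([&& inX e.1.1, e.1.1 \in W & inl e.1.1 \in S] +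
       [&& inX e.1.2, e.1.2 \in W & inl e.1.2 \in S]) +
  (\sum_(r | inr r \in S) oddr r).*2.
Proof.
move=> bS; pose SX u := [&& inX u, u \in W & inl u \in S].
rewrite -(sum_ends_weighted SX (fun e => arrow2 e)) -(sum_ends_weighted SX (fun e => directed e)).
have -> : \sum_(z in S) t0 z = \sum_(x | SX x) t0 (inl x) + \sum_(r | inr r \in S) oddr r.
  rewrite big_mkcond big_sumType /= -!big_mkcond /=; congr (_ + _).
  rewrite big_mkcond [RHS]big_mkcond; apply: eq_bigr => x _; rewrite /SX.
  by case: (inl x \in S); rewrite ?andbF //= !andbT andbC; case: (_ && _).
rewrite doubleD addnAC; congr (_ + _).
rewrite -mul2n big_distrr -big_split; apply: eq_bigr => x /and3P[Xx xW _] /=.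
by rewrite mul2n; apply: t0_double.
Qed.

Lemma t0_cut (S : {set V + N}) : inl b \notin S -> \sum_(e <- H) inside quot S e <= \sum_(z in S) t0 z.
Proof.
move=> bS; have := merged_cut bS; have := t0_sum bS.
have -> : \sum_(e <- H) inside quot S e = \sum_(e <- G) (directed e && inside quot S e).
  by rewrite big_filter big_mkcond; apply: eq_bigr => e _; case: (directed e).
move=> <-; rewrite addnC leq_add2r.
by rewrite leq_double.
Qed.

Lemma t0_touch (S : {set V + N}) : inl b \notin S ->
  \sum_(z in S) t0 z <= \sum_(e <- H) ((quot e.1.1 \in S) || (quot e.1.2 \in S)).
Proof.
move=> bS; have := touch_cut bS; rewrite -(t0_sum bS).
have -> : \sum_(e <- H) ((quot e.1.1 \in S) || (quot e.1.2 \in S)) =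
    \sum_(e <- G) (directed e && ((quot e.1.1 \in S) || (quot e.1.2 \in S))).
  by rewrite big_filter big_mkcond; apply: eq_bigr => e _; case: (directed e).
by move=> h; rewrite -leq_double; apply: leq_trans h; rewrite leq_addr.
Qed.

Lemma good_orientation : exists H', [/\ reoriented H H',
  forall x, x \in W -> inX x -> (\sum_(e <- H') (e.1.2 == x)).*2 + n1 x = d0 x &
  forall r, \sum_(e <- H') (T e.1.2 == Some r) = oddr r].
Proof.
(* The root receives all remaining heads; [t0_touch] shows that this is no negative number. *)
pose t z := if z == inl b then size H - \sum_(z in ~: [set inl b]) t0 z else t0 z.
have tE (S : {set V + N}) : inl b \notin S -> \sum_(z in S) t z = \sum_(z in S) t0 z.
  move=> bS; apply: eq_bigr => z zS; rewrite /t; case: eqP => // zb.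
  by rewrite -zb zS in bS.
have bN : inl b \notin ~: [set inl b : V + N] by rewrite !inE eqxx.
have touch_size (S : {set V + N}) : \sum_(e <- H) ((quot e.1.1 \in S) || (quot e.1.2 \in S)) <= size H.
  by rewrite -sum1_size; apply: leq_sum => e _; apply: leq_b1.
have le : \sum_(z in ~: [set inl b]) t0 z <= size H.
  exact: leq_trans (t0_touch bN) (touch_size _).
have tot : size H = \sum_z t z.
  rewrite (bigD1 (inl b)) //= {1}/t eqxx.
  rewrite [X in _ + X](_ : _ = \sum_(z in ~: [set inl b]) t z).
    by rewrite tE // subnK.
  by apply: eq_bigl => z; rewrite !inE.
have totS (S : {set V + N}) : \sum_z t z = \sum_(z in S) t z + \sum_(z in ~: S) t z.
  rewrite (bigID (fun z => z \in S)) /=; congr (_ + _).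
  by apply: eq_bigl => z; rewrite !inE.
have [|//|H' rH' tH'] := @orientation V _ quot H t.
  (* With the root in [S], an edge is inside [S] or touches the complement, so the condition follows
     from [t0_touch] there and the total count. *)
  move=> S; case bS: (inl b \in S); last by rewrite tE ?bS // t0_cut ?bS.
  have bS' : inl b \notin ~: S by rewrite inE bS.
  have := t0_touch bS'; rewrite -tE //.
  have : size H = \sum_(e <- H) inside quot S e +
       \sum_(e <- H) ((quot e.1.1 \in ~: S) || (quot e.1.2 \in ~: S)).
    rewrite -big_split -sum1_size; apply: eq_bigr => e _ /=; rewrite /inside !inE.
    by case: (_ \in S); case: (_ \in S).
  rewrite tot (totS S) => e1 le1.
  by rewrite -(leq_add2r (\sum_(z in ~: S) t z)) e1 leq_add2l.
exists H'; split=> // [x xW Xx|r].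
- rewrite -t0_double //; congr (_.*2 + _).
  have -> : t0 (inl x) = t (inl x).
    rewrite /t; case: eqP => // -[xb]; move: (inst_root instG).
    by rewrite -xb xW.
  by rewrite -tH'; apply: eq_bigr => e _; rewrite quot_inl.
- by rewrite -[RHS](tH' (inr r)); apply: eq_bigr => e _; rewrite quot_inr.
Qed.

Lemma even_outcome r : ~~ oddr r ->
  exists2 L, red (fun x => x \in class T r) (local G T r) L & all (outer T r) L.
Proof.
move=> evr; case: (pickP (fun u => T u == Some r)) => [u0 /eqP u0C|none].
  have [u1 u1W u1C] := nontrivial r.
  exact: (class_even instG okG IH off vT tight strict u0C u1W u1C evr).
have -> : local G T r = [::].
  apply/eqP; rewrite -[_ == _]negbK -has_filter; apply/hasPn => e _.
  by rewrite /touches !inE !none.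
by exists [::] => //; apply: red_refl.
Qed.

Lemma odd_outcome r x y w : oddr r -> T x = None -> T y = Some r ->
  (x, y, w) \in G \/ (y, x, w) \in G ->
  exists x' L, [/\ red (fun x => x \in class T r) (local G T r) ((x, x', false) :: L),
    x' \notin class T r & all (outer T r) L].
Proof.
move=> oddr1 Tx Ty eG; have [u1 u1W u1C] := nontrivial r.
by apply: (class_odd instG okG IH off vT tight strict Ty u1W u1C oddr1 _ _ eG);
  rewrite inE ?Tx ?Ty.
Qed.

Lemma reoriented_mem (A B : seq (wedge V)) e : reoriented A B -> e \in B ->
  e \in A \/ erev e \in A.
Proof.
rewrite /reoriented; elim: A B => [|a A IHA] [|c B] //= /andP[ac /IHA h].
rewrite !inE => /orP[/eqP ->|/h[->|->]]; rewrite ?orbT; auto.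
case/orP: ac => /eqP->; rewrite ?erevK eqxx; auto.
Qed.

(** * Replacing classes by passages and contracting the rest *)

Section Processing.
Variable H' : seq (wedge V).
Hypothesis reH : reoriented H H'.
Hypothesis balH : forall x, x \in W -> inX x ->
  (\sum_(e <- H') (e.1.2 == x)).*2 + n1 x = d0 x.
Hypothesis inH : forall r, \sum_(e <- H') (T e.1.2 == Some r) = oddr r.

Let rest := filter (predC directed) G.
Let oriented := H' ++ rest.
Let part r := filter (touches T r) oriented.

(** Unlike [heads1], this looks at [arrow2] and not at the weight: a non-zero edge of delta(X) has
    only one arrowhead until its class is reduced. *)
Let hd x (e : wedge V) : nat := (e.1.2 == x) + (arrow2 e && (e.1.1 == x)).
Let tl x (e : wedge V) : nat := ~~ arrow2 e && (e.1.1 == x).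

Lemma directed_rev e : directed (erev e) = directed e.
Proof. by rewrite /directed /arrow2 /= orbC andbCA. Qed.

Lemma H'_directed e : e \in H' -> directed e.
Proof.
have : all directed H' by rewrite -(reoriented_all directed_rev reH); apply: filter_all.
by move/allP; apply.
Qed.

Lemma oriented_perm : perm_eq G (H ++ rest).
Proof. by rewrite perm_sym; apply/permPl/perm_filterC. Qed.

Lemma eqv_oriented : eqv G oriented.
Proof.
exists (H ++ rest); first exact: oriented_perm.
by apply: reoriented_cat => //; apply: reoriented_refl.
Qed.

Lemma oriented_mem e : e \in oriented -> e \in G \/ erev e \in G.
Proof.
rewrite mem_cat mem_filter => /orP[|/andP[_ ->]]; last by left.
by move=> /(reoriented_mem reH)[]; rewrite mem_filter => /andP[_ ->]; auto.
Qed.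

Lemma oriented_valid e : e \in oriented -> vedge T e.
Proof.
by move=> /oriented_mem[|] /(allP vT) //; rewrite vedge_rev.
Qed.

Lemma oriented_ends e : e \in oriented -> ends_in W b e.
Proof.
by move=> /oriented_mem[|] /(allP (inst_ends instG)) //; rewrite /ends_in /= andbC.
Qed.

Lemma touches_rev r e : touches T r (erev e) = touches T r e.
Proof. by rewrite /touches /= orbC. Qed.

Lemma red_part A r : red A (part r) (local G T r).
Proof.
apply: (@red_trans _ _ _ (filter (touches T r) (H ++ rest))).
  apply: reoriented_red; apply: reoriented_filter; first exact: touches_rev.
  apply: reoriented_cat; last exact: reoriented_refl.
  exact: reoriented_sym.
by apply/red_perm/perm_filter; rewrite perm_sym; apply: oriented_perm.
Qed.

Let incoming r (e : wedge V) := inX e.1.1 && (T e.1.2 == Some r).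

Lemma sum_incoming r : \sum_(e <- part r) incoming r e = oddr r.
Proof.
rewrite -inH /part big_filter big_mkcond big_cat /= [X in _ + X]big1_seq ?addn0.
  apply: eq_big_seq => e /H'_directed; rewrite /touches /incoming /directed !inE.
  case: (T e.1.2 =P Some r) => [->|]; last by rewrite andbF; case: ifP.
  by rewrite orbT orbF => /andP[->].
move=> e /=; rewrite mem_filter /= /directed negb_and negbK => /andP[].
rewrite /touches /arrow2 /incoming !inE; case: ifP => // _.
case: (T e.1.2 =P Some r) => [->|]; last by rewrite andbF.
by rewrite !andbF orbF andbT; case: (inX _).
Qed.

Lemma part_pointwise r e x : e \in part r -> inX x ->
  hd x e + tl x e = ends_at x e /\ tl x e = (incoming r e && (e.1.1 == x)).
Proof.
rewrite mem_filter => /andP[te eo] Xx; have := oriented_valid eo.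
move: te; rewrite /touches !inE /hd /tl /arrow2 /incoming /ends_at /vedge.
case: (eqVneq e.1.1 x) => [->|_]; last by rewrite !andbF addn0 add0n addn0.
rewrite Xx /= (eqP Xx) /=.
case Tv: (T e.1.2) => [a|] //= /eqP[->] _; rewrite eqxx /=.
by have -> : (e.1.2 == x) = false by apply/negP => /eqP vx; rewrite vx (eqP Xx) in Tv.
Qed.

Lemma outcome_ends r A Y u : red A (local G T r) Y -> ~~ A u -> u \notin class T r ->
  0 < deg Y u -> inX u && ((u \in W) || (u == b)).
Proof.
move=> rY Au uC; rewrite -(red_deg rY Au) => /sum_pos_has[e].
rewrite mem_filter => /andP[te eG]; have [_ /(_ te)[h1 h2]] := crossing_ends r vT eG.
have /andP[e1 e2] := allP (inst_ends instG) e eG.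
rewrite /ends_at; case: (eqVneq e.1.1 u) => [E _|_].
  have -> : T u = None by rewrite -E; apply: h1; rewrite E.
  by rewrite -E.
case: (eqVneq e.1.2 u) => // E _.
have -> : T u = None by rewrite -E; apply: h2; rewrite E.
by rewrite -E.
Qed.

Lemma deg_pos_mem (Y : seq (wedge V)) e x : e \in Y -> (e.1.1 == x) || (e.1.2 == x) -> 0 < deg Y x.
Proof.
move=> eY h; rewrite /deg (big_rem e) //= /ends_at.
by case/orP: h => ->; rewrite ?addn1.
Qed.

(** Replacing the edges of a class by its passages keeps heads minus tails at every vertex of X. A
    non-zero passage has arrowheads at both ends, matching two edges that leave the class; the zero
    passage of an odd class matches its one entering edge and one leaving edge. *)
Lemma class_outcome r : exists Y, [/\
  red (fun x => x \in class T r) (part r) Y,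
  all (fun e => [&& inX e.1.1, inX e.1.2 & ends_in W b e]) Y,
  forall x, x \in W -> inX x ->
    \sum_(e <- Y) tl x e + \sum_(e <- part r) hd x e =
    \sum_(e <- Y) hd x e + \sum_(e <- part r) tl x e &
  (count (fun e => e.2) Y).*2 + (oddr r).*2 = ncross G T r].
Proof.
have cross Y : red (fun x => x \in class T r) (local G T r) Y ->
    all (fun e => (e.1.1 \notin class T r) && (e.1.2 \notin class T r)) Y ->
    all (fun e => [&& inX e.1.1, inX e.1.2 & ends_in W b e]) Y /\ (size Y).*2 = ncross G T r.
  move=> rY oY; split.
    apply/allP => e eY; have /andP[o1 o2] := allP oY e eY.
    have p1 : 0 < deg Y e.1.1 by apply: (deg_pos_mem eY); rewrite eqxx.
    have p2 : 0 < deg Y e.1.2 by apply: (deg_pos_mem eY); rewrite eqxx orbT.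
    have /andP[-> h1] := outcome_ends rY o1 o1 p1.
    have /andP[-> h2] := outcome_ends rY o2 o2 p2.
    by rewrite /ends_in h1 h2.
  have -> : ncross G T r = \sum_(x | x \notin class T r) deg (local G T r) x.
    rewrite (sum_ends (fun x => x \notin class T r)) big_filter [RHS]big_mkcond.
    apply: eq_bigr => e _; rewrite /touches.
    by case: (_ \in class T r); case: (_ \in class T r).
  rewrite (eq_bigr (deg Y)); last by move=> x xC; apply: red_deg rY xC.
  rewrite (sum_ends (fun x => x \notin class T r)) -sum1_size -mul2n big_distrr.
  by apply: eq_big_seq => e /(allP oY)/andP[-> ->].
have hdE x : inX x -> \sum_(e <- part r) hd x e + \sum_(e <- part r) tl x e = deg (local G T r) x.
  move=> Xx; have xC : x \notin class T r by rewrite inE (eqP Xx).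
  rewrite -(red_deg (red_part (fun x => x \in class T r) r) xC) -big_split.
  by apply: eq_big_seq => e eP /=; have [] := part_pointwise eP Xx.
have tlE x : inX x -> \sum_(e <- part r) tl x e = \sum_(e <- part r) (incoming r e && (e.1.1 == x)).
  by move=> Xx; apply: eq_big_seq => e eP; have [] := part_pointwise eP Xx.
have outerE L e : all (outer T r) L -> e \in L -> [/\ e.1.1 \notin class T r, e.1.2 \notin class T r & e.2].
  by move=> /allP h /h /and3P[].
have hdL L x : all (outer T r) L -> all (fun e => [&& inX e.1.1, inX e.1.2 & ends_in W b e]) L ->
    \sum_(e <- L) hd x e = deg L x /\ \sum_(e <- L) tl x e = 0.
  move=> oL iL; split.
    apply: eq_big_seq => e eL; have [_ _ e2] := outerE L e oL eL.
    have /and3P[X1 X2 _] := allP iL e eL.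
    by rewrite /hd /arrow2 X1 X2 e2 /ends_at addnC.
  rewrite big1_seq // => e /andP[_ eL]; have [_ _ e2] := outerE L e oL eL.
  have /and3P[X1 X2 _] := allP iL e eL.
  by rewrite /tl /arrow2 X1 X2 e2.
case: (boolP (oddr r)) => [oddr1|evr].
  have pos : 0 < \sum_(e <- part r) incoming r e by rewrite sum_incoming oddr1.
  have [f fP incf] := sum_pos_has pos.
  have p := perm_to_rem fP; set R := rem f _ in p.
  have noR e : e \in R -> incoming r e = false.
    move=> eR; have := sum_incoming r; rewrite (perm_big _ p) big_cons oddr1 /=.
    rewrite (big_rem e) //=; move: incf.
    by case: (incoming r f) => //; case: (incoming r e).
  move: incf; rewrite lt0b /incoming => /andP[Xf /eqP vf].
  have fG : (f.1.1, f.1.2, f.2) \in G \/ (f.1.2, f.1.1, f.2) \in G.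
    move: fP; rewrite mem_filter => /andP[_ /oriented_mem].
    by rewrite /erev; case: (f) => [[? ?] ?].
  (* The entering edge [f] is the one prescribed, so the zero passage starts where [f] has its
     tail. *)
  have [x' [L [rL x'C oL]]] := odd_outcome oddr1 (eqP Xf) vf fG.
  have fC : f.1.1 \notin class T r by rewrite inE (eqP Xf).
  set Y := (f.1.1, x', false) :: L in rL.
  have [iY sY] : all (fun e => [&& inX e.1.1, inX e.1.2 & ends_in W b e]) Y /\ (size Y).*2 = ncross G T r.
    apply: cross => //; rewrite /= fC x'C /=.
    by apply: sub_all oL => e /and3P[-> ->].
  exists Y; split=> //.
  - exact: red_trans (red_part _ _) rL.
  - move=> x xW Xx; have xC : x \notin class T r by rewrite inE (eqP Xx).
    have iL : all (fun e => [&& inX e.1.1, inX e.1.2 & ends_in W b e]) L by case/andP: iY.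
    have [hL tL] := hdL L x oL iL.
    have tM : \sum_(e <- part r) tl x e = (f.1.1 == x).
      rewrite tlE // (perm_big _ p) big_cons big1_seq ?addn0.
        by rewrite /incoming Xf vf eqxx /= addn0.
      by move=> e /= eR; rewrite noR.
    have := hdE x Xx; rewrite (red_deg rL xC) /Y /deg !big_cons -/(deg L x) hL tL tM.
    rewrite /hd /tl /ends_at /arrow2 /= !andbF /=.
    by move: (\sum_(e <- part r) _) (deg L x) (f.1.1 == x) (x' == x); clear; move=> a c [] [] /=; lia.
  - have -> : count (fun e => e.2) Y = size L.
      by apply/eqP; rewrite /= -all_count; apply: sub_all oL => e /and3P[].
    by rewrite -sY /=; clear; lia.
have [L rL oL] := even_outcome evr.
have [iL sL] : all (fun e => [&& inX e.1.1, inX e.1.2 & ends_in W b e]) L /\ (size L).*2 = ncross G T r.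
  by apply: cross => //; apply: sub_all oL => e /and3P[-> ->].
exists L; split=> //.
- exact: red_trans (red_part _ _) rL.
- move=> x xW Xx; have xC : x \notin class T r by rewrite inE (eqP Xx).
  have [hL tL] := hdL L x oL iL.
  have tM : \sum_(e <- part r) tl x e = 0.
    have := sum_incoming r; rewrite (negbTE evr) tlE // => /eqP.
    rewrite sum_nat_seq_eq0 => /allP h; rewrite big1_seq // => e /= eP.
    by have /eqP := h e eP; case: (incoming r e).
  by have := hdE x Xx; rewrite (red_deg rL xC) hL tL tM addn0 add0n addn0.
- have -> : count (fun e => e.2) L = size L.
    by apply/eqP; rewrite -all_count; apply: sub_all oL => e /and3P[].
  by rewrite sL addn0.
Qed.

Lemma touches_inj r r' e : vedge T e -> touches T r e -> touches T r' e -> r = r'.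
Proof.
rewrite /touches !inE /vedge; case: (T e.1.1) => [a|]; case: (T e.1.2) => [c|] //.
- by move=> /eqP <-; rewrite !orbb => /eqP[->] /eqP[->].
- by rewrite !orbF => _ /eqP[->] /eqP[->].
- by rewrite !orFb => _ /eqP[->] /eqP[->].
Qed.

(** [rs] lists the classes still to be reduced; the invariant is that their edges are untouched so
    far and X is balanced. Each class turns its crossing edges into half as many passages, all
    non-zero except one if it is odd. *)
Lemma process_classes rs M : uniq rs -> all (ends_in W b) M -> valid T M ->
  (forall e r, e \in M -> touches T r e -> r \in rs) ->
  (forall r, r \in rs -> perm_eq (filter (touches T r) M) (part r)) ->
  (forall x, x \in W -> inX x -> \sum_(e <- M) tl x e = \sum_(e <- M) hd x e) ->
  exists L, [/\ red (fun x => x \in W) M L, all (fun e => e.1 == (b, b)) L &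
    (count (fun e => e.2) L).*2 + (\sum_(r <- rs) oddr r).*2 =
    (count arrow2 M).*2 + \sum_(r <- rs) ncross G T r].
Proof.
elim: rs M => [|r rs IHrs] M.
  move=> _ eM vM noT _ balM.
  have MX e : e \in M -> inX e.1.1 && inX e.1.2.
    move=> eM1; have := noT e ^~ eM1; rewrite /touches.
    case Tu: (T e.1.1) => [a|] /=; first by move=> /(_ a); rewrite !inE Tu eqxx => /(_ isT).
    by case Tv: (T e.1.2) => [a|] //= /(_ a); rewrite !inE Tv eqxx orbT => /(_ isT).
  have aE e : e \in M -> arrow2 e = e.2 by rewrite /arrow2 andbA => /MX->.
  have bA : ~~ ((b \in W) && inX b) by rewrite (negbTE (inst_root instG)).
  (* With no class left, both ends of every edge lie in X, so [arrow2] is the weight and [hd], [tl]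
     are the counts of [balanced_red]. *)
  have [||L [rL lL cL]] := @balanced_red _ (fun x => (x \in W) && inX x) b M bA.
  - apply/allP => e eM1; have /andP[-> ->] := MX e eM1; rewrite !andbT.
    exact: (allP eM).
  - move=> x /andP[xW Xx]; have := balM x xW Xx.
    rewrite (eq_big_seq (tails1 x)); last by move=> e /aE; rewrite /tl /tails1 => ->.
    by rewrite [RHS](eq_big_seq (heads1 x)) // => e /aE; rewrite /hd /heads1 => ->.
  exists L; split=> //; first by apply: red_mono rL => x /andP[].
  rewrite !big_nil !addn0 cL; congr _.*2.
  by apply: eq_in_count => e /aE.
move=> /= /andP[rrs urs] eM vM Mrs Mpart balM.
have [Y [rY iY hY cY]] := class_outcome r.
set F := filter (predC (touches T r)) M.
have pM : perm_eq M (part r ++ F).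
  rewrite perm_sym; apply: perm_trans (_ : perm_eq (filter (touches T r) M ++ F) M).
    by rewrite perm_cat2r perm_sym Mpart ?mem_head.
  exact/permPl/perm_filterC.
have part0 e : e \in part r -> arrow2 e = false.
  rewrite mem_filter /touches /arrow2 !inE => /andP[+ _].
  by case: (T e.1.1); case: (T e.1.2).
have YX e : e \in Y -> inX e.1.1 /\ inX e.1.2 by move=> /(allP iY)/and3P[].
have Ytouch r' e : e \in Y -> touches T r' e = false.
  by move=> /YX[/eqP X1 /eqP X2]; rewrite /touches !inE X1 X2.
have Fsub e : e \in F -> e \in M /\ ~~ touches T r e by rewrite mem_filter => /andP[].
have [||||| L [rL lL cL]] := IHrs (Y ++ F) urs.
- rewrite all_cat; apply/andP; split; first by apply: sub_all iY => e /and3P[].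
  by apply/allP => e /Fsub[eM1 _]; apply: (allP eM).
- rewrite /valid all_cat; apply/andP; split.
    by apply/allP => e /YX[/eqP X1 _]; rewrite /vedge X1.
  by apply/allP => e /Fsub[eM1 _]; apply: (allP vM).
- move=> e r'; rewrite mem_cat => /orP[eY|/Fsub[eM1 nt]]; first by rewrite Ytouch.
  by move=> te; have := Mrs e r' eM1 te; rewrite inE => /orP[/eqP E|//]; rewrite -E te in nt.
- move=> r' r'rs; rewrite filter_cat [filter _ Y](_ : _ = [::]); last first.
    by apply/eqP; rewrite -[_ == _]negbK -has_filter; apply/hasPn => e /Ytouch->.
  rewrite /= -filter_predI; apply: perm_trans (Mpart r' _); last by rewrite inE r'rs orbT.
  rewrite (@eq_in_filter _ _ (touches T r')) // => e eM1 /=.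
  case te: (touches T r' e) => //=; apply/negP => te'.
  by move: rrs; rewrite (touches_inj (allP vM e eM1) te' te) r'rs.
- move=> x xW Xx; have := balM x xW Xx; have := hY x xW Xx.
  rewrite !(perm_big _ pM) /= !big_cat /=.
  move: (\sum_(e <- Y) tl x e) (\sum_(e <- Y) hd x e) (\sum_(e <- part r) tl x e).
  move: (\sum_(e <- part r) hd x e) (\sum_(e <- F) hd x e) (\sum_(e <- F) tl x e).
  by clear; lia.
exists L; split=> //.
  apply: (red_trans (red_perm _ pM)); apply: red_trans rL; apply: red_catr.
  by apply: red_mono rY => u; apply: (subsetP (class_sub r off)).
move: cL; rewrite !big_cons (permP pM) !count_cat.
have -> : count arrow2 (part r) = 0.
  by rewrite -(count_pred0 (part r)); apply: eq_in_count => e /part0.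
have -> : count arrow2 Y = count (fun e => e.2) Y.
  by apply: eq_in_count => e /YX[X1 X2]; rewrite /arrow2 X1 X2.
rewrite -cY; move: (count _ L) (count _ Y) (count _ F) (\sum_(r <- rs) _) (\sum_(r <- rs) _).
by case: (_ == 2); clear => /=; lia.
Qed.

Lemma oriented_flood : flood b W G k.
Proof.
have [|||||L [rL lL cL]] := @process_classes (enum N) oriented (enum_uniq _).
- by apply/allP => e /oriented_ends.
- by apply/allP => e /oriented_valid.
- by move=> e r _ _; rewrite mem_enum.
- by [].
- move=> x xW Xx; rewrite !big_cat /=.
  have hH : \sum_(e <- H') tl x e = \sum_(e <- H') (e.1.1 == x).
    apply: eq_big_seq => e /H'_directed /andP[_ h].
    by rewrite /tl h.
  have hH' : \sum_(e <- H') hd x e = \sum_(e <- H') (e.1.2 == x).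
    apply: eq_big_seq => e /H'_directed /andP[_ /negbTE h].
    by rewrite /hd h addn0.
  have hR : \sum_(e <- rest) tl x e = 0.
    rewrite big1_seq // => e; rewrite mem_filter /= /directed => /andP[+ _].
    rewrite negb_and negbK /tl; case: (arrow2 e) => //=; rewrite orbF negb_or => /andP[h _].
    by case: eqP => // E; rewrite E Xx in h.
  have hR' : \sum_(e <- rest) hd x e = n1 x.
    rewrite big_filter big_mkcond; apply: eq_bigr => e _ /=.
    rewrite /directed /hd /ends_at; case h: (arrow2 e) => /=.
      by rewrite andbF /= addnC mul1n.
    rewrite andbT mul0n; case: ifP => //; rewrite negb_or => /andP[_ h2].
    by case: eqP => // E; rewrite E Xx in h2.
  have dH : \sum_(e <- H') (e.1.1 == x) + \sum_(e <- H') (e.1.2 == x) = d0 x.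
    rewrite -big_split /= -(reoriented_sum (F := ends_at x) _ reH); last first.
      by move=> e; rewrite /ends_at /= addnC.
    by rewrite big_filter big_mkcond; apply: eq_bigr => e _; case: (directed e); rewrite ?mul1n ?mul0n.
  rewrite hH hH' hR hR'; have := balH xW Xx; rewrite -dH.
  by move: (\sum_(e <- H') _) (\sum_(e <- H') _) (n1 x); clear; lia.
exists L; split=> //.
  exact: red_trans (eqv_red _ eqv_oriented) rL.
rewrite -leq_double.
have cA : count arrow2 oriented = \sum_(e <- G) arrow2 e.
  rewrite -sumn_count sumnE big_map; apply/esym/(eqv_sum _ eqv_oriented) => e.
  by rewrite /arrow2 /= andbCA.
(* With this form of the cost, tightness of [T] says that the number of non-zero loops obtained is
   exactly [k]. *)
have cG : cost T G = (\sum_(e <- G) arrow2 e).*2 + \sum_r ncross G T r.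
  rewrite /ncross exchange_big /= -mul2n big_distrr -big_split /=.
  apply: eq_big_seq => e /(allP vT); rewrite /vedge /cost1 /arrow2.
  have sum1 r0 (f : N -> bool) : (forall r, f r = (r0 == r)) -> \sum_r f r = 1.
    move=> fE; rewrite (bigD1 r0) //= fE eqxx big1 ?addn0 // => r rr0.
    by rewrite fE eq_sym (negbTE rr0).
  under eq_bigr do rewrite !inE.
  case Tu: (T e.1.1) => [a|]; case Tv: (T e.1.2) => [c|] /=.
  + by move=> /eqP ->; rewrite big1 // => r _; rewrite addbb.
  + by rewrite (sum1 a) // => r; rewrite addbF.
  + by rewrite (sum1 c).
  + by rewrite big1 //; case: (e.2).
move: cL tight; rewrite !big_enum /= cA cG -/(nodd T G).
by move: (count _ L) (nodd T G) (\sum_(e <- G) _) (\sum_r _); clear; lia.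
Qed.

End Processing.

Lemma nontrivial_flood : flood b W G k.
Proof.
by have [H' [reH balH inH]] := good_orientation; apply: (oriented_flood reH).
Qed.

End Assembly.

(** * The min-max theorem for reductions *)

Section Tightness.
Variable V : finType.
Implicit Types (W K : {set V}) (G : seq (wedge V)) (b : V).

(** Rank above 1 excludes only the certificates whose X misses [W] and which have at most one class
    meeting [W]. By parity, missing tightness means a gap of 4. *)
Definition strict k W G := forall (s : V -> bool) (N : finType) (T : V -> option N),
  (forall u, u \notin W -> T u = None) -> valid T G -> 1 < rank W T ->
  k.*2 + (nodd T (shift s G)).*2 + 4 <= cost T (shift s G).

Definition smaller W G := forall (b' : V) (W' : {set V}) (G' : seq (wedge V)) k',
  instance b' W' G' -> ok k' W' G' ->
  #|W'| + size G' < #|W| + size G -> flood b' W' G' k'.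

Lemma shift0 G : shift (fun=> false) G = G.
Proof. by rewrite /shift map_id_in // => -[[u v] w] _; rewrite emapE !addbF. Qed.

Lemma flood_leq b W G k k' : k' <= k -> flood b W G k -> flood b W G k'.
Proof. by move=> kk [L [rL lL cL]]; exists L; split=> //; apply: leq_trans cL. Qed.

(** Once [k] has the parity of the total weight, both sides agree modulo 4, so being short by less
    than 4 means not being short at all. *)
Lemma ok_parity k G s (N : finType) (T : V -> option N) : even_graph G ->
  valid T G -> (tweight G).*2 = k.*2 %[mod 4] ->
  k.*2 + (nodd T (shift s G)).*2 < cost T (shift s G) + 4 ->
  k.*2 + (nodd T (shift s G)).*2 <= cost T (shift s G).
Proof.
move=> ev vT; have vT' : valid T (shift s G) by rewrite valid_shift.
have := bound_parity (even_shift s ev) vT'; rewrite tweight_shift //.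
by move: (nodd _ _) (cost _ _) (tweight G) => n c t; clear; lia.
Qed.

Lemma tight_parity k G s (N : finType) (T : V -> option N) : even_graph G ->
  valid T G -> k.*2 + (nodd T (shift s G)).*2 = cost T (shift s G) ->
  (tweight G).*2 = k.*2 %[mod 4].
Proof.
move=> ev vT; have vT' : valid T (shift s G) by rewrite valid_shift.
have := bound_parity (even_shift s ev) vT'; rewrite tweight_shift //.
by move: (nodd _ _) (cost _ _) => n c; lia.
Qed.

Lemma rank_bound W (N : finType) (T : V -> option N) : rank W T <= 3 * #|V|.
Proof.
have h1 : #|[set u in W | T u == None]| <= #|V| by apply: max_card.
suff : #|[set r | [exists u in W, T u == Some r]]| <= #|V| by rewrite /rank; move: h1; lia.
pose f (r : N) := odflt (@None V) (Some [pick u in W | T u == Some r]).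
have inj : {in [set r | [exists u in W, T u == Some r]] &, injective (fun r => [pick u in W | T u == Some r])}.
  move=> r r'; rewrite !inE => /existsP[u /andP[uW Tu]] _.
  case: pickP => [x /andP[xW /eqP Tx]|/(_ u)]; last by rewrite uW Tu.
  by case: pickP => // x' /andP[_ /eqP Tx'] [E]; move: Tx; rewrite E Tx' => -[].
rewrite -(card_in_imset inj).
have : [set [pick u in W | T u == Some r] | r in [set r | [exists u in W, T u == Some r]]]
    \subset [set Some x | x in V].
  apply/subsetP => o /imsetP[r]; rewrite inE => /existsP[u /andP[uW Tu]] ->.
  case: pickP => [x _|/(_ u)]; first by rewrite mem_imset //; exact: Some_inj.
  by rewrite uW Tu.
by move/subset_leq_card => h; apply: leq_trans h _; apply: leq_imset_card.
Qed.

(** Rank is bounded, so a tight certificate of maximal rank exists, possibly with another shift [s];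
    the graph is replaced by its shift, and parity turns maximality into the gap of 4. *)
Lemma tight_flood b W G k s (N : finType) (T : V -> option N) :
  instance b W G -> ok k W G -> smaller W G ->
  (forall u, u \notin W -> T u = None) -> valid T G ->
  k.*2 + (nodd T (shift s G)).*2 = cost T (shift s G) -> 1 < rank W T ->
  flood b W G k.
Proof.
move=> inst okG IH; have [d] := ubnP (3 * #|V| - rank W T).
elim: d s N T => // d IHd s N T rd off vT tight rk.
have [[s' [N' [T' [off' vT' tight' rk']]]]|no] :=
  EM (exists s' (N' : finType) (T' : V -> option N'),
    [/\ forall u, u \notin W -> T' u = None, valid T' G,
        k.*2 + (nodd T' (shift s' G)).*2 = cost T' (shift s' G) & rank W T < rank W T']).
  apply: (IHd s' N' T' _ off' vT' tight'); last exact: ltn_trans rk'.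
  by have := rank_bound W T'; move: rd rk'; clear; lia.
apply: (flood_shift (s := s)).
apply: (nontrivial_flood (T := T)) => //.
- exact: instance_shift.
- exact: ok_shift.
- by move=> b' W' G' k' i' o'; rewrite size_map; apply: IH.
- by rewrite valid_shift.
- move=> s' N' T' off'; rewrite valid_shift shift_add => vT' rk'.
  set t := fun x => _.
  have ok' := okG t N' T' off' vT'.
  have ne : k.*2 + (nodd T' (shift t G)).*2 != cost T' (shift t G).
    by apply/eqP => E; apply: no; exists t, N', T'.
  have p1 := tight_parity (inst_even inst) vT tight.
  have vt' : valid T' (shift t G) by rewrite valid_shift.
  have := bound_parity (even_shift t (inst_even inst)) vt'.
  rewrite tweight_shift ?p1; last exact: inst_even inst.
  by move: ok' ne; move: (nodd _ _) (cost _ _) => n c; clear; lia.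
- move=> r; case: (boolP [exists u in W, T u != Some r]) => [/existsP[u /andP[uW Tu]]|].
    by exists u.
  rewrite negb_exists => /forallP all; exfalso; move: rk; rewrite /rank.
  have allr u : u \in W -> T u = Some r.
    by move=> uW; have := all u; rewrite uW /= negbK => /eqP.
  have -> : [set u in W | T u == None] = set0.
    apply/setP => u; rewrite !inE; case uW: (u \in W) => //=.
    by rewrite allr.
  have : #|[set r0 | [exists u in W, T u == Some r0]]| <= #|[set r]|.
    apply: subset_leq_card; apply/subsetP => r0; rewrite !inE => /existsP[u /andP[uW]].
    by rewrite allr // => /eqP[->].
  by rewrite cards0 cards1; clear; lia.
Qed.

Definition single W u : option unit := if u \in W then Some tt else None.

Lemma single_off W u : u \notin W -> single W u = None.
Proof. by rewrite /single => /negbTE->. Qed.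

Lemma single_valid W G : valid (single W) G.
Proof. by apply/allP => e _; rewrite /vedge /single; case: (e.1.1 \in W); case: (e.1.2 \in W) => //; apply: eqxx. Qed.

(** If X misses [W], the cost comes only from root edges into [W] and from root loops, so it depends
    neither on the partition into classes nor on the shift. *)
Lemma full_cost b W G s (N : finType) (T : V -> option N) : b \notin W ->
  all (ends_in W b) G -> (forall u, u \notin W -> T u = None) ->
  (forall u, u \in W -> T u != None) ->
  cost T (shift s G) = cost (single W) G.
Proof.
move=> bW eW off on; rewrite /cost /shift big_map; apply: eq_big_seq => e /(allP eW).
rewrite /ends_in /cost1 /single /=.
have offb := off b bW.
case uW: (e.1.1 \in W); case vW: (e.1.2 \in W) => /=.
- by have := on _ uW; have := on _ vW; case: (T e.1.1) => // a; case: (T e.1.2).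
- by move=> /eqP ->; rewrite offb; have := on _ uW; case: (T _).
- by rewrite andbT => /eqP ->; rewrite offb; have := on _ vW; case: (T _).
- by move=> /andP[/eqP -> /eqP ->]; rewrite offb addbb addbF.
Qed.

Lemma nodd_single_le1 G (T : V -> option unit) : nodd T G <= 1.
Proof.
rewrite /nodd (bigD1 tt) //= big1 ?addn0; last by case.
by case: (_ == 2).
Qed.

(** The root end of the edge becomes a separate vertex [None], where the flip is a shift. A single
    final loop ends at [None], so undoing the flip loses at most one non-zero loop. *)
Lemma unflip_flood b W v w R k : b \notin W -> flood b W ((b, v, ~~ w) :: R) k.+1 ->
  flood b W ((b, v, w) :: R) k.
Proof.
move=> bW [L [rL lL cL]].
pose g (o : option V) := odflt b o; pose s (o : option V) := ~~ isSome o.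
pose Gh : seq (wedge (option V)) := (None, Some v, w) :: map (emap Some (fun=> false)) R.
have GhE : map (emap g s) Gh = (b, v, ~~ w) :: R.
  rewrite /= emapE /= addbT -map_comp map_id_in // => -[[u v'] w'] _.
  by rewrite /= /emap /= !addbF.
rewrite -GhE in rL; have [|L' rL' LE] := red_lift _ rL.
  by move=> [x|] [y|] //= => [-> //|->|<-]; rewrite (negbTE bW).
have dN : deg L' None = 1.
  by rewrite -(red_deg rL') /= ?(negbTE bW) // /deg big_cons big_map big1_seq.
exists (map (emap g (fun=> false)) L'); split.
- have -> : (b, v, w) :: R = map (emap g (fun=> false)) Gh.
    rewrite /= emapE /= !addbF -map_comp map_id_in // => -[[u v'] w'] _.
    by rewrite /= /emap /= !addbF.
  by apply: red_map rL' => -[u|].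
- rewrite all_map; apply/allP => e eL; have : emap g s e \in L by rewrite LE map_f.
  by move/(allP lL).
- rewrite -ltnS; apply: leq_trans cL _; rewrite LE -addn1 -dN /deg.
  elim: (L') => [|e M IHM] /=; first by rewrite big_nil.
  rewrite big_cons addnACA; apply: leq_add => //.
  rewrite addbF /ends_at /s.
  by case: (e.1.1) => [x|]; case: (e.1.2) => [y|]; case: (e.2).
Qed.

(** Non-zero loops come in pairs, and two of them split into one zero loop. *)
Lemma red_loops (A : pred V) v L : A v -> all (fun e => e.1 == (v, v)) L ->
  ~~ tweight L -> red A L [::].
Proof.
move=> Av; have [n] := ubnP (size L); elim: n L => // n IH [|[[x y] w] L] //= sL.
  by move=> _ _; apply: red_refl.
move=> /andP[/eqP[-> ->] lL]; rewrite tweight_cons /=; case: w => /= tL; last first.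
  by apply: red_trans (red_loop _ Av) _; apply: IH.
have [e eL ew] : exists2 e, e \in L & e.2.
  apply/hasP; rewrite has_count -sumn_count sumnE big_map.
  by move: tL; rewrite negbK /tweight; case: (\sum_(e <- L) _).
have p := perm_to_rem eL.
have eE : e = (v, v, true).
  by have /eqP := allP lL e eL; move: ew; case: (e) => [[? ?] ?] /= -> [-> ->].
rewrite eE in p.
apply: red_trans (red_perm _ (_ : perm_eq _ [:: (v, v, true), (v, v, true) & rem (v, v, true) L])) _.
  by rewrite perm_cons.
apply: red_trans (red_split _ _ _ _ _ Av) _; apply: red_trans (red_loop _ Av) _.
apply: IH.
- by move: sL; rewrite (perm_size p) /= ltnS => /ltnW.
- by move: lL; rewrite (perm_all _ p) => /andP[].
- by move: tL; rewrite (tweight_perm p) tweight_cons /= negbK.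
Qed.

End Tightness.

(** * The one-class case and the main induction *)

Section Induction.
Variable V : finType.
Implicit Types (W K : {set V}) (G : seq (wedge V)) (b : V).

Lemma count_sum (P : pred (wedge V)) G : count P G = \sum_(e <- G) P e.
Proof. by elim: G => [|e G IH]; rewrite ?big_nil // big_cons /= IH. Qed.

(** If no edge joins [W] to the root there is nothing to split off. The part on [W] has even weight;
    rerooted at [v] it is a smaller instance, and the loops it leaves at [v] vanish in pairs. Only
    the root's own loops count. *)
Lemma reroot_flood b W G k v : instance b W G -> ok k W G -> smaller W G -> v \in W ->
  closed_in G W -> k.*2 + (nodd (single W) G).*2 = cost (single W) G -> flood b W G k.
Proof.
move=> [bW eW ev clG] okG IH vW clW tight.
pose inW (e : wedge V) := e.1.1 \in W.
set GW := filter inW G; set Gb := filter (predC inW) G.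
have p : perm_eq G (GW ++ Gb) by rewrite perm_sym; apply/permPl/perm_filterC.
have GbE e : e \in Gb -> e.1 = (b, b).
  rewrite mem_filter => /andP[/= uW eG]; have /eqP := allP clW e eG.
  have := allP eW e eG; rewrite /ends_in; rewrite -/(inW e) (negbTE uW) /= => /andP[/eqP ub].
  move=> + vE; rewrite -vE /= => /eqP vb.
  by case: (e) ub vb => [[x y] w] /= -> ->.
have GWE e : e \in GW -> (e.1.1 \in W) && (e.1.2 \in W).
  rewrite mem_filter => /andP[uW eG]; have /eqP <- := allP clW e eG.
  by rewrite -/(inW e) uW.
have tGW : ~~ tweight GW.
  have := clG W bW clW; congr (~~ odd _).
  by rewrite [RHS]big_filter [RHS]big_mkcond; apply: eq_bigr => e _; rewrite /inW; case: (_ \in W).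
have costE (N : finType) (T : V -> option N) s : (forall u, u \notin W -> T u = None) ->
    cost T (shift s G) = cost T (shift s GW) + (count (fun e => e.2) Gb).*2.
  move=> off; rewrite (cost_perm T (perm_map (emap id s) p)) map_cat cost_cat; congr (_ + _).
  rewrite /cost big_map count_sum -mul2n big_distrr /=; apply: eq_big_seq => e /GbE.
  by case: e => [[x y] w] /= [-> ->]; rewrite /cost1 /= off // addbb addbF mul2n.
(* With [W] closed, the doubled bound is twice this count minus twice the oddness of the class;
   parity makes the class even. *)
have kb : k = count (fun e => e.2) Gb.
  have c0 : cost (single W) GW = 0.
    rewrite /cost big1_seq // => e /andP[_ /GWE/andP[h1 h2]].
    by rewrite /cost1 /single h1 h2.
  have := costE _ (single W) (fun=> false) (@single_off _ W); rewrite !shift0 c0 add0n => cE.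
  move: tight; rewrite cE.
  have := bound_parity ev (single_valid W G); rewrite cE.
  have -> : tweight G = odd (count (fun e => e.2) Gb).
    rewrite (tweight_perm p) /tweight big_cat oddD -/(tweight GW) (negbTE tGW) /=.
    by rewrite -count_sum.
  have := nodd_single_le1 G (single W).
  move: (nodd _ _) (count _ _) => n c; case: n => [|[|]] //; clear; lia.
have endsv : all (ends_in (W :\ v) v) GW.
  apply/allP => e /GWE/andP[h1 h2]; rewrite /ends_in !inE h1 h2 !andbT.
  by rewrite !orNb.
have inst : instance v (W :\ v) GW.
  split=> //.
  - by rewrite !inE eqxx.
  - apply: (even_from_root _ endsv) => [|x]; rewrite !inE ?eqxx // => /andP[_ xW].
    have := ev x; rewrite (deg_perm x p) /deg big_cat /= [X in _ + X]big1_seq ?addn0 //.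
    move=> e /= /GbE eb; rewrite /ends_at eb /=.
    by have -> : (b == x) = false by apply: contraNF bW => /eqP ->.
  - move=> K vK cK; have bK : b \notin K :&: W by rewrite inE (negbTE bW) andbF.
    have cK' : closed_in G (K :&: W).
      rewrite /closed_in (perm_all _ p) all_cat; apply/andP; split; apply/allP => e eG /=.
        by have /andP[h1 h2] := GWE e eG; rewrite !inE h1 h2 !andbT; apply: (allP cK).
      by rewrite (GbE e eG) /=.
    have := clG _ bK cK'; congr (~~ odd _).
    rewrite (perm_big _ p) big_cat /= [X in _ + X]big1_seq ?addn0.
      by apply: eq_big_seq => e /GWE/andP[h1 h2]; rewrite inE h1 andbT.
    by move=> e /= /GbE ->; rewrite (negbTE bK).
have ok0 : ok 0 (W :\ v) GW.
  move=> s N T off vT.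
  have off' u : u \notin W -> T u = None by move=> uW; apply: off; rewrite !inE (negbTE uW) andbF.
  have vT' : valid T G.
    rewrite (valid_perm T p) /valid all_cat; apply/andP; split=> //.
    by apply/allP => e /GbE eb; rewrite /vedge eb /= off'.
  have := okG s N T off' vT'; rewrite costE // kb => h.
  have : nodd T (shift s GW) = nodd T (shift s G).
    apply: eq_bigr => r _; rewrite (charge_perm T r (perm_map (emap id s) p)).
    have -> : charge T (map (emap id s) (GW ++ Gb)) r = charge T (shift s GW) r; last by [].
    rewrite /charge map_cat big_cat /= [X in _ + X]big1_seq ?addn0 // => e.
    move=> /= /mapP[f /GbE fb ->].
    by rewrite /charge1 /= fb /= off'.
  by move=> ->; move: h; rewrite addnC leq_add2r.
have sz : #|W :\ v| + size GW < #|W| + size G.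
  have := cardsD1 v W; rewrite vW; have : size GW <= size G by rewrite size_filter count_size.
  by move: (size GW) (size G) (#|_|) (#|_|); clear; lia.
have [L [rL lL _]] := IH _ _ _ _ inst ok0 sz.
exists Gb; split.
- apply: red_trans (red_perm _ p) _; rewrite -[Gb in X in red _ _ X]cat0s; apply: red_catr.
  apply: red_trans (_ : red _ GW L) _.
    by apply: red_mono rL => x; rewrite inE => /andP[].
  apply: (red_loops (v := v)) => //.
  by rewrite -(red_tweight rL).
- by apply/allP => e /GbE ->.
- by rewrite kb.
Qed.

Lemma nodd_support (N : finType) (T : V -> option N) G (D : seq N) :
  (forall u, oapp (fun r => r \in D) true (T u)) -> uniq D ->
  nodd T G = \sum_(r <- D) (charge T G r %% 4 == 2).
Proof.
move=> onD uD; rewrite /nodd (bigID (fun r => r \in D)) /= [X in _ + X]big1 ?addn0.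
  by rewrite -big_uniq.
move=> r rD; rewrite /charge big1 // => e _; rewrite /charge1.
have iE u : incl (T u) r = false.
  have := onD u; case: (T u) => [a|] //= aD; apply/negP => /eqP E.
  by rewrite -E aD in rD.
by rewrite !iE.
Qed.

(** All edges leaving the class go to the root, so the edges at the class whose weight flips form a
    cut. Their number is even, and the charge moves by a multiple of 4. *)
Lemma charge_shift b W G s (N : finType) (T : V -> option N) r : b \notin W ->
  all (ends_in W b) G -> even_graph G -> valid T G ->
  (forall u, u \notin W -> T u = None) -> (forall u, u \in W -> T u != None) ->
  charge T (shift s G) r = charge T G r %[mod 4].
Proof.
move=> bW eW ev vT off on.
pose t (e : wedge V) := incl (T e.1.1) r || incl (T e.1.2) r.
pose d (e : wedge V) := s e.1.1 (+) s e.1.2.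
have E : charge T (shift s G) r + 4 * \sum_(e <- G) (t e && (e.2 && d e)) =
    charge T G r + 2 * \sum_(e <- G) (t e && d e).
  rewrite /charge big_map !big_distrr -!big_split; apply: eq_bigr => e _ /=.
  rewrite /charge1 /= -/(t e) -/(d e).
  move: (incl _ _ (+) incl _ _) => x.
  by case: (t e); case: (e.2); case: (d e); case: x.
have := even_cut_graph (fun x => incl (T x) r && (s x (+) s b)) ev.
have -> : \sum_(e <- G) ((incl (T e.1.1) r && (s e.1.1 (+) s b)) (+) (incl (T e.1.2) r && (s e.1.2 (+) s b))) =
    \sum_(e <- G) (t e && d e).
  apply: eq_big_seq => e eG; have := allP vT e eG; have /andP[e1 e2] := allP eW e eG.
  have root u : (u \in W) || (u == b) -> T u = None -> u = b.
    by case/orP => [/on|/eqP //]; case: (T u).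
  rewrite /vedge /t /d; move: (root _ e1) (root _ e2).
  case: (T e.1.1) => [a|] h1; case: (T e.1.2) => [c|] h2 /=.
  - by move=> /eqP ->; case: (c == r) => //=; case: (s _); case: (s _); case: (s _).
  - by move=> _; rewrite (h2 erefl); case: (a == r) => //=; rewrite addbF.
  - by move=> _; rewrite (h1 erefl); case: (c == r) => //=; rewrite addbC.
  - by [].
by move: E; move: (\sum_(e <- G) _) (\sum_(e <- G) _) (charge _ _ _) (charge _ _ _); clear; lia.
Qed.

Lemma split_arith (k n n' c c' : nat) : k.*2 + n.*2 + 4 <= c ->
  c + n'.*2 = c' + n.*2 \/ c + n'.*2 = c' + n.*2 + 4 -> k.*2 + n'.*2 < c' + 4.
Proof. by move=> h []; move: h; lia. Qed.

(** * Splitting off a pair of edges at a neighbour of the root *)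

Section Split.
Variables (b v y : V) (W : {set V}) (w2 : bool) (R : seq (wedge V)) (k : nat).
Let G := [:: (b, v, false), (v, y, w2) & R].
Let G' := (b, y, w2) :: R.
Hypotheses (inst : instance b W G) (str : strict k W G) (vW : v \in W).
Hypotheses (tight : k.*2 = cost (single W) G) (even1 : nodd (single W) G = 0).

(* If splitting off (b, v), (v, y) separates y from v, the part of y is the class
   r0 of T2 and is joined to v by a single edge, so the inequality makes it even. *)
Lemma nobridge (N2 : finType) (T2 : V -> option N2) r0 :
  (forall u, (T2 u == None) = (u \notin W :\ v)) -> valid T2 G ->
  (forall P : pred V,
     (forall f, f \in G -> f.1.1 \in W :\ v -> f.1.2 \in W :\ v -> P f.1.1 = P f.1.2) ->
     forall u u', T2 u != None -> T2 u = T2 u' -> P u = P u') ->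
  T2 y = Some r0 ->
  (charge T2 G r0 %% 4 == 2).*2 <
    \sum_(e <- G) (((e.1.1 == v) && (T2 e.1.2 == Some r0)) || ((e.1.2 == v) && (T2 e.1.1 == Some r0))) ->
  forall (N : finType) (T : V -> option N) r r',
  (forall u, u \notin W -> T u = None) -> valid T G' -> (forall u, u \in W -> T u != None) ->
  T v = Some r -> T y = Some r' -> r != r' -> (charge T G' r' %% 4 == 2) = false.
Proof.
move=> off2 vT2 conn T2y gap N T r r' off vT on Tv Ty rr'.
have bW := inst_root inst.
have inWv u : (u \in W :\ v) = (u != v) && (u \in W) by rewrite !inE.
have T2in u : T2 u != None -> (u != v) && (u \in W) by rewrite off2 negbK inWv.
have vb : (b == v) = false by apply: contraNF bW => /eqP ->.
have T2b : T2 b = None by apply/eqP; rewrite off2 inWv (negbTE bW) andbF.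
have T2v : T2 v = None by apply/eqP; rewrite off2 inWv eqxx.
have Tb := off b bW.
have vR f : f \in R -> vedge T f.
  by move=> fR; apply: (allP vT); rewrite inE fR orbT.
have RT f : f \in R -> f.1.1 \in W -> f.1.2 \in W -> T f.1.1 = T f.1.2.
  move=> /vR; rewrite /vedge => + /on h1 /on h2; move: h1 h2.
  by case: (T _) => // a _; case: (T _) => // c _ /eqP ->.
(* By [conn] the class [r0] is connected off [v], and no edge of it leaves a class of [T]. *)
have C_K u : T2 u = Some r0 -> T u = Some r'.
  move=> T2u; apply/eqP; rewrite -[_ == _](conn (fun u => T u == Some r') _ y u) ?Ty //.
  - move=> f; rewrite !inE => /or3P[/eqP ->|/eqP ->|fR]; rewrite ?(negbTE bW) ?eqxx ?andbF //=.
    by move=> /andP[_ h1] /andP[_ h2]; rewrite RT.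
  - by rewrite T2y.
  - by rewrite T2y T2u.
(* As [T] separates [v] from [y], the split edge is the only one between [v] and [r0]; the gap then
   reads 2 times the oddness is less than 1. *)
have notodd : (charge T2 G r0 %% 4 == 2) = false.
  apply/negP => o; move: gap; rewrite o /G !big_cons /= ?vb ?T2b ?T2v ?eqxx /=.
  have -> : (None == Some r0 :> option N2) = false by [].
  rewrite andbF orbF.
  rewrite big1_seq; first by case: (_ == Some r0).
  move=> f /= fR; apply/eqP; rewrite eqb0; apply/negP => h.
  have := vR f fR; rewrite /vedge.
  case/orP: h => /andP[/eqP -> /eqP /C_K ->]; rewrite Tv.
    by apply/negP; rewrite -[r == r']/(r == r').
  by rewrite eq_sym; apply/negP.
(* Otherwise the rest of the class [r'] could be separated from all other vertices of [W], giving a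
   two-class certificate of [G] with the tight cost, against strictness. *)
have K_C u : u \in W -> T u = Some r' -> T2 u = Some r0.
  move=> uW Tu; apply/eqP/contraT => T2u.
  pose T3 u := if u \in W then Some ((T u == Some r') && (T2 u != Some r0)) else None.
  have off3 x : x \notin W -> T3 x = None by rewrite /T3 => /negbTE->.
  have v3 : valid T3 G.
    apply/allP => f; rewrite /vedge /T3 !inE => /or3P[/eqP ->|/eqP ->|fR] /=.
    - by rewrite (negbTE bW).
    - by rewrite vW Tv T2y eqxx andbF; case: (y \in W) => //; rewrite -[Some r == _]/(r == r') (negbTE rr').
    case h1: (_ \in W) => //; case h2: (_ \in W) => //; apply/eqP.
    have TE := RT f fR h1 h2; rewrite TE.
    case: (eqVneq f.1.1 v) => [E|n1].
      by rewrite -TE E Tv -[Some r == _]/(r == r') (negbTE rr').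
    case: (eqVneq f.1.2 v) => [E|n2].
      by rewrite E Tv -[Some r == _]/(r == r') (negbTE rr').
    have vf : vedge T2 f by apply: (allP vT2); rewrite !inE fR !orbT.
    have o1 : T2 f.1.1 != None by rewrite off2 inWv n1 h1.
    have o2 : T2 f.1.2 != None by rewrite off2 inWv n2 h2.
    move: vf o1 o2; rewrite /vedge; case: (T2 f.1.1) => // a; case: (T2 f.1.2) => // c.
    by move=> /eqP ->.
  have rk : 1 < rank W T3.
    rewrite /rank; apply: leq_trans (leq_addl _ _); apply/card_gt1P; exists true, false.
    rewrite !inE; split=> //; apply/existsP; [exists u|exists v].
      by rewrite uW /T3 uW Tu T2u eqxx.
    by rewrite vW /T3 vW Tv -[Some r == _]/(r == r') (negbTE rr').
  have := str (fun=> false) off3 v3 rk; rewrite (full_cost _ bW (inst_ends inst) off3) -?tight.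
    by clear; lia.
  by move=> x xW; rewrite /T3 xW.
have iE u : incl (T u) r' = incl (T2 u) r0.
  case uW: (u \in W); last first.
    rewrite off ?uW //; have -> // : T2 u = None by apply/eqP; rewrite off2 inWv uW andbF.
  case T2u: (T2 u == Some r0); first by rewrite (eqP T2u) (C_K _ (eqP T2u)) /= !eqxx.
  have i2 (M : finType) (o : option M) a : (o == Some a) = false -> incl o a = false by case: o.
  rewrite (i2 _ _ _ T2u); apply: i2; apply/eqP => Tu.
  by rewrite (K_C u uW Tu) eqxx in T2u.
move: notodd; rewrite /G /G' !charge_cons /charge1 /= !iE T2b T2v T2y /= eqxx /=.
by rewrite mul0n !add0n; congr (_ = false); congr (_ %% 4 == 2); congr (_ + _);
  apply: eq_bigr => e _; rewrite /charge1 !iE.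
Qed.

Hypothesis good : (y \in W) || ((y == b) && w2).
Hypothesis nb : forall (N : finType) (T : V -> option N) r r',
  (forall u, u \notin W -> T u = None) -> valid T G' -> (forall u, u \in W -> T u != None) ->
  T v = Some r -> T y = Some r' -> r != r' -> (charge T G' r' %% 4 == 2) = false.

Lemma split_parity : (tweight G').*2 = k.*2 %[mod 4].
Proof.
have -> : tweight G' = tweight G by rewrite !tweight_cons.
have := bound_parity (inst_even inst) (single_valid W G).
by rewrite even1 -tight addn0 => ->.
Qed.

Lemma split_ends : all (ends_in W b) G'.
Proof.
have /and3P[_ /andP[_ h] h2] := inst_ends inst.
by apply/andP; split; last exact: h2; rewrite /ends_in /= eqxx orbT; exact: h.
Qed.

(** [good] keeps the cost at [k.*2]: the new edge either crosses like the old root edge, or is a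
    non-zero root loop of cost 2 replacing two crossing edges. *)
Lemma split_full (N : finType) (T : V -> option N) s :
  (forall u, u \notin W -> T u = None) -> (forall u, u \in W -> T u != None) ->
  cost T (shift s G') = k.*2.
Proof.
move=> off on; rewrite (full_cost s (inst_root inst) split_ends off on) tight.
rewrite !cost_cons addnA; congr (_ + _); rewrite /cost1 /single /=.
rewrite vW (negbTE (inst_root inst)).
case/orP: good => [->|/andP[/eqP-> ->]] //.
by rewrite (negbTE (inst_root inst)).
Qed.

(** A certificate valid before and after loses at most 4, and one that separates [v] from [y] is
    merged, again losing at most 4; strictness covers both if the rank exceeds 1. Otherwise the cost
    is still [k.*2] and at most one class is odd, by [nb] when there are two, so parity leaves
    none. *)
Lemma split_ok : ok k W G'.
Proof.
move=> s N T off vT; have ev := inst_even inst; have bW := inst_root inst.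
have Tb := off b bW.
have evG' : even_graph G' by apply: (even_split (v := v) (w1 := false)).
apply: (ok_parity evG' vT split_parity).
pose a1 := false (+) (s b (+) s v); pose a2 := w2 (+) (s v (+) s y).
have sG : shift s G = [:: (b, v, a1), (v, y, a2) & shift s R] by [].
have sG' : shift s G' = (b, y, a1 (+) a2) :: shift s R.
  rewrite /= emapE; congr (_ :: _); congr (_, _).
  by rewrite /a1 /a2; case: w2; case: (s b); case: (s v); case: (s y).
have evs : even_graph (shift s G) by apply: even_shift.
case vTG : (valid T G).
  have h := @split_valid _ _ T b v y a1 a2 (shift s R).
  rewrite /= -sG -sG' !valid_shift in h; have {}h := h evs vTG vT.
  case: (leqP (rank W T) 1) => rk; last first.
    exact: split_arith (str s off vTG rk) h.
  have [r Tr] := rank_single vW rk.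
  have on u : u \in W -> T u != None by move=> /Tr ->.
  rewrite split_full //.
  have -> : nodd T (shift s G') = (charge T (shift s G') r %% 4 == 2).
    rewrite (@nodd_support _ T _ [:: r]) ?big_seq1 // => u.
    by case uW: (u \in W); [rewrite Tr //= inE | rewrite off ?uW].
  by case: (_ == 2); clear; lia.
have [r [r' [Tv Ty rr']]] : exists r r', [/\ T v = Some r, T y = Some r' & r != r'].
  move: vTG (vT); rewrite !valid_cons => + /andP[_ vR]; rewrite vR /vedge /= Tb andbT /=.
  by case: (T v) => [r|] //; case: (T y) => [r'|] // /negbT rr'; exists r, r'.
have vT' : valid T ((b, y, a1 (+) a2) :: shift s R) by rewrite -sG' valid_shift.
have [vm cm nm] := split_backward_merge (w1 := a1) (w2 := a2) Tb Tv Ty rr' vT'.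
rewrite -sG -sG' in vm cm nm; rewrite -!/(shift s _) in nm cm *.
have offm u : u \notin W -> merge r r' T u = None.
  by move=> uW; apply/eqP; rewrite merge_None off.
have vm' : valid (merge r r' T) G by rewrite -(valid_shift _ s).
case: (leqP (rank W (merge r r' T)) 1) => rk; last first.
  have := str s offm vm' rk; rewrite cm; move: nm.
  move: (nodd _ _) (nodd _ _) (cost _ _) => n n' c; clear; lia.
have [r1 Tr1] := rank_single vW rk.
have on u : u \in W -> T u != None.
  by move=> /Tr1 E; rewrite -(merge_None r r') E.
have Tr u : u \in W -> T u = Some r \/ T u = Some r'.
  have r1E : r1 = r.
    by have := Tr1 v vW; rewrite /merge Tv; case: ifP => _ [].
  move=> /Tr1; rewrite r1E /merge; case: ifP => [/eqP ->|_ ->]; auto.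
rewrite split_full //.
rewrite (@nodd_support _ T _ [:: r; r']); last 2 first.
- move=> u; case uW: (u \in W); last by rewrite off ?uW.
  by have [->|->] := Tr u uW; rewrite /= !inE eqxx ?orbT.
- by rewrite /= inE rr'.
rewrite big_cons big_seq1 (charge_shift s r' bW split_ends evG' vT off on).
rewrite (nb off vT on Tv Ty rr') addn0.
by case: (_ == 2); clear; lia.
Qed.

(** A closed off-root set of odd weight would give, together with the rest of [W], a certificate of
    cost [k.*2] with an odd class, against [split_ok]. *)
Lemma split_instance : instance b W G'.
Proof.
have bW := inst_root inst.
have evG' : even_graph G' by apply: (even_split (v := v) (w1 := false)); apply: (inst_even inst).
split=> //; first exact: split_ends.
move=> K bK cK; apply/negP => oK.
pose T u := if u \in W then Some (u \in K) else None.
have off u : u \notin W -> T u = None by rewrite /T => /negbTE->.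
have on u : u \in W -> T u != None by rewrite /T => ->.
have vT : valid T G'.
  apply/allP => e /(allP cK) /= /eqP E; rewrite /vedge /T E.
  by case: (e.1.1 \in W); case: (e.1.2 \in W).
have := split_ok (fun=> false) off vT; rewrite split_full // shift0.
suff : 0 < nodd T G' by clear; lia.
rewrite /nodd (bigD1 true) //=.
have -> : charge T G' true = (\sum_(e <- G') (e.1.1 \in K) && e.2).*2.
  rewrite -mul2n big_distrr /=; apply: eq_big_seq => e eG.
  have /andP[e1 e2] := allP split_ends e eG; have /eqP E := allP cK e eG.
  have iE u : (u \in W) || (u == b) -> incl (T u) true = (u \in K).
    case/orP => [uW|/eqP ->]; first by rewrite /T uW /=; case: (u \in K).
    by rewrite off // (negbTE bK).
  rewrite /charge1 !iE // E addbb orbb addn0 mul2n.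
  by case: (_ \in K); case: (e.2).
by move: oK; move: (\sum_(e <- G') _) (\sum_(i | _) _); clear; lia.
Qed.

End Split.

Lemma eqv_smaller W G H : eqv G H -> smaller W G -> smaller W H.
Proof.
move=> GH IH b' W' G' k' i o; have := eqv_sum (F := fun=> 1) (fun=> erefl) GH.
by rewrite !sum1_size => <-; apply: IH.
Qed.

Lemma split_flood b v y W w2 R k :
  let G := [:: (b, v, false), (v, y, w2) & R] in
  instance b W G -> strict k W G -> v \in W ->
  k.*2 = cost (single W) G -> nodd (single W) G = 0 ->
  (y \in W) || ((y == b) && w2) ->
  (forall (N : finType) (T : V -> option N) r r',
    (forall u, u \notin W -> T u = None) -> valid T ((b, y, w2) :: R) ->
    (forall u, u \in W -> T u != None) ->
    T v = Some r -> T y = Some r' -> r != r' ->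
    (charge T ((b, y, w2) :: R) r' %% 4 == 2) = false) ->
  smaller W G -> flood b W G k.
Proof.
move=> G inst str vW tight even1 good nb IH.
have okG' := split_ok inst str vW tight even1 good nb.
have instG' := split_instance inst str vW tight even1 good nb.
apply: flood_red (IH _ _ _ _ instG' okG' _); last by rewrite ltn_add2l.
exact: (@red_split _ (fun x => x \in W) b v y false w2 R vW).
Qed.

Lemma eqv_strict k W G H : eqv G H -> strict k W G -> strict k W H.
Proof.
move=> GH h s N T off vT; rewrite -(eqv_cost T (eqv_map id s GH)) -(eqv_nodd T (eqv_map id s GH)).
by apply: h => //; rewrite (eqv_valid _ GH).
Qed.

Lemma strict_shift k W s G : strict k W G -> strict k W (shift s G).
Proof.
move=> h t N T off vT; rewrite shift_add; apply: h => //.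
by move: vT; rewrite valid_shift.
Qed.

Lemma eqv_flood b W G H k : eqv G H -> flood b W H k -> flood b W G k.
Proof. by move=> GH; apply: flood_red; apply: eqv_red. Qed.

Lemma exists_lt_sum (I : finType) (f g : I -> nat) :
  \sum_i f i < \sum_i g i -> exists i, f i < g i.
Proof.
move=> h; case: (boolP [exists i, f i < g i]) => [/existsP //|].
rewrite negb_exists => /forallP no; exfalso; move: h; rewrite ltnNge => /negP; apply.
by apply: leq_sum => i _; rewrite leqNgt.
Qed.

(** To find a partner for the root edge, move [v] into X and take the components of [W :\ v] as
    classes. Strictness there shows that some component has more edges to [v] than twice its
    oddness, the gap that [nobridge] asks for. *)
Lemma even_flood1 b v W R k :
  let G := (b, v, false) :: R in
  instance b W G -> strict k W G -> v \in W ->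
  k.*2 = cost (single W) G -> nodd (single W) G = 0 -> smaller W G -> flood b W G k.
Proof.
move=> G inst str vW tight even1 IH; have bW := inst_root inst.
have vb : (b == v) = false by apply: contraNF bW => /eqP ->.
have pick e y w2 : e \in R -> e = (v, y, w2) \/ e = (y, v, w2) ->
    exists R', eqv G [:: (b, v, false), (v, y, w2) & R'].
  move=> eR eE; exists (rem e R); exists [:: (b, v, false), e & rem e R].
    by rewrite perm_cons perm_to_rem.
  rewrite /reoriented /= /rev_rel eqxx /=; apply/andP; split; last exact: reoriented_refl.
  by case: eE => ->; rewrite eqxx ?orbT.
have main y w2 R' : eqv G [:: (b, v, false), (v, y, w2) & R'] ->
    (y \in W) || ((y == b) && w2) ->
    (forall (N : finType) (T : V -> option N) r r',
    (forall u, u \notin W -> T u = None) -> valid T ((b, y, w2) :: R') ->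
    (forall u, u \in W -> T u != None) ->
    T v = Some r -> T y = Some r' -> r != r' ->
    (charge T ((b, y, w2) :: R') r' %% 4 == 2) = false) -> flood b W G k.
  move=> E good nb; apply: (eqv_flood E); apply: split_flood => //.
  - exact: eqv_instance inst.
  - exact: eqv_strict str.
  - by rewrite -(eqv_cost _ E).
  - by rewrite -(eqv_nodd _ E).
  - exact: eqv_smaller IH.
(* A loop at [v] or a non-zero edge to the root is a partner at once, since [y] is then [v] itself
   or lies in X and no two classes get separated. Without such edges the cost estimate below
   holds. *)
pose bad (e : wedge V) := (e.1 == (v, v)) || (((e.1 == (b, v)) || (e.1 == (v, b))) && e.2).
case: (boolP (has bad R)) => [/hasP[[[x z] w] eR]|/hasPn nobad].
  rewrite /bad => /orP[/eqP[xv zv]|/andP[h wT]].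
    have [R' E] : exists R', eqv G [:: (b, v, false), (v, v, w) & R'].
      by apply: (pick _ v w eR); left; rewrite xv zv.
    by apply: (main _ _ _ E) => [|N T r r' _ _ _ -> [->]]; rewrite ?vW ?eqxx.
  have [R' E] : exists R', eqv G [:: (b, v, false), (v, b, true) & R'].
    apply: pick eR _; move: h wT => /= h ->.
    by case/orP: h => /eqP[-> ->]; auto.
  apply: (main _ _ _ E) => [|N T r r' off _ _ _]; first by rewrite eqxx orbT.
  by rewrite off.
pose adjW x z := [&& x \in W :\ v, z \in W :\ v &
  has (fun f : wedge V => (f.1 == (x, z)) || (f.1 == (z, x))) G].
have sym : connect_sym adjW.
  apply: sym_connect_sym => x z; rewrite /adjW andbCA; do 2!congr (_ && _).
  by apply: eq_has => f; rewrite orbC.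
pose T2 u := if u \in W :\ v then Some (fingraph.root adjW u) else None.
have off2 u : (T2 u == None) = (u \notin W :\ v) by rewrite /T2; case: (u \in W :\ v).
have edge_adj f : f \in G -> f.1.1 \in W :\ v -> f.1.2 \in W :\ v -> adjW f.1.1 f.1.2.
  move=> fG h1 h2; rewrite /adjW h1 h2; apply/hasP; exists f => //.
  by case: (f.1) => p q; rewrite eqxx.
have vT2 : valid T2 G.
  apply/allP => f fG; rewrite /vedge /T2.
  case h1: (f.1.1 \in W :\ v) => //; case h2: (f.1.2 \in W :\ v) => //.
  by rewrite (root_connect sym); apply/connect1/edge_adj.
have conn (P : pred V) :
    (forall f, f \in G -> f.1.1 \in W :\ v -> f.1.2 \in W :\ v -> P f.1.1 = P f.1.2) ->
    forall u u', T2 u != None -> T2 u = T2 u' -> P u = P u'.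
  move=> Pc u u' un; have u'n : T2 u' != None -> true by [].
  have cl : closed adjW P.
    move=> x z /and3P[xW zW /hasP[f fG /orP[]/eqP fE]]; rewrite !unfold_in.
      by have := Pc f fG; rewrite fE; apply.
    by apply: esym; have := Pc f fG; rewrite fE; apply.
  move: un; rewrite /T2; case: ifP => // uW _; case: ifP => // u'W [] /eqP.
  by rewrite (root_connect sym) => /(closed_connect cl); rewrite !unfold_in.
have off2' u : u \notin W -> T2 u = None.
  by move=> uW; apply/eqP; rewrite off2 !inE (negbTE uW) andbF.
have rk : 1 < rank W T2.
  rewrite /rank; apply: leq_trans (leq_addr _ _).
  suff : 0 < #|[set u in W | T2 u == None]| by clear; lia.
  by apply/card_gt0P; exists v; rewrite !inE vW off2 !inE eqxx.
have := str (fun=> false) _ T2 off2' vT2 rk; rewrite shift0 => str2.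
pose joins r (e : wedge V) := ((e.1.1 == v) && (T2 e.1.2 == Some r)) || ((e.1.2 == v) && (T2 e.1.1 == Some r)).
(* Moving [v] into X makes only its edges to other vertices of [W] dearer, by 1 each; its root edges
   are zero and become free. *)
have costle : cost T2 G <= cost (single W) G + \sum_r \sum_(e <- G) joins r e.
  rewrite exchange_big -big_split /= /cost big_seq [leqRHS]big_seq.
  apply: leq_sum => e eG.
  have nb : ~~ bad e.
    move: eG; rewrite inE => /orP[/eqP ->|/nobad //].
    by rewrite /bad andbF orbF; apply/eqP => -[bv]; rewrite bv eqxx in vb.
  have jr r u : T2 u = Some r -> (e.1 = (v, u) \/ e.1 = (u, v)) -> 0 < \sum_r joins r e.
    move=> T2u eE; rewrite (bigD1 r) //= /joins.
    by case: eE => -> /=; rewrite T2u !eqxx ?orbT.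
  have /andP[e1 e2] := allP (inst_ends inst) e eG.
  have T2b : T2 b = None by apply: off2'.
  have T2v : T2 v = None by apply/eqP; rewrite off2 !inE eqxx.
  have T2S u : u != v -> u \in W -> exists r, T2 u = Some r.
    by move=> uv uW; exists (fingraph.root adjW u); rewrite /T2 !inE uv uW.
  have sb : single W b = None by rewrite /single (negbTE bW).
  have sS u : u \in W -> single W u = Some tt by rewrite /single => ->.
  have nvv : e.1 <> (v, v) by move=> E; move: nb; rewrite /bad E eqxx.
  have nbv : e.1 = (b, v) \/ e.1 = (v, b) -> e.2 = false.
    by move=> E; apply: contraNF nb; rewrite /bad; case: E => ->; rewrite eqxx ?orbT => ->; rewrite orbT.
  move: nvv nbv jr e1 e2; rewrite /cost1; case: e {eG nb} => [[x z] w] /= nvv nbv jr xE zE.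
  case: (eqVneq x v) => [xv|xv].
    rewrite xv in nvv nbv jr *; rewrite T2v sS //.
    case/orP: zE => [zW|/eqP zb]; last by rewrite zb T2b nbv // zb; auto.
    have zv : z != v by apply/eqP => zv; apply: nvv; rewrite zv.
    have [r Tz] := T2S z zv zW; rewrite Tz; apply: leq_trans (leq_addl _ _).
    by apply: jr _ _ Tz _; auto.
  case/orP: xE => [xW|/eqP xb].
    have [r Tx] := T2S x xv xW; rewrite Tx (sS x) //.
    case: (eqVneq z v) => [zv|zv].
      rewrite zv in jr *; rewrite T2v; apply: leq_trans (leq_addl _ _).
      by apply: jr _ _ Tx _; auto.
    case/orP: zE => [zW|/eqP zb]; last by rewrite zb T2b sb leq_addr.
    by have [r' Tz] := T2S z zv zW; rewrite Tz.
  rewrite xb T2b sb; case: (eqVneq z v) => [zv|zv].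
    by rewrite zv T2v nbv // xb zv; auto.
  case/orP: zE => [zW|/eqP zb]; last by rewrite zb T2b sb leq_addr.
  by have [r' Tz] := T2S z zv zW; rewrite Tz sS // leq_addr.
have [r0 gap] : exists r0, (charge T2 G r0 %% 4 == 2).*2 < \sum_(e <- G) joins r0 e.
  apply: exists_lt_sum; rewrite -(eq_bigr _ (fun r _ => mul2n _)) -big_distrr /= -/(nodd T2 G).
  by move: str2 costle; rewrite -tight mul2n; clear; lia.
have [e eG je] := sum_pos_has (leq_ltn_trans (leq0n _) gap).
have T2b : T2 b = None by apply: off2'.
have eR : e \in R.
  move: eG je; rewrite inE => /orP[/eqP ->|//].
  by rewrite /joins /= vb /= T2b andbF.
have [y [w2 [T2y eE]]] : exists y w2, T2 y = Some r0 /\ (e = (v, y, w2) \/ e = (y, v, w2)).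
  move: je; rewrite lt0b /joins; case: e {eG eR} => [[x z] w] /=.
  by case/orP => /andP[/eqP -> /eqP Tx]; [exists z, w | exists x, w]; auto.
have [R' E] := pick e y w2 eR eE.
have yWv : y \in W :\ v by rewrite -[_ \in _]negbK -off2 T2y.
have yW : y \in W by move: yWv; rewrite inE => /andP[].
apply: (main y w2 R' E); first by rewrite yW.
have tight' : k.*2 = cost (single W) [:: (b, v, false), (v, y, w2) & R'].
  by rewrite -(eqv_cost _ E).
have vT2' : valid T2 [:: (b, v, false), (v, y, w2) & R'] by rewrite -(eqv_valid _ E).
have conn' (P : pred V) :
    (forall f, f \in [:: (b, v, false), (v, y, w2) & R'] ->
      f.1.1 \in W :\ v -> f.1.2 \in W :\ v -> P f.1.1 = P f.1.2) ->
    forall u u', T2 u != None -> T2 u = T2 u' -> P u = P u'.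
  move=> Pc; apply: conn => f fG h1 h2.
  pose Q (f : wedge V) := ((f.1.1 \in W :\ v) && (f.1.2 \in W :\ v)) ==> (P f.1.1 == P f.1.2).
  have : all Q G.
    rewrite (eqv_all (P := Q) _ E) => [|g]; last by rewrite /Q /= andbC eq_sym.
    by apply/allP => g gG; apply/implyP => /andP[g1 g2]; rewrite Pc.
  by move/allP/(_ f fG); rewrite /Q h1 h2 => /eqP.
rewrite (eqv_charge _ _ E) (eqv_sum (F := fun e => nat_of_bool (joins r0 e)) _ E) in gap; last first.
  by move=> f; rewrite /joins /= orbC.
exact: (nobridge (eqv_instance E inst) (eqv_strict E str) vW tight' off2 vT2' conn' T2y gap).
Qed.

Lemma single_cost_shift b W G s : instance b W G ->
  cost (single W) (shift s G) = cost (single W) G.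
Proof.
move=> inst; apply: (full_cost s (inst_root inst) (inst_ends inst)); first exact: single_off.
by move=> u uW; rewrite /single uW.
Qed.

Lemma nodd_single W G : nodd (single W) G = 0 \/ nodd (single W) G = 1.
Proof. by have := nodd_single_le1 G (single W); case: (nodd _ _) => [|[|]] //; auto. Qed.

(** A shift at [v] makes the chosen root edge zero. *)
Lemma even_flood b v w W R k :
  let G := (b, v, w) :: R in
  instance b W G -> strict k W G -> v \in W ->
  k.*2 = cost (single W) G -> nodd (single W) G = 0 -> smaller W G -> flood b W G k.
Proof.
move=> G inst str vW tight even1 IH; have bW := inst_root inst.
pose s x := (x == v) && w.
have sE : shift s G = (b, v, false) :: shift s R.
  rewrite /= emapE /s eqxx (_ : (b == v) = false) ?addbb //.
  by apply: contraNF bW => /eqP ->.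
apply: (flood_shift (s := s)); rewrite sE.
have cE := single_cost_shift s inst.
have ev := inst_even inst.
apply: even_flood1 => //; rewrite -?sE.
- exact: instance_shift.
- exact: strict_shift.
- by rewrite cE.
- have p1 := bound_parity (even_shift s ev) (single_valid W (shift s G)).
  have p2 := bound_parity ev (single_valid W G).
  move: p1 p2; rewrite cE even1 tweight_shift //.
  have := nodd_single_le1 (shift s G) (single W).
  by move: (nodd _ _) (cost _ _) (tweight _) => n c t; case: n => [|[|]] //; clear; lia.
- by move=> b' W' G0 k' i o; rewrite size_map; apply: IH.
Qed.

(** After the flip the one-class certificate is even with bound [k.+1], while those of rank above 1
    had slack 4 and lose at most 2. So the flipped graph floods with [k.+1], and undoing the flip
    costs one loop. *)
Lemma odd_class_flood b v w W R k :
  let G := (b, v, w) :: R in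
  instance b W G -> ok k W G -> strict k W G -> v \in W ->
  k.*2 + 2 = cost (single W) G -> nodd (single W) G = 1 -> smaller W G -> flood b W G k.
Proof.
move=> G inst okG str vW tight odd1 IH; have bW := inst_root inst.
pose H := (b, v, ~~ w) :: R.
have instH : instance b W H by apply: flip_instance inst.
have tH : tweight H = ~~ tweight G by rewrite !tweight_cons /= addNb.
have smH : smaller W H by [].
have full (N : finType) (T : V -> option N) s : (forall u, u \notin W -> T u = None) ->
    (forall u, u \in W -> T u != None) -> cost T (shift s H) = k.*2 + 2.
  move=> off on; rewrite (full_cost s bW (inst_ends instH) off on) tight.
  by rewrite !cost_cons /cost1 /single /= (negbTE bW) vW.
have pH : (tweight H).*2 = k.+1.*2 %[mod 4].
  have := bound_parity (inst_even inst) (single_valid W G); rewrite odd1 -tight tH.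
  by case: (tweight G) => /=; clear; lia.
have okH : ok k.+1 W H.
  move=> s N T off vT; case: (leqP (rank W T) 1) => rk.
    have [r Tr] := rank_single vW rk.
    have on u : u \in W -> T u != None by move=> /Tr ->.
    apply: (ok_parity (inst_even instH) vT pH).
    rewrite full // (@nodd_support _ T _ [:: r]) ?big_seq1 // => [|u].
      by case: (_ == 2); clear; lia.
    by case uW: (u \in W); [rewrite Tr //= inE | rewrite off ?uW].
  have := str s N T off vT rk.
  have := flip_bound v (w (+) (s b (+) s v)) (shift s R) (off b bW).
  have -> : (b, v, w (+) (s b (+) s v)) :: shift s R = shift s G by [].
  have -> : (b, v, ~~ (w (+) (s b (+) s v))) :: shift s R = shift s H.
    by rewrite /shift /= emapE addNb.
  move: (nodd _ (shift s G)) (cost _ (shift s G)) => n c.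
  move: (nodd _ _) (cost _ _) => n' c'; clear; lia.
apply: (unflip_flood bW).
have [[s [N [T [off vT tightT rk]]]]|no] :=
  EM (exists s (N : finType) (T : V -> option N),
    [/\ forall u, u \notin W -> T u = None, valid T H,
        k.+1.*2 + (nodd T (shift s H)).*2 = cost T (shift s H) & 1 < rank W T]).
  exact: (tight_flood instH okH smH off vT tightT rk).
apply: (even_flood instH _ vW _ _ smH).
- move=> s N T off vT rk; have ok1 := okH s N T off vT.
  have ne : k.+1.*2 + (nodd T (shift s H)).*2 != cost T (shift s H).
    by apply/eqP => E; apply: no; exists s, N, T.
  have vt' : valid T (shift s H) by rewrite valid_shift.
  have := bound_parity (even_shift s (inst_even instH)) vt'.
  rewrite tweight_shift ?pH; last exact: inst_even instH.
  by move: ok1 ne; move: (nodd _ _) (cost _ _) => n c; clear; lia.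
- have := full _ (single W) (fun=> false) (@single_off _ W); rewrite shift0 => -> //.
    by clear; lia.
  by move=> u uW; rewrite /single uW.
- have := bound_parity (inst_even instH) (single_valid W H); rewrite pH.
  have := full _ (single W) (fun=> false) (@single_off _ W); rewrite shift0 => -> //.
    have := nodd_single_le1 H (single W).
    by case: (nodd _ _) => [|[|]] //; clear; lia.
  by move=> u uW; rewrite /single uW.
Qed.

Theorem flood_exists b W G k : instance b W G -> ok k W G -> flood b W G k.
Proof.
have [n] := ubnP (#|W| + size G); elim: n b W G k => // n IHn b W G k sz inst okG.
have IH : smaller W G.
  move=> b' W' G' k' i o lt; apply: IHn i o.
  by move: sz lt; clear; lia.
have bW := inst_root inst; have ev := inst_even inst.
case: (set_0Vmem W) => [W0|[u0 u0W]].
  have lG : all (fun e => e.1 == (b, b)) G.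
    apply/allP => e /(allP (inst_ends inst)); rewrite /ends_in W0 !inE /=.
    by case: (e) => [[x y] w] /= /andP[/eqP -> /eqP ->].
  exists G; split=> //; first exact: red_refl.
  have := okG (fun=> false) _ (fun=> None : option unit) (fun=> fun=> erefl).
  have vN : valid (fun=> None : option unit) G by apply/allP.
  move=> /(_ vN); rewrite shift0 => h.
  have cE : cost (fun=> None : option unit) G = (count (fun e => e.2) G).*2.
    by rewrite count_sum -mul2n big_distrr /=; apply: eq_bigr => e _; rewrite mul2n.
  by rewrite -leq_double -cE; apply: leq_trans h; apply: leq_addr.
(* [k] may be raised until the bound is attained; it is capped by the one-class certificate. *)
have [d] := ubnP (cost (single W) G - k); elim: d k okG => // d IHd k okG dk.
have kle : k.*2 + (nodd (single W) G).*2 <= cost (single W) G.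
  have := okG (fun=> false) _ (single W) (@single_off _ W) (single_valid W G).
  by rewrite shift0.
have [ok1|nok1] := EM (ok k.+1 W G).
  apply: (flood_leq (leqnSn k)); apply: IHd => //.
  have := ok1 (fun=> false) _ (single W) (@single_off _ W) (single_valid W G).
  by rewrite shift0; move: dk; move: (cost _ _) (nodd _ _); clear; lia.
have [s [N [T [off vT tight]]]] : exists s (N : finType) (T : V -> option N),
    [/\ forall u, u \notin W -> T u = None, valid T G &
        k.*2 + (nodd T (shift s G)).*2 = cost T (shift s G)].
  apply: contrapT => no; apply: nok1 => s N T off vT.
  have ok2 := okG s N T off vT.
  have ne : k.*2 + (nodd T (shift s G)).*2 != cost T (shift s G).
    by apply/eqP => E; apply: no; exists s, N, T.
  have vt' : valid T (shift s G) by rewrite valid_shift.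
  have := cost_even (even_shift s ev) vt'.
  by move: ok2 ne; move: (nodd _ _) (cost _ _) => m c; clear; lia.
have pG := tight_parity ev vT tight.
have [[s' [N' [T' [off' vT' tight' rk']]]]|no] :=
  EM (exists s (N : finType) (T : V -> option N),
    [/\ forall u, u \notin W -> T u = None, valid T G,
        k.*2 + (nodd T (shift s G)).*2 = cost T (shift s G) & 1 < rank W T]).
  exact: (tight_flood inst okG IH off' vT' tight' rk').
have str : strict k W G.
  move=> s1 N1 T1 off1 vT1 rk1; have ok2 := okG s1 N1 T1 off1 vT1.
  have ne : k.*2 + (nodd T1 (shift s1 G)).*2 != cost T1 (shift s1 G).
    by apply/eqP => E; apply: no; exists s1, N1, T1.
  have vt' : valid T1 (shift s1 G) by rewrite valid_shift.
  have := bound_parity (even_shift s1 ev) vt'.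
  rewrite tweight_shift ?pG //.
  by move: ok2 ne; move: (nodd _ _) (cost _ _) => m c; clear; lia.
have rkT : rank W T <= 1 by rewrite leqNgt; apply/negP => rk; apply: no; exists s, N, T.
have [r Tr] := rank_single u0W rkT.
have on u : u \in W -> T u != None by move=> /Tr ->.
have cT := full_cost s bW (inst_ends inst) off on.
(* The tight certificate has one class on all of [W]; its cost is that of [single W], and parity
   fixes the oddness. *)
have tight1 : k.*2 + (nodd (single W) G).*2 = cost (single W) G.
  have nT : nodd T (shift s G) <= 1.
    rewrite (@nodd_support _ T _ [:: r]) ?big_seq1 // => [|u]; first by case: (_ == 2).
    by case uW: (u \in W); [rewrite Tr //= inE | rewrite off ?uW].
  have := bound_parity ev (single_valid W G); rewrite pG.
  move: tight kle; rewrite cT; have := nodd_single_le1 G (single W).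
  by move: nT; move: (nodd _ _) (nodd _ _) (cost _ _); clear; lia.
case: (boolP (closed_in G W)) => [clW|]; first exact: (reroot_flood inst okG IH u0W clW tight1).
rewrite -has_predC => /hasP[e eG /= ecross].
have [v [w [R [vW E]]]] : exists v w R, v \in W /\ eqv G ((b, v, w) :: R).
  have := allP (inst_ends inst) e eG; move: ecross; case: e eG => [[x y] w] eG /=.
  rewrite /ends_in /=; case xW: (x \in W); case yW: (y \in W) => //= _.
    move=> /eqP yb; exists x, w, (rem (x, y, w) G); split=> //.
    exists ((x, y, w) :: rem (x, y, w) G); first exact: perm_to_rem.
    by rewrite /reoriented /= /rev_rel yb eqxx orbT; apply: reoriented_refl.
  rewrite andbT => /eqP xb; exists y, w, (rem (x, y, w) G); split=> //.
  by apply: eqv_perm; rewrite -{1}xb; apply: perm_to_rem.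
apply: (eqv_flood E); have inst' := eqv_instance E inst; have str' := eqv_strict E str.
have IH' := eqv_smaller E IH; have ok' := eqv_ok E okG.
move: tight1; rewrite (eqv_cost _ E) (eqv_nodd _ E) => tight1.
have [n0|n1] := nodd_single W ((b, v, w) :: R).
  by apply: even_flood => //; rewrite -tight1 n0 addn0.
by apply: odd_class_flood => //; rewrite -tight1 n1.
Qed.

End Induction.

(** * Trails and circuit decompositions *)

Section Trails.
Variables (V E : finType) (ends : E -> V * V) (gamma : E -> bool).
Notation arc := (Defs.arc E).
Notation atail := (Defs.atail ends).
Notation ahead := (Defs.ahead ends).
Implicit Types (a : arc) (t : seq arc) (u v x : V).

Fixpoint walk u t v : bool :=
  if t is a :: t' then (atail a == u) && walk (ahead a) t' v else u == v.

Lemma walk_cat u s t v w : walk u s v -> walk v t w -> walk u (s ++ t) w.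
Proof.
elim: s u => [|a s IH] u /=; first by move=> /eqP ->.
by move=> /andP[-> /IH h] /h.
Qed.

Lemma walk_catP u s t w : walk u (s ++ t) w -> exists2 v, walk u s v & walk v t w.
Proof.
elim: s u => [|a s IH] u /=; first by exists u.
by move=> /andP[-> /IH[v h1 h2]]; exists v.
Qed.

Definition reverse t : seq arc := rev (map (fun a => (a.1, ~~ a.2)) t).

Lemma atail_flip a : atail (a.1, ~~ a.2) = ahead a.
Proof. by rewrite /Defs.atail /Defs.ahead /=; case: (a.2). Qed.

Lemma ahead_flip a : ahead (a.1, ~~ a.2) = atail a.
Proof. by rewrite /Defs.atail /Defs.ahead /=; case: (a.2). Qed.

Lemma walk_reverse u t v : walk u t v -> walk v (reverse t) u.
Proof.
rewrite /reverse; elim: t u => [|a t IH] u /=; first by rewrite eq_sym.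
move=> /andP[/eqP au /IH h]; rewrite rev_cons -cats1; apply: walk_cat h _.
by rewrite /= atail_flip ahead_flip eqxx au eqxx.
Qed.

Lemma weight_cat s t : weight gamma (s ++ t) = weight gamma s (+) weight gamma t.
Proof. by rewrite /weight; elim: s => //= a s ->; rewrite addbA. Qed.

Lemma weight_perm s t : perm_eq s t -> weight gamma s = weight gamma t.
Proof.
have wE r : weight gamma r = odd (\sum_(a <- r) gamma a.1).
  by elim: r => [|a r IH]; rewrite ?big_nil // big_cons oddD oddb /= -IH.
by move=> st; rewrite !wE (perm_big _ st).
Qed.

Lemma weight_reverse t : weight gamma (reverse t) = weight gamma t.
Proof.
rewrite /reverse (weight_perm (s := rev _) (t := map (fun a => (a.1, ~~ a.2)) t)).
  by rewrite /weight -map_comp.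
by rewrite perm_rev.
Qed.

Lemma circuit_walk t v : t != [::] -> uniq (map fst t) -> walk v t v -> circuit ends t.
Proof.
case: t => // a t _ /= u1 /andP[/eqP av w]; rewrite /circuit /trail /= u1 /=.
have : path (fun c d : arc => ahead c == atail d) a t && (ahead (last a t) == v).
  elim: t a w {u1 av} => [|c t IH] a //=.
  by move=> /andP[/eqP cv /IH h]; rewrite -andbA h cv eqxx.
by rewrite av.
Qed.

Lemma walk_circuit t : circuit ends t ->
  [/\ t != [::], uniq (map fst t) & exists v, walk v t v].
Proof.
case: t => // a t; rewrite /circuit /trail => /andP[/andP[u1 p] /eqP l]; split=> //.
exists (atail a); rewrite /= eqxx /=; rewrite -{}l.
elim: t a p {u1} => [|c t IH] a /=; first by rewrite eqxx.
by move=> /andP[/eqP ac /IH ->]; rewrite ac eqxx.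
Qed.

Lemma rotate_walk t v x : walk v t v -> hits ends t x ->
  exists2 t', perm_eq t t' & walk x t' x.
Proof.
move=> w /hasP[a at_ hx]; case/splitPr: at_ w => s t1.
case: (eqVneq (atail a) x) => [ax|ax].
  move=> /walk_catP[m w1 w2]; exists ((a :: t1) ++ s); first by rewrite perm_catC.
  have mx : m = x by move: w2 => /= /andP[/eqP am _]; rewrite -ax am.
  by rewrite -mx; apply: walk_cat w2 w1.
rewrite -cat_rcons => /walk_catP[m w1 w2]; exists (t1 ++ rcons s a).
  by rewrite perm_catC.
have mx : m = x.
  move: w1 hx; rewrite (negbTE ax) /= -cats1 => /walk_catP[p _] /= /andP[_ /eqP <-].
  by move/eqP.
by rewrite -mx; apply: walk_cat w2 w1.
Qed.

Definition realize (e : wedge V) t :=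
  [&& t != [::], walk e.1.1 t e.1.2 & weight gamma t == e.2].

(* [Cs] collects the loops deleted by the reduction. *)
Lemma red_realize (A : pred V) G H : red A G H ->
  forall Z : seq (wedge V * seq arc), map fst Z = G -> all (fun z => realize z.1 z.2) Z ->
  exists Z' Cs, [/\ map fst Z' = H, all (fun z => realize z.1 z.2) Z',
    forall c, c \in Cs -> exists v, realize (v, v, false) c &
    perm_eq (map fst (flatten (map snd Z))) (map fst (flatten (map snd Z' ++ Cs)))].
Proof.
elim=> {G H}.
- move=> G H GH Z ZG rZ; move: GH; rewrite -ZG => /perm_map_lift[Z' pZ ->].
  exists Z', [::]; split=> //; first by rewrite -(perm_all _ pZ).
  by rewrite cats0; apply/perm_map/perm_flatten/perm_map.
- move=> u v w G [|[e t] Z] //= [eE ZG] /andP[/and3P[t0 wt gt] rZ].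
  exists (((v, u, w), reverse t) :: Z), [::]; split=> //=; first by rewrite ZG.
  + rewrite rZ andbT /realize /= weight_reverse; move: t0 wt gt; rewrite eE /= => t0 /walk_reverse -> ->.
    rewrite !andbT; apply: contra t0 => /eqP h; rewrite -size_eq0.
    by rewrite -(size_map (fun a : arc => (a.1, ~~ a.2))) -size_rev -/(reverse t) h.
  + rewrite cats0 !map_cat perm_cat2r /reverse map_rev -map_comp perm_sym perm_rev.
    by rewrite (eq_map (g := fst)) // => a.
- move=> u v y w1 w2 G Av [|[e1 t1] [|[e2 t2] Z]] //= [E1 E2 ZG].
  move=> /and3P[/and3P[n1 k1 g1] /and3P[n2 k2 g2] rZ].
  exists (((u, y, w1 (+) w2), t1 ++ t2) :: Z), [::]; split=> //=; first by rewrite ZG.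
  + rewrite rZ andbT /realize /= weight_cat (eqP g1) (eqP g2) E1 E2 /= eqxx andbT.
    move: k1 k2; rewrite E1 E2 /= => k1 k2; rewrite (walk_cat k1 k2) andbT.
    by move: n1; case: (t1).
  + by rewrite cats0 catA.
- move=> v G Av [|[e t] Z] //= [eE ZG] /andP[rt rZ].
  exists Z, [:: t]; split=> //.
  + by move=> c; rewrite inE => /eqP ->; exists v; rewrite -eE.
  + by rewrite flatten_cat /= cats0 map_cat perm_sym map_cat perm_catC.
- move=> G H K _ IH1 _ IH2 Z ZG rZ.
  have [Z1 [C1 [E1 r1 c1 p1]]] := IH1 Z ZG rZ.
  have [Z2 [C2 [E2 r2 c2 p2]]] := IH2 Z1 E1 r1.
  exists Z2, (C2 ++ C1); split=> //.
  + by move=> c; rewrite mem_cat => /orP[/c2|/c1].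
  + apply: (perm_trans p1); rewrite flatten_cat map_cat catA flatten_cat map_cat perm_cat2r.
    exact: p2.
Qed.

Definition arc_edge a : wedge V := (atail a, ahead a, gamma a.1).

Lemma walk_red u t v : t != [::] -> walk u t v ->
  red predT (map arc_edge t) [:: (u, v, weight gamma t)].
Proof.
elim: t u => // a [|c t] IH u _ /= /andP[/eqP au w].
  by rewrite /weight /= addbF /arc_edge au (eqP w); apply: red_refl.
apply: (red_trans (red_cons _ (IH (ahead a) isT w))).
by rewrite /arc_edge au; apply: red_split.
Qed.

Definition edge_list (g : E -> bool) : seq (wedge V) :=
  [seq ((ends e).1, (ends e).2, g e) | e <- enum E].

Lemma arcs_eqv t : perm_eq (map fst t) (enum E) -> eqv (edge_list gamma) (map arc_edge t).
Proof.
move=> p; exists [seq ((ends e).1, (ends e).2, gamma e) | e <- map fst t].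
  by apply: perm_map; rewrite perm_sym.
rewrite /reoriented -map_comp; elim: t {p} => //= a t ->; rewrite andbT.
rewrite /rev_rel /arc_edge /Defs.atail /Defs.ahead /erev /=.
by case: (a.2); rewrite eqxx ?orbT.
Qed.

(** Rotated to start at the root, a non-zero circuit contracts to one non-zero loop. *)
Lemma circuits_red b (D : seq (seq arc)) :
  all (fun c => circuit ends c && (weight gamma c && hits ends c b)) D ->
  red predT (map arc_edge (flatten D)) (nseq (size D) (b, b, true)).
Proof.
elim: D => [|c D IH] /=; first by move=> _; apply: red_refl.
move=> /andP[/andP[/walk_circuit[c0 _ [v w]] /andP[wc hb]] /IH{}IH].
rewrite map_cat -cat1s; apply: red_cat IH.
have [c' p w'] := rotate_walk w hb.
apply: (red_trans (red_perm _ (perm_map arc_edge p))).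
rewrite -wc (weight_perm p); apply: walk_red w'.
by rewrite -size_eq0 -(perm_size p) size_eq0.
Qed.

Definition edges_of (D : seq (seq arc)) : seq E := map fst (flatten D).

Lemma edges_of_perm D D' : perm_eq D D' -> perm_eq (edges_of D) (edges_of D').
Proof. by move=> p; apply/perm_map/perm_flatten. Qed.

Lemma edges_of_cons c D : edges_of (c :: D) = map fst c ++ edges_of D.
Proof. by rewrite /edges_of /= map_cat. Qed.

Lemma decomposition_edges D : circuit_decomposition ends D -> perm_eq (edges_of D) (enum E).
Proof.
move=> /andP[cD /forallP one]; apply/allP => e _ /=.
rewrite (count_uniq_mem _ (enum_uniq _)) mem_enum /= -(eqP (one e)).
elim: D cD {one} => //= c D IH /andP[/walk_circuit[_ uc _] /IH h].
by rewrite edges_of_cons count_cat (eqP h) (count_uniq_mem _ uc).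
Qed.

Lemma edges_decomposition D : all (circuit ends) D -> perm_eq (edges_of D) (enum E) ->
  circuit_decomposition ends D.
Proof.
move=> cD p; rewrite /circuit_decomposition cD /=; apply/forallP => e.
have : count_mem e (edges_of D) = 1.
  by rewrite (permP p) (count_uniq_mem _ (enum_uniq _)) mem_enum.
move=> <-; apply/eqP; elim: D cD {p} => //= c D IH /andP[/walk_circuit[_ uc _] /IH ->].
by rewrite edges_of_cons count_cat (count_uniq_mem _ uc).
Qed.

Lemma hits_perm s t x : perm_eq s t -> hits ends s x = hits ends t x.
Proof. by move=> st; rewrite /hits !has_count (permP st). Qed.

Definition good b (c : seq arc) := circuit ends c && (weight gamma c && hits ends c b).

(* Zero circuits are absorbed one at a time; connectivity provides one that meets
   a circuit through the root. *)
Lemma absorb b (Zs Ds : seq (seq arc)) : (forall u v, connect (adj ends) u v) -> Ds != [::] ->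
  all (good b) Ds -> all (fun c => circuit ends c && ~~ weight gamma c) Zs ->
  perm_eq (edges_of (Ds ++ Zs)) (enum E) ->
  exists D, [/\ all (good b) D, size D = size Ds & perm_eq (edges_of D) (enum E)].
Proof.
move=> conn; have [n] := ubnP (size Zs); elim: n Zs Ds => // n IH Zs Ds sZ D0 gD zZ p.
case: (eqVneq Zs [::]) => [Z0|Z0].
  by exists Ds; split=> //; move: p; rewrite Z0 cats0.
pose S := [set x | has (fun c => hits ends c x) Ds].
case: (boolP [exists x in S, has (fun c => hits ends c x) Zs]).
  move=> /existsP[x /andP[]]; rewrite inE => /hasP[d dD dx] /hasP[z zz zx].
  have /and3P[cd wd hd] : good b d by apply: (allP gD).
  have /andP[cz wz] := allP zZ z zz.
  have [d0 _ [u wu]] := walk_circuit cd; have [z0 _ [v wv]] := walk_circuit cz.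
  have [d' pd wd'] := rotate_walk wu dx; have [z' pz wz'] := rotate_walk wv zx.
  have pD := perm_to_rem dD; have pZ := perm_to_rem zz.
  set D1 := rem d Ds in pD; set Z1 := rem z Zs in pZ.
  have pe : perm_eq (edges_of (((d' ++ z') :: D1) ++ Z1)) (enum E).
    apply: perm_trans p; rewrite perm_sym.
    apply: (perm_trans (edges_of_perm (perm_cat pD pZ))).
    rewrite /= !edges_of_cons /edges_of !flatten_cat /= !map_cat.
    apply/permP => P; rewrite !count_cat (permP (perm_map fst pd)) (permP (perm_map fst pz)).
    by rewrite -!addnA; congr (_ + _); rewrite addnCA.
  have unew : uniq (map fst (d' ++ z')).
    have := enum_uniq E; rewrite -(perm_uniq pe) /= edges_of_cons cat_uniq.
    by case/andP.
  have gnew : good b (d' ++ z').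
    apply/and3P; split.
    - apply: (circuit_walk (v := x)) unew _; last exact: walk_cat wd' wz'.
      by move: d0; rewrite -!size_eq0 size_cat addn_eq0 (perm_size pd) negb_and => ->.
    - rewrite weight_cat -(weight_perm pd) -(weight_perm pz) wd.
      by rewrite (negbTE wz).
    - by rewrite /hits has_cat -/(hits _ d' b) -(hits_perm b pd) hd.
  have [||||D [gD' sD' pD']] := IH Z1 ((d' ++ z') :: D1) _ _ _ _ pe.
  - by move: sZ; rewrite (perm_size pZ).
  - by [].
  - by rewrite /= gnew /=; move: gD; rewrite (perm_all _ pD) => /andP[].
  - by move: zZ; rewrite (perm_all _ pZ) => /andP[].
  by exists D; split=> //; rewrite sD' (perm_size pD).
(* If no zero circuit meets [S], then [S] is closed under adjacency because every edge lies on some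
   circuit. By connectedness it is everything, yet it misses the first vertex of a zero circuit. *)
rewrite negb_exists => /forallP no; exfalso.
have noZ x z : x \in S -> z \in Zs -> hits ends z x = false.
  move=> xS zz; apply/negP => zx; have := no x; rewrite xS /= => /negP; apply.
  by apply/hasP; exists z.
have ends_hit c e x : e \in map fst c -> ((ends e).1 == x) || ((ends e).2 == x) -> hits ends c x.
  move=> /mapP[a ac ->] h; apply/hasP; exists a => //.
  by move: h; rewrite /Defs.atail /Defs.ahead; case: (a.2); rewrite // orbC.
have bS : b \in S.
  case: Ds D0 gD @S {p no noZ} => // d Ds _ /= /andP[/and3P[_ _ hd] _].
  by rewrite inE /= hd.
have clS : closed (adj ends) S.
  have half u w : adj ends u w -> u \in S -> w \in S.
    move=> /existsP[e he] uS.
    have [eu ew] : ((ends e).1 == u) || ((ends e).2 == u) /\ ((ends e).1 == w) || ((ends e).2 == w).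
      by case/orP: he => /eqP ->; rewrite !eqxx ?orbT.
    have : e \in edges_of (Ds ++ Zs) by rewrite (perm_mem p) mem_enum.
    move=> /mapP[a /flattenP[c]]; rewrite mem_cat => /orP[cD|cZ] ac ea.
      rewrite inE; apply/hasP; exists c => //; apply: ends_hit ew.
      by rewrite ea; apply: map_f.
    have : hits ends c u by apply: ends_hit eu; rewrite ea; apply: map_f.
    by rewrite noZ.
  have sym u w : adj ends u w = adj ends w u.
    by apply: eq_existsb => e; rewrite orbC.
  by move=> u w uw; apply/idP/idP; apply: half; rewrite // sym.
case: Zs Z0 zZ noZ {sZ p no} => // z Zs _ /= /andP[/andP[/walk_circuit[z0 _ _] _] _] noZ.
case: z z0 noZ => // a z _ noZ.
have aS : atail a \in S by rewrite -(closed_connect clS (conn b (atail a))).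
by have := noZ _ _ aS (mem_head _ _); rewrite /hits /= eqxx.
Qed.

Lemma size_decomposition D : all (circuit ends) D -> perm_eq (edges_of D) (enum E) -> size D <= #|E|.
Proof.
move=> cD p; rewrite cardE -(perm_size p) /edges_of size_map.
elim: D cD {p} => //= c D IH /andP[/walk_circuit[c0 _ _] /IH h].
by rewrite size_cat -add1n leq_add // lt0n size_eq0.
Qed.

(** Each edge starts as a one-arc trail, and trails are carried along the reduction. [0 < k]
    provides a circuit into which zero circuits can be absorbed. *)
Lemma flood_decomposition b (W : {set V}) k : (forall u v, connect (adj ends) u v) -> 0 < k ->
  flood b W (edge_list gamma) k ->
  exists D, [/\ all (good b) D, k <= size D & perm_eq (edges_of D) (enum E)].
Proof.
move=> conn k0 [L [rL lL cL]].
pose Z0 : seq (wedge V * seq arc) := [seq (((ends e).1, (ends e).2, gamma e), [:: (e, false)]) | e <- enum E].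
have Z0E : map fst Z0 = edge_list gamma by rewrite /Z0 -map_comp.
have rZ0 : all (fun z => realize z.1 z.2) Z0.
  rewrite all_map; apply/allP => e _ /=.
  by rewrite /realize /= /Defs.atail /Defs.ahead /weight /= !eqxx addbF eqxx.
have [Z [Cs [ZL rZ rC pE]]] := red_realize rL Z0E rZ0.
have {}pE : perm_eq (edges_of (map snd Z ++ Cs)) (enum E).
  apply: perm_trans (_ : perm_eq (map fst (flatten (map snd Z0))) _); first by rewrite perm_sym.
  rewrite /Z0 -map_comp; have -> : map fst (flatten [seq [:: (e, false)] | e <- enum E]) = enum E.
    by elim: (enum E) => //= e s ->.
  by [].
(* [Z2] holds the zero loops left at the root; with the deleted loops [Cs] they are the circuits to
   absorb. *)
pose Z1 := filter (fun z => z.1.2) Z; pose Z2 := filter (predC (fun z => z.1.2)) Z.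
have pZ : perm_eq Z (Z1 ++ Z2) by rewrite perm_sym; apply/permPl/perm_filterC.
have {}pE : perm_eq (edges_of (map snd Z1 ++ (map snd Z2 ++ Cs))) (enum E).
  apply: perm_trans pE; apply: edges_of_perm; rewrite catA perm_cat2r -map_cat perm_sym.
  exact: perm_map.
have uni c : c \in map snd Z1 ++ (map snd Z2 ++ Cs) -> uniq (map fst c).
  move=> cI; have := enum_uniq E; rewrite -(perm_uniq pE).
  by rewrite (perm_uniq (edges_of_perm (perm_to_rem cI))) edges_of_cons cat_uniq => /andP[].
have rZw z : z \in Z -> z.1.1 = (b, b) /\ realize z.1 z.2.
  move=> zZ; split; last exact: (allP rZ).
  by apply/eqP/(allP lL); rewrite -ZL; apply: map_f.
have goodZ1 : all (good b) (map snd Z1).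
  apply/allP => c cZ; have /mapP[z zZ cE] := cZ.
  move: zZ; rewrite mem_filter => /andP[z1 zZ]; have [zb /and3P[n w g]] := rZw z zZ.
  rewrite cE zb in n w g *; apply/and3P; split.
  - by apply: (circuit_walk n _ w); rewrite -cE; apply: uni; rewrite mem_cat cZ.
  - by rewrite (eqP g).
  - move: n w; case: (z.2) => //= a t _ /andP[/eqP h _].
    by rewrite /hits /= h eqxx.
have zeroZ2 : all (fun c => circuit ends c && ~~ weight gamma c) (map snd Z2 ++ Cs).
  apply/allP => c cI; have uc : uniq (map fst c) by apply: uni; rewrite mem_cat cI orbT.
  move: cI; rewrite mem_cat => /orP[/mapP[z zZ cE]|/rC[v /and3P[n w g]]].
    move: zZ; rewrite mem_filter => /andP[/= z1 zZ]; have [zb /and3P[n w g]] := rZw z zZ.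
    rewrite cE (eqP g) z1 andbT; rewrite zb in w.
    by apply: (circuit_walk n _ w); rewrite -cE.
  by rewrite (circuit_walk n uc w) (eqP g).
have sZ1 : k <= size (map snd Z1).
  apply: leq_trans cL _; rewrite -ZL count_map size_map size_filter.
  by [].
have Z10 : map snd Z1 != [::] by rewrite -size_eq0 -lt0n; apply: leq_trans sZ1.
have [D [gD sD pD]] := absorb conn Z10 goodZ1 zeroZ2 pE.
by exists D; split=> //; rewrite sD.
Qed.

End Trails.

(** * Certificates and the bound of the theorem *)

Section Refinement.
Variables (V M N : finType) (G : seq (wedge V)).
Variables (T1 : V -> option M) (T : V -> option N) (phi : M -> option N).
Hypotheses (ev : even_graph G) (vT1 : valid T1 G).
Hypothesis refines : forall u, T u = obind phi (T1 u).

Lemma refined_charge r : charge T G r = \sum_(c | phi c == Some r) charge T1 G c.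
Proof.
rewrite exchange_big /=; apply: eq_big_seq => e eG; have := allP vT1 e eG.
have i2 (o : option N) : incl o r = (o == Some r) by case: o.
have sum1 c0 (f : bool -> nat) : f false = 0 ->
    \sum_(c | phi c == Some r) f (c0 == c) = f (phi c0 == Some r).
  move=> f0; case pc: (phi c0 == Some r).
    by rewrite (bigD1 c0) //= eqxx big1 ?addn0 // => c /andP[_ /negbTE]; rewrite eq_sym => ->.
  by rewrite big1 ?f0 // => c pc'; case: eqP => // E; rewrite E pc' in pc.
rewrite /charge1 !refines !i2 /vedge.
case: (T1 e.1.1) => [a|]; case: (T1 e.1.2) => [c|] //=.
- by move=> /eqP <-; rewrite (sum1 a (fun x => (x || x) * e.2.*2 + (x (+) x))).
- by move=> _; rewrite (sum1 a (fun x => (x || false) * e.2.*2 + (x (+) false))).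
- by move=> _; rewrite (sum1 c (fun x => (false || x) * e.2.*2 + (false (+) x))).
- by rewrite big1.
Qed.

(** The charge of a coarse class is the sum over its parts; if it is 2 modulo 4, some part has
    charge 2 modulo 4 as well. *)
Lemma refined_nodd : nodd T G <= nodd T1 G.
Proof.
apply: (@leq_trans (\sum_(r : N) \sum_(c | phi c == Some r) (charge T1 G c %% 4 == 2))).
  apply: leq_sum => r _; case o: (_ == 2) => //; rewrite lt0n; apply: contraTneq o => s0.
  rewrite refined_charge; suff : \sum_(c | phi c == Some r) charge T1 G c = 0 %[mod 4] by move=> ->.
  apply: (big_ind (fun n => n = 0 %[mod 4])) => // [m n|c pc]; first by clear; lia.
  have := charge_even T1 c ev; move/eqP: s0; rewrite sum_nat_eq0 => /forall_inP/(_ c pc).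
  by move: (charge _ _ _); clear; lia.
rewrite (exchange_big_dep xpredT) //=; apply: leq_sum => c _.
case: (phi c) => [r0|]; last by rewrite big1.
by rewrite (bigD1 r0) //= big1 ?addn0 // => r /andP[/eqP[->]]; rewrite eqxx.
Qed.

End Refinement.

(* Every odd class has at least two outgoing edges. *)
Lemma ok0 (V : finType) (b : V) W G : instance b W G -> ok 0 W G.
Proof.
move=> inst s N T off vT; have inst' := instance_shift s inst.
have vT' : valid T (shift s G) by rewrite valid_shift.
rewrite add0n; set H := shift s G in inst' vT' *.
have h : (nodd T H).*2 <= \sum_r ncross H T r.
  rewrite -mul2n big_distrr /=; apply: leq_sum => r _.
  case o: (_ == 2) => //; exact: (odd_class_cross inst' off).
apply: leq_trans h _; rewrite exchange_big /= /cost big_seq [leqRHS]big_seq.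
apply: leq_sum => e /(allP vT'); rewrite /vedge /cost1.
under eq_bigr do rewrite !inE.
have sum1 r0 (f : N -> bool) : (forall r, f r = (r0 == r)) -> \sum_r f r = 1.
  move=> fE; rewrite (bigD1 r0) //= fE eqxx big1 ?addn0 // => r rr0.
  by rewrite fE eq_sym (negbTE rr0).
case: (T e.1.1) => [a|]; case: (T e.1.2) => [c|] /=.
- by move=> /eqP ->; rewrite big1 // => r _; rewrite addbb.
- by rewrite (sum1 a) // => r; rewrite addbF.
- by rewrite (sum1 c).
- by rewrite big1.
Qed.

(** * Components, shiftings and the bound of the theorem *)

Section Bound.
Variables (V E : finType) (ends : E -> V * V).
Hypothesis Heul : eulerian ends.
Implicit Types (g : E -> bool) (X : {set V}).

Lemma edge_list_deg g x : deg (edge_list ends g) x = degree ends x.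
Proof. by rewrite /deg big_map big_enum. Qed.

Lemma edge_list_even g : even_graph (edge_list ends g).
Proof. by move=> x; rewrite edge_list_deg; apply: Heul.2. Qed.

Lemma edge_list_instance g b : instance b (~: [set b]) (edge_list ends g).
Proof.
split; first by rewrite !inE eqxx.
- by apply/allP => e _; rewrite /ends_in !inE !orNb.
- exact: edge_list_even.
(* In a connected graph the only closed set without the root is the empty one. *)
- move=> K bK cK; suff K0 : K = set0.
    by rewrite big1 // => e _; rewrite K0 inE.
  apply/setP => x; rewrite inE; apply: contraNF bK => xK.
  rewrite (closed_connect (a := K) _ (Heul.1 b x)) // => u w /existsP[e he].
  have := allP cK ((ends e).1, (ends e).2, g e).
  rewrite map_f ?mem_enum // => /(_ isT)/eqP /=.
  by case/orP: he => /eqP ->.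
Qed.

Definition comp X u : {set V} := [set v | connect (adj_minus ends X) u v].
(** Components serve as their own names, so class names range over all vertex sets; a set that is no
    component has charge 0 and is never odd. *)
Definition comp_cert X u : option {set V} := if u \in X then None else Some (comp X u).

Lemma adj_minus_sym X : connect_sym (adj_minus ends X).
Proof.
apply: sym_connect_sym => u w; rewrite /adj_minus [(u \notin X) && _]andbC.
by congr (_ && _); apply: eq_existsb => e; rewrite orbC.
Qed.

Lemma comp_eq X u w : connect (adj_minus ends X) u w -> comp X u = comp X w.
Proof.
move=> uw; apply/setP => x; rewrite !inE.
by rewrite !(adj_minus_sym X _ x) (same_connect_r (adj_minus_sym X) uw).
Qed.

Lemma comp_mem X u : u \in comp X u. Proof. by rewrite inE. Qed.

Lemma connect_out X u w : u \notin X -> connect (adj_minus ends X) u w -> w \notin X.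
Proof.
move=> uX /(closed_connect (a := ~: X)); rewrite !inE uX => <- //.
by move=> x y /andP[/andP[xX yX] _]; rewrite !inE xX yX.
Qed.

Lemma comp_cert_comp X C u : C \in components_minus ends X ->
  (comp_cert X u == Some C) = (u \in C).
Proof.
move=> /imsetP[u0]; rewrite inE => u0X ->; rewrite -/(comp X u0) /comp_cert.
case: ifP => uX.
  by apply/esym/negbTE; apply: contraTN uX; rewrite inE => /(connect_out u0X).
apply/eqP/idP => [[<-]|]; first exact: comp_mem.
by rewrite inE => /comp_eq ->.
Qed.

Lemma comp_valid X g : valid (comp_cert X) (edge_list ends g).
Proof.
apply/allP => _ /mapP[e _ ->]; rewrite /vedge /comp_cert /=.
case: ifP => // uX; case: ifP => // vX; apply/eqP/comp_eq/connect1.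
rewrite /adj_minus uX vX; apply/existsP; exists e.
by case: (ends e) => p q; rewrite eqxx.
Qed.

Lemma sum_card (P : pred E) : \sum_(e <- enum E) P e = #|[set e | P e]|.
Proof.
rewrite big_enum /= -sum1_card big_mkcond [RHS]big_mkcond; apply: eq_bigr => e _.
by rewrite inE; case: (P e).
Qed.

Lemma comp_cost X g : cost (comp_cert X) (edge_list ends g) =
  (gcount g (E_in ends X)).*2 + #|delta ends X|.
Proof.
rewrite /cost big_map /gcount /delta /E_in.
have -> : [set e in [set e | ((ends e).1 \in X) && ((ends e).2 \in X)] | g e] =
    [set e | [&& (ends e).1 \in X, (ends e).2 \in X & g e]].
  by apply/setP => e; rewrite !inE andbA.
rewrite -!sum_card -mul2n big_distrr -big_split /=; apply: eq_bigr => e _.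
rewrite /cost1 /comp_cert /= mul2n.
by case: (_ \in X); case: (_ \in X); case: (g e).
Qed.

Lemma delta_even X : ~~ odd #|delta ends X|.
Proof.
have := even_cut_graph (fun x => x \in X) (edge_list_even (fun=> false)).
by rewrite big_map sum_card.
Qed.

Lemma comp_charge X g C : C \in components_minus ends X ->
  charge (comp_cert X) (edge_list ends g) C =
  (gcount g (E_in ends C :|: delta ends C)).*2 + #|delta ends C|.
Proof.
move=> CX; rewrite /charge big_map /gcount /delta /E_in.
have -> : [set e in [set e | ((ends e).1 \in C) && ((ends e).2 \in C)] :|:
    [set e | ((ends e).1 \in C) (+) ((ends e).2 \in C)] | g e] =
    [set e | (((ends e).1 \in C) || ((ends e).2 \in C)) && g e].
  by apply/setP => e; rewrite !inE; case: (_ \in C); case: (_ \in C).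
rewrite -!sum_card -mul2n big_distrr -big_split /=; apply: eq_bigr => e _.
have iE u : incl (comp_cert X u) C = (u \in C).
  by rewrite -(comp_cert_comp _ CX); case: (comp_cert X u).
rewrite /charge1 /= !iE mul2n.
by case: (_ \in C); case: (_ \in C); case: (g e).
Qed.

Lemma comp_nodd X g : nodd (comp_cert X) (edge_list ends g) = odd_components ends g X.
Proof.
rewrite /nodd /odd_components -sum1_card [RHS]big_mkcond; apply: eq_bigr => C _.
rewrite inE; case CX: (C \in components_minus ends X) => /=.
  rewrite comp_charge // /gamma_odd; have := delta_even C.
  move: (gcount _ _) #|_| => m d; clear => ev.
  by case: ifP; lia.
rewrite /charge big1 // => e _; rewrite /charge1.
have iE u : incl (comp_cert X u) C = false.
  apply: contraFF CX => h; have : comp_cert X u = Some C.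
    by move: h; case: (comp_cert X u) => //= a /eqP ->.
  by rewrite /comp_cert; case: ifP => // uX [<-]; apply: imset_f; rewrite inE uX.
by rewrite !iE.
Qed.

(** [delta] is even in an Eulerian graph, so halving it is exact and nothing is lost by doubling. *)
Lemma bound_valueE X g (k : nat) : (k%:Z <= bound_value ends g X)%R =
  (k.*2 + (nodd (comp_cert X) (edge_list ends g)).*2 <= cost (comp_cert X) (edge_list ends g)).
Proof.
rewrite comp_nodd comp_cost /bound_value; have := delta_even X.
move: (gcount _ _) #|_| (odd_components _ _ _) => m d n; clear => ev.
by apply/idP/idP; lia.
Qed.

Definition shifted g (s : V -> bool) e := g e (+) (s (ends e).1 (+) s (ends e).2).

(** Shifting twice at a vertex cancels, so only the parity [s] of the number of shifts at each
    vertex matters. *)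
Lemma shifting_shifted g g' : is_shifting ends g g' -> exists s, g' =1 shifted g s.
Proof.
move=> [vs]; elim: vs g => [|v vs IH] g /=.
  by move=> h; exists (fun=> false) => e; rewrite h /shifted !addbF.
move=> /IH[s hs]; exists (fun x => s x (+) (x == v)) => e; rewrite hs /shifted /shift_at.
case: (eqVneq (ends e).1 (ends e).2) => [->|nE] /=.
  by rewrite !addbb.
have nb : ((ends e).1 == v) && ((ends e).2 == v) = false.
  by apply/negP => /andP[/eqP h1 /eqP h2]; rewrite h1 h2 eqxx in nE.
move: nb; case: (_ == v); case: (_ == v) => //= _;
by case: (g e); case: (s _); case: (s _).
Qed.

Lemma shifted_shifting g s : is_shifting ends g (shifted g s).
Proof.
have sE x : s x = odd (count_mem x (enum [set x | s x])).
  by rewrite (count_uniq_mem _ (enum_uniq _)) mem_enum inE; case: (s x).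
exists (enum [set x | s x]) => e; rewrite /shifted 2!{1}sE.
elim: (enum _) g => [|v vs IH] g /=; first by rewrite addbF.
rewrite -IH /shift_at !oddD.
case: (eqVneq (ends e).1 (ends e).2) => [->|nE] /=.
  by rewrite !addbb.
have nb : (v == (ends e).1) && (v == (ends e).2) = false.
  by apply/negP => /andP[/eqP h1 /eqP h2]; rewrite -h1 -h2 eqxx in nE.
move: nb; rewrite ![_ == v]eq_sym; case: (v == _); case: (v == _) => //= _;
by case: (g e); case: (odd _); case: (odd _).
Qed.

Lemma edge_list_shift g s : edge_list ends (shifted g s) = shift s (edge_list ends g).
Proof. by rewrite /shift -map_comp. Qed.

Lemma eq_bound_value g g' X : g =1 g' -> bound_value ends g X = bound_value ends g' X.
Proof. by move=> /funext ->. Qed.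

Lemma comp_off (b : V) X u : b \in X -> u \notin ~: [set b] -> comp_cert X u = None.
Proof. by rewrite !inE negbK /comp_cert => bX /eqP ->; rewrite bX. Qed.

(** The cost depends only on X, and the components of G - X refine the classes of any valid
    certificate with that X; so components give the smallest bound. *)
Lemma ok_bound g b k : ok k (~: [set b]) (edge_list ends g) <->
  forall s X, b \in X -> (k%:Z <= bound_value ends (shifted g s) X)%R.
Proof.
split=> [okk s X bX|h s N T off vT].
  rewrite bound_valueE edge_list_shift; apply: okk; last exact: comp_valid.
  by move=> u; apply: comp_off.
pose X := [set u | T u == None].
have bX : b \in X by rewrite inE off // !inE eqxx.
have := h s X bX; rewrite bound_valueE edge_list_shift => h1.
have cE : cost (comp_cert X) (shift s (edge_list ends g)) = cost T (shift s (edge_list ends g)).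
  apply: eq_bigr => e _; rewrite /cost1 /comp_cert !inE.
  by case: (T e.1.1) => [a|]; case: (T e.1.2).
suff : nodd T (shift s (edge_list ends g)) <= nodd (comp_cert X) (shift s (edge_list ends g)).
  by move: h1; rewrite cE; move: (nodd _ _) (nodd _ _) (cost _ _); clear; lia.
pose phi (C : {set V}) := if [pick u in C] is Some u then T u else None.
apply: (@refined_nodd _ _ _ _ _ _ phi).
- by apply: even_shift; apply: edge_list_even.
- by rewrite valid_shift; apply: comp_valid.
move=> u; rewrite /comp_cert inE; case: eqP => [-> //|Tu] /=; rewrite /phi.
case: pickP => [w|/(_ u)]; last by rewrite comp_mem.
rewrite inE => uw; apply/eqP; rewrite eq_sym.
suff cl : closed (adj_minus ends X) [pred x | T x == T u].
  by have := closed_connect cl uw; rewrite !inE eqxx => <-.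
move=> x y /andP[/andP[xX yX] /existsP[e he]]; rewrite !inE.
have := allP vT ((ends e).1, (ends e).2, g e); rewrite map_f ?mem_enum // => /(_ isT).
move: xX yX; rewrite !inE /vedge.
by case/orP: he => /eqP -> /=; case: (T x) => // a; case: (T y) => // c _ _ /eqP ->.
Qed.

(** The decomposition reduces to [size D] non-zero root loops, where every certificate with the root
    in X has doubled bound [(size D).*2]. *)
Lemma flooding_ok g b D : flooding_decomposition ends g b D ->
  ok (size D) (~: [set b]) (edge_list ends g).
Proof.
move=> [dD gD] s N T off vT.
have cD : all (circuit ends) D by case/andP: dD.
have r : red predT (edge_list ends g) (nseq (size D) (b, b, true)).
  apply: (red_trans (eqv_red predT (arcs_eqv ends g (decomposition_edges dD)))).
  apply: circuits_red; apply/allP => c cin; have := allP gD c cin => ->.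
  by rewrite (allP cD).
have r' := red_map s (g := id) (A' := predT) (fun _ _ => isT) r.
have vT' : valid T (shift s (edge_list ends g)) by rewrite valid_shift.
have [T' [n' v' h]] := red_bound r' (even_shift s (edge_list_even g)) vT'.
have T'b : T' b = None by apply/eqP; rewrite n' off // !inE eqxx.
move: h; have -> : map (emap id s) (nseq (size D) (b, b, true)) = nseq (size D) (b, b, true).
  by rewrite map_nseq /emap /= addbb.
have -> : cost T' (nseq (size D) (b, b, true)) = (size D).*2.
  elim: (size D) => [|n IH]; first by rewrite /cost big_nil.
  by rewrite /= cost_cons IH /cost1 /= T'b.
have -> : nodd T' (nseq (size D) (b, b, true)) = 0; last by rewrite addn0.
rewrite /nodd big1 // => r0 _; rewrite /charge big1_seq // => e /= /nseqP[-> _].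
by rewrite /charge1 /= T'b.
Qed.

End Bound.

Lemma ok_leq (V : finType) (W : {set V}) G k k' : k' <= k -> ok k W G -> ok k' W G.
Proof.
move=> kk h s N T off vT; apply: leq_trans (h s N T off vT).
by rewrite leq_add2r leq_double.
Qed.

(** The certificate with X everything already caps [k]. *)
Lemma ok_max (V : finType) (W : {set V}) G : ok 0 W G ->
  exists k, ok k W G /\ ~ ok k.+1 W G.
Proof.
move=> h0; apply: contrapT => no.
have all k : ok k W G.
  elim: k => // k IH; apply: contrapT => nk; apply: no; exists k; by [].
pose T (u : V) : option unit := None.
have vT : valid T G by apply/allP.
have := all (cost T G).+1 (fun=> false) _ T (fun _ _ => erefl) vT.
rewrite shift0; move: (nodd _ _) (cost _ _) => n c; clear; lia.
Qed.

(** * The flooding number as the largest valid bound *)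

Section Number.
Variables (V E : finType) (ends : E -> V * V) (gamma : E -> bool) (b : V).
Hypothesis Heul : eulerian ends.

Lemma flooding_number_ok k :
  let W := ~: [set b] in let G := edge_list ends gamma in
  ok k W G -> ~ ok k.+1 W G -> flooding_number ends gamma b = k.
Proof.
move=> W G okk nok; apply/eqP; rewrite eqn_leq; apply/andP; split.
  apply/bigmax_leqP => i /asboolP[D [fD sD]].
  rewrite leqNgt; apply/negP => ki; apply: nok; apply: ok_leq ki _.
  by rewrite -sD; apply: flooding_ok.
(* For [k = 0] there is nothing to exhibit, in accordance with the default value 0 when no
   decomposition exists. *)
case: (posnP k) => [->//|k0].
have [D [gD kD pD]] := flood_decomposition Heul.1 k0
  (flood_exists (edge_list_instance Heul gamma b) okk).
have cD : all (circuit ends) D by apply: sub_all gD => c /andP[].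
have sD : size D < #|E|.+1 by rewrite ltnS; apply: (size_decomposition cD pD).
apply: leq_trans kD _.
apply: (leq_bigmax_cond (F := fun i : 'I_ _ => nat_of_ord i) (Ordinal sD)).
apply/asboolP; exists D; split=> //; split; first exact: edges_decomposition.
by apply: sub_all gD => c /andP[].
Qed.

End Number.

Local Open Scope ring_scope.

Theorem mainTheorem1 (V E : finType) (ends : E -> V * V) (gamma : E -> bool)
    (b : V) (Heul : eulerian ends) :
  (exists (gamma' : E -> bool) (X : {set V}),
      is_shifting ends gamma gamma' /\ b \in X /\
      (flooding_number ends gamma b)%:Z = bound_value ends gamma' X) /\
  (forall (gamma' : E -> bool) (X : {set V}),
      is_shifting ends gamma gamma' -> b \in X ->
      (flooding_number ends gamma b)%:Z <= bound_value ends gamma' X).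
Proof.
have [k [okk nok]] := ok_max (ok0 (edge_list_instance Heul gamma b)).
rewrite (flooding_number_ok Heul okk nok).
have okB := (ok_bound Heul gamma b k).1 okk.
split=> [|g X /shifting_shifted[s gs] bX]; last first.
  by rewrite (eq_bound_value _ _ gs); apply: okB.
have [s [X [bX lt]]] : exists s (X : {set V}), b \in X /\ ~ (k.+1%:Z <= bound_value ends (shifted ends gamma s) X).
  apply: contrapT => no; apply: nok; apply/(ok_bound Heul) => s X bX.
  by apply: contrapT => h; apply: no; exists s, X.
exists (shifted ends gamma s), X; split; first exact: shifted_shifting.
(* An integer that is at least [k] and not at least [k.+1] equals [k]. *)
split=> //; have := okB s X bX; move: lt.
by move: (bound_value _ _ _) => v; clear; lia.
Qed.
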